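(* There exist a number $N_3$ and a sequence $\{\gamma_k\}$ with $\gamma_k\to0$ as $k\to\infty$ such that, for every $k>N_3$, any spectral gap $(\alpha,\beta)$ of $L(Q)$ lying in \[ U(k)=\left((\pi k)^2+\mu_1-\varepsilon(k-1),\ (\pi k)^2+\mu_p+\varepsilon(k)\right) \] is contained in the intersection of the sets $S(1,k),S(2,k),\ldots,S(p,k)$, where \[ S(j,k)=\bigcup_{i=1}^{p}\left((\pi k)^2+\frac{\mu_i+\mu_j}{2}-\gamma_k,\ (\pi k)^2+\frac{\mu_i+\mu_j}{2}+\gamma_k\right). \]
   Context: Let $m\geq 1$ and let $Q(x)=(q_{s,j}(x))$ be an $m\times m$ matrix function on $(-\infty,\infty)$, Hermitian for all $x$, with complex-valued locally square summable entries and $Q(x+1)=Q(x)$. $L(Q)$ is the (self-adjoint) operator generated in $L_2^m(-\infty,\infty)$ (vector functions with $m$ components in $L_2(-\infty,\infty)$) by $-y''+Qy$. For $t\in(-\pi,\pi]$, $L_t(Q)$ is the operator generated in $L_2^m[0,1]$ by $-y''+Qy$ and the quasiperiodic conditions $y(1)=e^{it}y(0)$, $y'(1)=e^{it}y'(0)$. Its eigenvalues (Bloch eigenvalues), counted with multiplicity, are $\lambda_1(t)\leq\lambda_2(t)\leq\cdots$. The $n$-th band is $I_n(Q)=\{\lambda_n(t):t\in(-\pi,\pi]\}$, and $\sigma(L(Q))=\bigcup_{n\ge1}I_n(Q)$. The (nonempty) open intervals between consecutive bands $I_n(Q)$ and $I_{n+1}(Q)$, if they exist, are called the gaps in the spectrum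 of $L(Q)$ (spectral gaps). Let $C=\int_{[0,1]}Q(x)\,dx$, a Hermitian matrix, with distinct eigenvalues $\mu_1<\mu_2<\cdots<\mu_p$. The eigenvalues of $L_t(C)$ are $\mu_{k,j}(t)=(2\pi k+t)^2+\mu_j$, $k\in\mathbb Z$, $j=1,\ldots,p$. For integers $k\neq0$ set $\varepsilon_k=c_1\left(\left|\frac{\ln|k|}{k}\right|+q_k\right)$, where \[ q_k=\max\left\{\left|\int_{[0,1]}q_{s,r}(x)e^{-2\pi i n x}dx\right| : s,r=1,\ldots,m;\ n=\pm2k,\pm(2k+1)\right\}, \] and $c_1$ is a fixed positive constant, independent of $t$, $\varepsilon$ and $k$, with the following (known) property: there is $N$, independent of $t$ and $\varepsilon$, such that for all $t\in(-\pi,\pi]$ and $\varepsilon\in[0,1]$ all large eigenvalues (above a threshold independent of $t,\varepsilon$) of $L_t(C+\varepsilon(Q-C))$ lie in the union of the intervals $(\mu_{k,j}(t)-\varepsilon_k,\mu_{k,j}(t)+\varepsilon_k)$, $|k|\geq N$, $j=1,\ldots,p$; moreover for each large eigenvalue $\mu_{k,j}(t)$ of $L_t(C)$ there is an eigenvalue of $L_t(Q)$ in $(\mu_{k,j}(t)-\varepsilon_k,\mu_{k,j}(t)+\varepsilon_k)$. Finally, $\varepsilon(s)=\varepsilon_k$ if $s\in\{2k,2k+1\}$. *)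

(* Defs.v *)
From HB Require Import structures.
From mathcomp Require Import all_boot all_order all_algebra.
From mathcomp Require Import all_classical all_reals all_analysis.
From mathcomp Require Export complex.
Set Implicit Arguments.
Unset Strict Implicit.
Unset Printing Implicit Defensive.
Import Order.TTheory GRing.Theory Num.Theory.
Import numFieldNormedType.Exports.

Local Open Scope classical_set_scope.
Local Open Scope ring_scope.
Local Open Scope complex_scope.

Section ComplexFunctions.
Context {R : realType}.
Notation mu := (@lebesgue_measure R).

Definition expi (x : R) : R[i] := cos x +i* sin x.

Definition cintegral (a b : R) (f : R -> R[i]) : R[i] :=
  (\int[mu]_(x in `[a, b]) complex.Re (f x)) +i*
  (\int[mu]_(x in `[a, b]) complex.Im (f x)).

Definition cmeasurable (a b : R) (f : R -> R[i]) : Prop :=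
  measurable_fun `[a, b] (fun x => complex.Re (f x)) /\
  measurable_fun `[a, b] (fun x => complex.Im (f x)).

Definition integrable_on (a b : R) (f : R -> R[i]) : Prop :=
  cmeasurable a b f /\
  mu.-integrable `[a, b] (fun x => (Normc.normc (f x))%:E).

Definition square_integrable_on (a b : R) (f : R -> R[i]) : Prop :=
  cmeasurable a b f /\
  mu.-integrable `[a, b] (fun x => ((Normc.normc (f x)) ^+ 2)%:E).

(* f is absolutely continuous on [0, 1] and f' = g almost everywhere:
   absolute continuity is expressed as being an indefinite Lebesgue integral. *)
Definition ac_deriv (f g : R -> R[i]) : Prop :=
  integrable_on 0 1 g /\
  forall x : R, 0 <= x <= 1 -> f x = f 0 + cintegral 0 x g.

End ComplexFunctions.

Section QuasiperiodicOperator.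
Context {R : realType} {m : nat}.
Notation mu := (@lebesgue_measure R).
Implicit Types (Q : R -> 'M[R[i]]_m) (y f : R -> 'cV[R[i]]_m) (t l : R).

(* The graph of L_t(Q): y is in the domain of L_t(Q) and L_t(Q) y = f in
   L_2^m[0, 1].  The domain consists of the y such that y and y' are absolutely
   continuous on [0, 1], - y'' + Q y is in L_2^m[0, 1], and the quasiperiodic
   conditions hold; y1 is y' (everywhere on [0, 1], being continuous) and y2 is
   a representative of y''.  Only the values on [0, 1] matter. *)
Definition Lt Q t y f : Prop :=
  exists y1 y2 : R -> 'cV[R[i]]_m,
    [/\ forall s, ac_deriv (fun x => y x s ord0) (fun x => y1 x s ord0) /\
                  ac_deriv (fun x => y1 x s ord0) (fun x => y2 x s ord0),
        y 1 = expi t *: y 0 /\ y1 1 = expi t *: y1 0,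
        forall s, square_integrable_on 0 1 (fun x => f x s ord0) &
        {ae mu, forall x : R, 0 <= x <= 1 -> f x = - y2 x + Q x *m y x}].

Definition in_eigenspace Q t l y : Prop := Lt Q t y (fun x => l%:C *: y x).

(* L_t(Q) is self-adjoint, so only real l are considered. *)
Definition is_eigenvalue Q t l : Prop :=
  exists2 y, in_eigenspace Q t l y & exists2 x : R, 0 <= x <= 1 & y x != 0.

(* The eigenspace has dimension d, functions being identified when they agree
   on [0, 1]; d = 0 means that l is not an eigenvalue. *)
Definition has_multiplicity Q t l (d : nat) : Prop :=
  exists y : 'I_d -> R -> 'cV[R[i]]_m,
    [/\ forall i, in_eigenspace Q t l (y i),
        forall c : 'I_d -> R[i],
          (forall x : R, 0 <= x <= 1 -> \sum_(i < d) c i *: y i x = 0) ->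
          forall i, c i = 0 &
        forall z, in_eigenspace Q t l z ->
          exists c : 'I_d -> R[i],
            forall x : R, 0 <= x <= 1 -> z x = \sum_(i < d) c i *: y i x].

(* lam is the sequence of all eigenvalues of L_t(Q), counted with multiplicity
   and in nondecreasing order; it is indexed from 0. *)
Definition eigenvalue_sequence Q t (lam : nat -> R) : Prop :=
  nondecreasing_seq lam /\
  forall l, exists2 d, has_multiplicity Q t l d & ([set n | lam n = l] #= `I_d)%card.

End QuasiperiodicOperator.

Section Bands.
Context {R : realType}.
Implicit Type lam : R -> nat -> R.

Definition band lam (n : nat) : set R := [set lam t n | t in [set t : R | - pi < t <= pi]].

(* ]a, b[ is the nonempty open interval between two consecutive bands. *)
Definition spectral_gap lam (a b : R) : Prop :=
  a < b /\
  exists n, supremums (band lam n) a /\ infimums (band lam n.+1) b.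

End Bands.

Section Asymptotics.
Context {R : realType} {m : nat}.
Implicit Types (Q : R -> 'M[R[i]]_m) (t : R) (k : int).

Definition mean Q : 'M[R[i]]_m :=
  \matrix_(s, r) cintegral 0 1 (fun x => Q x s r).

Definition fourier_coef (f : R -> R[i]) (n : int) : R[i] :=
  cintegral 0 1 (fun x => f x * expi (- (2 * pi * n%:~R * x))).

(* The maximum is over a nonempty set of nonnegative numbers if 0 < m, so the
   default value 0 of the iterated maximum plays no role. *)
Definition qmax Q k : R :=
  \big[Num.max/0]_(s < m) \big[Num.max/0]_(r < m)
    \big[Num.max/0]_(n <- [:: 2 * k; - (2 * k); 2 * k + 1; - (2 * k + 1)])
      Normc.normc (fourier_coef (fun x => Q x s r) n).

(* Meaningful for k != 0 only. *)
Definition eps (c1 : R) Q k : R :=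
  c1 * (`| ln `|k%:~R| / k%:~R | + qmax Q k).

Definition eps_half (c1 : R) Q (s : nat) : R := eps c1 Q (s./2)%:Z.

Definition free_eigenvalue p (mu : 'I_p -> R) k (j : 'I_p) t : R :=
  (2 * pi * k%:~R + t) ^+ 2 + mu j.

Definition homotopy Q (e : R) (x : R) : 'M[R[i]]_m :=
  mean Q + e%:C *: (Q x - mean Q).

Definition localization_constant Q p (mu : 'I_p -> R) (c1 : R) : Prop :=
  0 < c1 /\
  exists (N : nat) (L : R),
    [/\ (0 < N)%N,
        forall t e l : R, - pi < t <= pi -> 0 <= e <= 1 ->
          is_eigenvalue (homotopy Q e) t l -> L < l ->
          exists k j, (N <= `|k|)%N /\
            free_eigenvalue mu k j t - eps c1 Q k < l
              < free_eigenvalue mu k j t + eps c1 Q k &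
        forall (t : R) k j, - pi < t <= pi -> k != 0 ->
          L < free_eigenvalue mu k j t ->
          exists2 l, is_eigenvalue Q t l &
            free_eigenvalue mu k j t - eps c1 Q k < l
              < free_eigenvalue mu k j t + eps c1 Q k].

(* U(k) and S(j, k); mu is indexed from 0, so mu_1 and mu_p are the values at
   ord0 and ord_max. *)
Definition Uset Q p (mu : 'I_p.+1 -> R) (c1 : R) (k : nat) : set R :=
  `](pi * k%:R) ^+ 2 + mu ord0 - eps_half c1 Q k.-1,
    (pi * k%:R) ^+ 2 + mu ord_max + eps_half c1 Q k[%classic.

Definition Sset p (mu : 'I_p.+1 -> R) (gamma : nat -> R) (j : 'I_p.+1)
    (k : nat) : set R :=
  \bigcup_(i in [set: 'I_p.+1])
    `](pi * k%:R) ^+ 2 + (mu i + mu j) / 2 - gamma k,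
      (pi * k%:R) ^+ 2 + (mu i + mu j) / 2 + gamma k[%classic.

End Asymptotics.

(* Main.v *)
Require Import Defs.
From HB Require Import structures.
From mathcomp Require Import all_boot all_order all_algebra.
From mathcomp Require Import all_classical all_reals all_analysis.
From mathcomp Require Import measurable_realfun complex.
From mathcomp Require Import ring lra zify.
Set Implicit Arguments.
Unset Strict Implicit.
Unset Printing Implicit Defensive.
Import Order.TTheory GRing.Theory Num.Theory.
Import numFieldNormedType.Exports.
Local Open Scope classical_set_scope.
Local Open Scope ring_scope.
Local Open Scope complex_scope.

(** Let a = (pi k)^2 and let x be a point of a gap inside U(k).  Suppose that
    for some j the point x keeps a fixed distance delta from all the points
    a + (mu_i + mu_j) / 2.  For large k this is impossible, and letting delta
    tend to 0 with k gives the sequence gamma.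

    The reason is a crossing argument.  In the extended quasimomentum s, the
    branch s^2 + mu_j of free eigenvalues passes through x near s = pi k.  The
    other free eigenvalues close to a at that moment are the branches
    s^2 + mu_i, at distance |mu_i - mu_j| from x, and the folded branches
    (s - 2 pi k)^2 + mu_i, at distance about 2 |x - a - (mu_i + mu_j) / 2|.
    So all of them stay away from x, while the branch j moves from just below
    x to just above x when s moves by a small multiple of 1 / k
    ([branch_avoids_window]).  All Bloch eigenvalues lie close to free ones and
    the remainders eps_k tend to 0 ([eps_cvg0], by the Riemann-Lebesgue lemma).
    Because x lies in a gap, there is one index n such that, for every
    quasimomentum, lambda_n is the largest eigenvalue below x
    ([gap_counting]).  Before the crossing an eigenvalue lies just below x, so
    lambda_n is close to x; after the crossing a whole window below x is free
    of eigenvalues, so lambda_n is below the window.  Hence lambda_n jumps,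
    whereas it depends continuously on the quasimomentum: it moves by at most
    2 |d| sqrt (2 (lambda_n + C)) + d^2 when the quasimomentum moves by d
    ([eigenvalue_lipschitz]), which is less than the window.

    The continuity estimate is a min-max argument.  Multiplication by e^{idx}
    maps the domain of L_t(Q) onto that of L_{t+d}(Q) and changes the quadratic
    form of L by a term controlled by |y'|.  Apply it to a combination of the
    first n + 1 eigenfunctions at t that is orthogonal, after multiplication,
    to the first n eigenfunctions at t + d.  What is needed is that a vector
    orthogonal to all eigenfunctions with eigenvalue below z satisfies
    <Lv, v> >= z |v|^2 ([variational_bound]).

    This last fact is proved without compactness.  Let s be the largest number
    up to z for which <Lv, v> >= s |v|^2 holds on the vectors v in question,
    which exists because L is bounded below ([derivative_bound]).  If s < z,
    then L - s has a bounded right inverse on these vectors: one solves the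
    differential equation and adjusts the initial data, which is a finite
    linear system whose solvability is a symplectic Fredholm alternative
    ([bounded_resolvent]).  The Cauchy-Schwarz inequality for the nonnegative
    form <(L - s)v, v> then bounds that form below by a positive multiple of
    |v|^2, so s was not the largest.

    All of this is done for real systems: C^m is read as a real space indexed by
    pairs of a coordinate and a real or imaginary part, so that a Hermitian
    potential becomes a symmetric one and e^{it} an orthogonal matrix
    ([Lt_op_graph]). *)

(** * Integrable functions and primitives on the unit interval *)

Section UnitInterval.
Context {R : realType}.
Notation leb := (@lebesgue_measure R).
Implicit Types (f g h : R -> R) (x : R).

Definition unit_itv : set R := `[0, 1]%classic.
Local Notation I := unit_itv.

Definition L1 f := leb.-integrable I (EFin \o f).
Definition L2 f := measurable_fun I f /\ L1 (fun x => f x ^+ 2).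
Definition bounded_measurable f :=
  measurable_fun I f /\ exists M, forall x, I x -> `|f x| <= M.
Definition prim f x := \int[leb]_(s in `[0, x]) f s.

(** As [prim g] is an integral over [[0, x]], this says that [f] is absolutely
    continuous with derivative [g] almost everywhere. *)
Definition abscont f g := L1 g /\ forall x, I x -> f x = f 0 + prim g x.

Lemma unit_itvE x : I x = (0 <= x <= 1) :> Prop.
Proof. by rewrite /I /= in_itv. Qed.

Lemma measurable_unit_itv : measurable I.
Proof. exact: measurable_itv. Qed.
Hint Resolve measurable_unit_itv : core.

Lemma unit_itv0 : I 0. Proof. by rewrite unit_itvE lexx ler01. Qed.
Lemma unit_itv1 : I 1. Proof. by rewrite unit_itvE lexx ler01. Qed.
Hint Resolve unit_itv0 unit_itv1 : core.

Lemma sub_unit_itv x : I x -> `[0, x]%classic `<=` I.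
Proof.
rewrite unit_itvE => /andP[x0 x1] s /=; rewrite in_itv unit_itvE /=.
by move=> /andP[-> sx] /=; exact: le_trans x1.
Qed.

Lemma L1_measurable f : L1 f -> measurable_fun I f.
Proof. by move=> /measurable_int /measurable_EFinP. Qed.

Lemma L1_prefix f x : I x -> L1 f -> leb.-integrable `[0, x] (EFin \o f).
Proof. by move=> Ix; apply: integrableS => //; exact: sub_unit_itv. Qed.

Lemma eq_L1 f g : (forall x, I x -> f x = g x) -> L1 f -> L1 g.
Proof.
by move=> fg; apply: eq_integrable => // x /set_mem Ix /=; rewrite fg.
Qed.

Lemma L1D f g : L1 f -> L1 g -> L1 (fun x => f x + g x).
Proof. by move=> Lf Lg; exact: eq_integrable (integrableD _ Lf Lg). Qed.

Lemma L1Z k f : L1 f -> L1 (fun x => k * f x).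
Proof. by move=> Lf; exact: eq_integrable (integrableZl _ k Lf). Qed.

Lemma L1N f : L1 f -> L1 (fun x => - f x).
Proof. by move=> Lf; apply: eq_L1 (L1Z (-1) Lf) => x _; rewrite mulN1r. Qed.

Lemma L1B f g : L1 f -> L1 g -> L1 (fun x => f x - g x).
Proof. by move=> Lf Lg; apply: L1D => //; exact: L1N. Qed.

Lemma L1_sum (K : Type) (r : seq K) (P : pred K) (F : K -> R -> R) :
  (forall i, P i -> L1 (F i)) -> L1 (fun x => \sum_(i <- r | P i) F i x).
Proof.
move=> LF; have := @integrable_sum _ _ _ leb I measurable_unit_itv K r P
  (fun i => EFin \o F i) LF.
by apply: eq_integrable => // x _ /=; rewrite sumEFin.
Qed.

Lemma L1_norm f : L1 f -> L1 (fun x => `|f x|).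
Proof. exact: integrable_norm. Qed.

Lemma le_L1 f g : measurable_fun I f -> (forall x, I x -> `|f x| <= g x) ->
  L1 g -> L1 f.
Proof.
move=> mf fg; apply: le_integrable => //; first exact/measurable_EFinP.
by move=> x Ix /=; rewrite lee_fin (le_trans (fg _ Ix))// ler_norm.
Qed.

Lemma bounded_measurable_cst k : bounded_measurable (fun=> k).
Proof. by split; [exact: measurable_cst | exists `|k|]. Qed.

Lemma bounded_measurableM f g :
  bounded_measurable f -> bounded_measurable g ->
  bounded_measurable (fun x => f x * g x).
Proof.
move=> [mf [M fM]] [mg [N gN]]; split; first exact: measurable_funM.
by exists (M * N) => x Ix; rewrite normrM ler_pM ?fM ?gN.
Qed.

Lemma bounded_measurableD f g :
  bounded_measurable f -> bounded_measurable g ->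
  bounded_measurable (fun x => f x + g x).
Proof.
move=> [mf [M fM]] [mg [N gN]]; split; first exact: measurable_funD.
exists (M + N) => x Ix; rewrite (le_trans (ler_normD _ _))//.
by rewrite lerD ?fM ?gN.
Qed.

Lemma L1_bounded_mul f g :
  bounded_measurable f -> L1 g -> L1 (fun x => f x * g x).
Proof.
move=> [mf [M fM]] Lg; apply: (@le_L1 _ (fun x => M * `|g x|)).
- by apply: measurable_funM => //; exact: L1_measurable.
- by move=> x Ix; rewrite normrM ler_wpM2r ?fM.
- by apply: L1Z; exact: L1_norm.
Qed.

Lemma L1_cst k : L1 (fun=> k).
Proof.
apply: measurable_bounded_integrable => //.
  suff: (leb I < +oo)%E by [].
  by rewrite /unit_itv lebesgue_measure_itv /= lte_fin ltr01 -EFinB ltry.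
by exists `|k|; split; [exact: num_real | move=> M /ltW Mk x _ ; exact: Mk].
Qed.

Lemma bounded_measurable_L1 f : bounded_measurable f -> L1 f.
Proof.
move=> bf; apply: eq_L1 (L1_bounded_mul bf (L1_cst 1)) => x _.
by rewrite mulr1.
Qed.

Lemma bounded_measurable_L2 f : bounded_measurable f -> L2 f.
Proof.
move=> bf; split; first exact: bf.1.
apply: eq_L1 (bounded_measurable_L1 (bounded_measurableM bf bf)) => x _.
by rewrite expr2.
Qed.

Lemma L2M f g : L2 f -> L2 g -> L1 (fun x => f x * g x).
Proof.
move=> [mf Lf] [mg Lg].
apply: (@le_L1 _ (fun x => f x ^+ 2 + g x ^+ 2)); last exact: L1D.
  exact: measurable_funM.
move=> x _; rewrite normrM -[f x ^+ 2]real_normK ?num_real//.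
rewrite -[g x ^+ 2]real_normK ?num_real//.
have := sqr_ge0 (`|f x| - `|g x|); have := normr_ge0 (f x).
have := normr_ge0 (g x); nra.
Qed.

Lemma L2_L1 f : L2 f -> L1 f.
Proof.
move=> Lf; have := L2M Lf (bounded_measurable_L2 (bounded_measurable_cst 1)).
by apply: eq_L1 => x _; rewrite mulr1.
Qed.

Lemma eq_L2 f g : (forall x, I x -> f x = g x) -> L2 f -> L2 g.
Proof.
move=> fg [mf Lf]; split.
  by apply: eq_measurable_fun mf => x /set_mem Ix; rewrite fg.
by apply: eq_L1 Lf => x Ix; rewrite fg.
Qed.

Lemma L2D f g : L2 f -> L2 g -> L2 (fun x => f x + g x).
Proof.
move=> Lf Lg; split; first by apply: measurable_funD; [exact: Lf.1|exact: Lg.1].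
apply: eq_L1 (L1D (L1D Lf.2 (L1Z 2 (L2M Lf Lg))) Lg.2) => x _.
by rewrite sqrrD mulr2n mulrDl mul1r.
Qed.

Lemma L2_bounded_mul f g :
  bounded_measurable f -> L2 g -> L2 (fun x => f x * g x).
Proof.
move=> bf Lg; split; first by apply: measurable_funM; [exact: bf.1|exact: Lg.1].
apply: eq_L1 (L1_bounded_mul (bounded_measurableM bf bf) Lg.2) => x _.
by rewrite exprMn expr2.
Qed.

Lemma L2Z k f : L2 f -> L2 (fun x => k * f x).
Proof. exact/L2_bounded_mul/bounded_measurable_cst. Qed.

Lemma L2_sum (K : Type) (r : seq K) (F : K -> R -> R) :
  (forall i, L2 (F i)) -> L2 (fun x => \sum_(i <- r) F i x).
Proof.
move=> LF; elim: r => [|i r IHr].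
  under eq_fun do rewrite big_nil.
  exact/bounded_measurable_L2/bounded_measurable_cst.
by under eq_fun do rewrite big_cons; exact: L2D.
Qed.

Lemma L2_norm f : L2 f -> L2 (fun x => `|f x|).
Proof.
move=> Lf; split; first by apply: measurableT_comp => //; exact: Lf.1.
by apply: eq_L1 Lf.2 => x _; rewrite real_normK ?num_real.
Qed.

Lemma eq_prim f g x : I x -> (forall s, I s -> f s = g s) -> prim f x = prim g x.
Proof.
move=> Ix fg; apply: eq_Rintegral => s /set_mem sx; apply: fg.
exact: sub_unit_itv sx.
Qed.

Lemma primD f g x : I x -> L1 f -> L1 g ->
  prim (fun s => f s + g s) x = prim f x + prim g x.
Proof. by move=> Ix Lf Lg; apply: RintegralD => //; exact: L1_prefix. Qed.

Lemma primZ k f x : I x -> L1 f -> prim (fun s => k * f s) x = k * prim f x.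
Proof. by move=> Ix Lf; apply: RintegralZl => //; exact: L1_prefix. Qed.

Lemma primN f x : I x -> L1 f -> prim (fun s => - f s) x = - prim f x.
Proof.
move=> Ix Lf; rewrite -mulN1r -primZ//.
by apply: eq_prim => // s _; rewrite mulN1r.
Qed.

Lemma primB f g x : I x -> L1 f -> L1 g ->
  prim (fun s => f s - g s) x = prim f x - prim g x.
Proof. by move=> Ix Lf Lg; rewrite primD ?primN//; exact: L1N. Qed.

Lemma prim_cst k x : I x -> prim (fun=> k) x = k * x.
Proof.
rewrite unit_itvE => /andP[x0 _]; rewrite /prim Rintegral_cst//.
suff -> : fine (leb `[0, x]) = x by [].
rewrite lebesgue_measure_itv /= lte_fin; case: ltgtP x0 => // x0 _.
by rewrite oppr0 adde0.
Qed.

Lemma prim_0 f : prim f 0 = 0.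
Proof. by rewrite /prim set_itv1 Rintegral_set1. Qed.

Lemma prim_ge0 f x : I x -> (forall s, I s -> 0 <= f s) -> 0 <= prim f x.
Proof.
move=> Ix f0; apply: Rintegral_ge0 => s sx; apply: f0.
exact: sub_unit_itv sx.
Qed.

Lemma le_prim f g x : I x -> L1 f -> L1 g ->
  (forall s, I s -> f s <= g s) -> prim f x <= prim g x.
Proof.
move=> Ix Lf Lg fg; apply: le_Rintegral => //; [exact: L1_prefix..|].
by move=> s sx; apply: fg; exact: sub_unit_itv sx.
Qed.

Lemma norm_prim f x : I x -> L1 f -> `|prim f x| <= prim (fun s => `|f s|) x.
Proof. by move=> Ix Lf; apply: le_normr_Rintegral => //; exact: L1_prefix. Qed.

Lemma prim_le_total f x : I x -> L1 f -> (forall s, I s -> 0 <= f s) ->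
  prim f x <= prim f 1.
Proof.
move=> Ix Lf f0; rewrite -subr_ge0 /prim Rintegral_itvB//.
- apply: Rintegral_ge0 => s /=; rewrite in_itv /= => /andP[xs s1].
  apply: f0; rewrite unit_itvE s1 andbT (le_trans _ (ltW xs))//.
  by move: Ix; rewrite unit_itvE => /andP[].
- by rewrite bnd_simp; move: Ix; rewrite unit_itvE => /andP[].
- by rewrite bnd_simp; move: Ix; rewrite unit_itvE => /andP[].
Qed.

Lemma bounded_measurable_prim f : L1 f -> bounded_measurable (prim f).
Proof.
move=> Lf; split.
  apply: subspace_continuous_measurable_fun => //.
  exact: parameterized_integral_continuous.
exists (prim (fun s => `|f s|) 1) => x Ix.
rewrite (le_trans (norm_prim Ix Lf))//.
by apply: prim_le_total => //; exact: L1_norm.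
Qed.

Lemma abscont_bounded_measurable f g : abscont f g -> bounded_measurable f.
Proof.
move=> [Lg fE].
have [mf [M fM]] :=
  bounded_measurableD (bounded_measurable_cst (f 0)) (bounded_measurable_prim Lg).
split; last by exists M => x Ix; rewrite fE// fM.
by apply: eq_measurable_fun mf => x /set_mem Ix; rewrite -fE.
Qed.

Lemma continuous_bounded_measurable f : continuous f -> bounded_measurable f.
Proof.
move=> cf; have cwf : {within I, continuous f} by exact: continuous_subspaceT.
split; first exact: subspace_continuous_measurable_fun.
have /compact_bounded[M [_ fM]] :=
  continuous_compact cwf (@segment_compact _ 0 1).
exists (`|M| + 1) => x Ix; apply: fM; last by exists x.
by rewrite (le_lt_trans (ler_norm M))// ltrDl.
Qed.

End UnitInterval.
#[global] Hint Resolve measurable_unit_itv unit_itv0 unit_itv1 : core.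

(** * Absolutely continuous functions *)

Section AbsolutelyContinuous.
Context {R : realType}.
Notation leb := (@lebesgue_measure R).
Local Notation I := (@unit_itv R).
Implicit Types (f g a b : R -> R) (x : R).

Lemma integrable_restrict_prefix a x : I x -> L1 a ->
  leb.-integrable setT (EFin \o (a \_ `[0, x])).
Proof.
move=> Ix La; rewrite -restrict_EFin; apply/(integrable_mkcond _ _).1 => //.
exact: L1_prefix.
Qed.

Lemma integrable_prod_mul (A B : R -> R) :
  leb.-integrable setT (EFin \o A) -> leb.-integrable setT (EFin \o B) ->
  (leb \x leb)%E.-integrable setT (EFin \o (fun z : R * R => A z.1 * B z.2)).
Proof.
move=> LA LB.
have mA : measurable_fun setT A.
  by have /measurable_int /measurable_EFinP := LA.
have mB : measurable_fun setT B.
  by have /measurable_int /measurable_EFinP := LB.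
apply/integrable12ltyP.
  apply/measurable_EFinP; apply: measurable_funM; exact: measurableT_comp.
have inner r : (\int[leb]_s `|(EFin \o (fun z : R * R => (A z.1 * B z.2)%R)) (r, s)| =
    `|A r|%:E * \int[leb]_s `|B s|%:E)%E.
  rewrite -ge0_integralZl//.
  - by apply: eq_integral => s _; rewrite /= normrM EFinM.
  - by apply/measurable_EFinP; exact: measurableT_comp.
under eq_integral do rewrite inner.
have [_ Afin] := integrableP _ _ _ LA.
have [_ Bfin] := integrableP _ _ _ LB.
rewrite ge0_integralZr//.
- apply: lte_mul_pinfty => //; first exact: integral_ge0.
  rewrite ge0_fin_numE//; exact: integral_ge0.
- by apply/measurable_EFinP; exact: measurableT_comp.
- exact: integral_ge0.
Qed.

(** Fubini for [a r * b s] on the triangle [s <= r] inside the square of side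
    [x]: the two iterated integrals are the two halves of the product. *)
Lemma prim_mul a b x : I x -> L1 a -> L1 b ->
  prim (fun s => a s * prim b s + prim a s * b s) x = prim a x * prim b x.
Proof.
move=> Ix La Lb.
have [x0 x1] : 0 <= x /\ x <= 1 by move: Ix; rewrite unit_itvE => /andP.
pose A := a \_ `[0, x]; pose B := b \_ `[0, x].
have LA := integrable_restrict_prefix Ix La.
have LB := integrable_restrict_prefix Ix Lb.
pose K (z : R * R) := if z.2 <= z.1 then A z.1 * B z.2 else 0.
have LK : (leb \x leb)%E.-integrable setT (EFin \o K).
  have LAB := integrable_prod_mul LA LB.
  apply: le_integrable LAB => //; last first.
    move=> z _ /=; rewrite lee_fin /K; case: ifP => // _.
    by rewrite normr0.
  apply/measurable_EFinP/measurable_fun_ifT => //.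
    by apply: measurable_fun_ler; [exact: measurable_snd|exact: measurable_fst].
  apply: measurable_funM.
    apply: measurableT_comp => //.
    by have /measurable_int /measurable_EFinP := LA.
  apply: measurableT_comp => //.
  by have /measurable_int /measurable_EFinP := LB.
have inner1 r : (\int[leb]_s (EFin \o K) (r, s) =
    ((fun r => a r * prim b r) \_ `[0, x] r)%:E)%E.
  rewrite /K /A /= !patchE; case: ifPn => [/set_mem rx|rx]; last first.
    by rewrite (eq_integral (cst 0%E)) ?integral0// => s _; case: ifP; rewrite ?mul0r.
  have Ir := sub_unit_itv Ix rx.
  rewrite [prim b r]Rintegral_mkcond -RintegralZl//; last first.
    exact: integrable_restrict_prefix.
  rewrite /Rintegral fineK; last first.
    apply: integrable_fin_num => //.
    have := integrableZl measurableT (a r) (integrable_restrict_prefix Ir Lb).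
    by apply: eq_integrable.
  apply: eq_integral => s _; congr EFin.
  move: rx; rewrite /B !patchE !mem_setE !in_itv /= => /andP[r0 rx].
  have [sr|_] := leP s r; last by rewrite andbF mulr0.
  by rewrite andbT (le_trans sr rx) andbT.
have inner2 s : (\int[leb]_r (EFin \o K) (r, s) =
    ((fun s => b s * (prim a x - prim a s)) \_ `[0, x] s)%:E)%E.
  rewrite /K /B /= !patchE; case: ifPn => [/set_mem sx|sx]; last first.
    by rewrite (eq_integral (cst 0%E)) ?integral0// => r _; case: ifP; rewrite ?mulr0.
  have [s0 sx'] : 0 <= s /\ s <= x by move: sx; rewrite /= in_itv /= => /andP.
  have Lsx : leb.-integrable `[s, x] (EFin \o a).
    apply: integrableS (L1_prefix Ix La) => // r /=.
    by rewrite !in_itv /= => /andP[sr ->]; rewrite (le_trans s0).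
  have Lsx' : leb.-integrable setT (EFin \o (a \_ `[s, x])).
    by rewrite -restrict_EFin; apply/(integrable_mkcond _ _).1.
  rewrite /prim Rintegral_itvB ?bnd_simp//; last exact: L1_prefix.
  rewrite Rintegral_itv_obnd_cbnd; last first.
    by apply: integrableS Lsx => // r /=; rewrite !in_itv /= => /andP[/ltW -> ->].
  rewrite [X in _ * X]Rintegral_mkcond -RintegralZl//.
  rewrite /Rintegral fineK; last first.
    apply: integrable_fin_num => //.
    have := integrableZl measurableT (b s) Lsx'.
    by apply: eq_integrable.
  apply: eq_integral => r _; congr EFin.
  rewrite /A !patchE !mem_setE !in_itv /= mulrC.
  have [sr|_] := leP s r; last by rewrite mulr0.
  by rewrite (le_trans s0 sr) /= mulrC.
have Lab : L1 (fun s => a s * prim b s).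
  apply: eq_L1 (L1_bounded_mul (bounded_measurable_prim Lb) La) => s _.
  by rewrite mulrC.
have Lba := L1_bounded_mul (bounded_measurable_prim La) Lb.
have := Fubini LK; under eq_integral do rewrite inner1.
under [in RHS]eq_integral do rewrite inner2.
move=> /(congr1 fine).
rewrite -!/(Rintegral _ _ _) -!Rintegral_mkcond => E.
rewrite primD// [X in X + _]E.
rewrite -[LHS]/(prim (fun s => b s * (prim a x - prim a s)) x + prim (fun s => prim a s * b s) x).
rewrite -primD//; last first.
  apply: eq_L1 (L1B (L1Z (prim a x) Lb) Lba) => s _; ring.
rewrite -primZ//; apply: eq_prim => // s _; ring.
Qed.

Lemma abscontM f a g b : abscont f a -> abscont g b ->
  abscont (fun x => f x * g x) (fun x => a x * g x + f x * b x).
Proof.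
move=> acf acg; have [La fE] := acf; have [Lb gE] := acg.
have Lag : L1 (fun s => a s * g s).
  by apply: eq_L1 (L1_bounded_mul (abscont_bounded_measurable acg) La) => s _; rewrite mulrC.
have Lfb := L1_bounded_mul (abscont_bounded_measurable acf) Lb.
split=> [|x Ix]; first exact: L1D.
have Lab : L1 (fun s => a s * prim b s).
  apply: eq_L1 (L1_bounded_mul (bounded_measurable_prim Lb) La) => s _.
  by rewrite mulrC.
have Lba := L1_bounded_mul (bounded_measurable_prim La) Lb.
rewrite (@eq_prim R _ (fun s => (g 0 * a s + f 0 * b s) +
    (a s * prim b s + prim a s * b s)))//; last first.
  by move=> s Is; rewrite fE// gE//; ring.
rewrite primD//; [|by apply: L1D; exact: L1Z|exact: L1D].
rewrite prim_mul// primD//; [|exact: L1Z..].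
by rewrite !primZ// fE// gE//; ring.
Qed.

Lemma abscontD f a g b : abscont f a -> abscont g b ->
  abscont (fun x => f x + g x) (fun x => a x + b x).
Proof.
move=> [La fE] [Lb gE]; split=> [|x Ix]; first exact: L1D.
by rewrite primD// fE// gE//; ring.
Qed.

Lemma abscont_cst (k : R) : @abscont R (fun=> k) (fun=> 0).
Proof.
split=> [|x Ix]; first exact: L1_cst.
by rewrite prim_cst// mul0r addr0.
Qed.

Lemma eq_abscont f g a b : (forall x, I x -> f x = g x) -> (forall x, I x -> a x = b x) ->
  abscont f a -> abscont g b.
Proof.
move=> fg ab [La fE]; split=> [|x Ix]; first exact: eq_L1 La.
by rewrite -fg// fE// fg//; congr (_ + _); exact: eq_prim.
Qed.

Lemma abscontZ (k : R) f a : abscont f a -> abscont (fun x => k * f x) (fun x => k * a x).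
Proof.
move=> acf; apply: eq_abscont (abscontM (abscont_cst k) acf) => // x _.
by rewrite mul0r add0r.
Qed.

Lemma abscont_sum (K : Type) (r : seq K) (f a : K -> R -> R) :
  (forall i, abscont (f i) (a i)) ->
  abscont (fun x => \sum_(i <- r) f i x) (fun x => \sum_(i <- r) a i x).
Proof.
move=> acf; elim: r => [|i r IHr].
  by apply: eq_abscont (abscont_cst 0) => x _; rewrite big_nil.
by apply: eq_abscont (abscontD (acf i) IHr) => x _; rewrite big_cons.
Qed.

Lemma abscont_derive f g : (forall x, is_derive x (1 : R) f (g x)) -> continuous g -> abscont f g.
Proof.
move=> fg cg; have cf : continuous f.
  by move=> x; apply/differentiable_continuous/derivable1_diffP; case: (fg x).
split=> [|x Ix].
  exact/bounded_measurable_L1/continuous_bounded_measurable.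
have := Ix; rewrite unit_itvE le_eqVlt => /andP[/predU1P[<-|x0] _].
  by rewrite prim_0 addr0.
rewrite /prim /Rintegral (@continuous_FTC2 _ _ f)//.
- by rewrite -EFinB /=; ring.
- exact: continuous_subspaceT.
- split.
  + by move=> y _; case: (fg y).
  + by apply: cvg_at_right_filter; exact: cf.
  + by apply: cvg_at_left_filter; exact: cf.
- by move=> y _; rewrite derive1E; case: (fg y).
Qed.

Lemma abscont_total f g : abscont f g -> prim g 1 = f 1 - f 0.
Proof. by move=> [_ ->//]; ring. Qed.

(** Evaluate at the minimizer [r = - B / C]; for [C = 0] the left-hand side is
    affine in [r], so [B = 0]. *)
Lemma discriminant_le (A B C : R) : 0 <= C ->
  (forall r, 0 <= A + r * B *+ 2 + r ^+ 2 * C) -> B ^+ 2 <= A * C.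
Proof.
rewrite le_eqVlt => /predU1P[<-|C0] pos.
  rewrite mulr0; have [->|B0] := eqVneq B 0; first by rewrite expr0n.
  have := pos (- ((A + 1) / B)); rewrite mulr0 addr0.
  have -> : A + - ((A + 1) / B) * B *+ 2 = - A - 2 by rewrite mulr2n; field.
  have := pos 0; rewrite mul0r mul0rn mulr0 !addr0; lra.
have /(mulr_ge0 (ltW C0)) := pos (- (B / C)).
suff -> : C * (A + - (B / C) * B *+ 2 + (- (B / C)) ^+ 2 * C) = A * C - B ^+ 2.
  by rewrite subr_ge0.
by rewrite mulr2n; field; rewrite gt_eqF.
Qed.

Lemma cauchy_schwarz_prim f g x : I x -> L2 f -> L2 g ->
  prim (fun s => f s * g s) x ^+ 2 <=
  prim (fun s => f s ^+ 2) x * prim (fun s => g s ^+ 2) x.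
Proof.
move=> Ix Lf Lg; apply: discriminant_le => [|r].
  by apply: prim_ge0 => // s _; exact: sqr_ge0.
rewrite (_ : _ + _ = prim (fun s => (f s + r * g s) ^+ 2) x).
  by apply: prim_ge0 => // s _; exact: sqr_ge0.
have Lfg := L2M Lf Lg.
rewrite (@eq_prim R (fun s => (_ + _) ^+ 2)
  (fun s => (f s ^+ 2 + (r *+ 2) * (f s * g s)) + r ^+ 2 * g s ^+ 2))//; last first.
  by move=> s _; ring.
rewrite !primD//; [|exact: Lf.2|exact: L1Z|apply: L1D; [exact: Lf.2|exact: L1Z]|exact: L1Z Lg.2].
by rewrite !primZ//; [ring|exact: Lg.2].
Qed.

Lemma ae_impl (P Q : R -> Prop) : (forall x, P x -> Q x) ->
  {ae leb, forall x, P x} -> {ae leb, forall x, Q x}.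
Proof.
by move=> PQ; apply: negligibleS => x /= nQ Px; exact/nQ/PQ.
Qed.

Lemma ae_impl2 (P Q S : R -> Prop) : (forall x, P x -> Q x -> S x) ->
  {ae leb, forall x, P x} -> {ae leb, forall x, Q x} -> {ae leb, forall x, S x}.
Proof.
move=> PQS aeP aeQ; apply: negligibleS (negligibleU aeP aeQ) => x /= nS.
apply/not_notP => nPQ; apply/nS/PQS; apply/not_notP => n; apply: nPQ.
  by left.
by right.
Qed.

Lemma ae_eq_prim f g x : I x -> L1 f -> L1 g ->
  {ae leb, forall s, I s -> f s = g s} -> prim f x = prim g x.
Proof.
move=> Ix Lf Lg fg; congr fine; apply: ae_eq_integral => //.
- by have /measurable_int := L1_prefix Ix Lf.
- by have /measurable_int := L1_prefix Ix Lg.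
- apply: ae_impl fg => s sfg sx; rewrite sfg//; exact: sub_unit_itv sx.
Qed.

End AbsolutelyContinuous.

(** * Linear differential systems with square integrable coefficients *)

Section LinearSystem.
Context {R : realType}.
Local Notation I := (@unit_itv R).
Implicit Types (x : R).

(** The sequences [s n - 2 B / 2 ^ n] and [s n + 2 B / 2 ^ n] are monotone, and
    the first lies below the second; the limit is the supremum of the first, and
    this gives the rate of convergence as well. *)
Lemma geometric_cauchy_limit (s : nat -> R) (B : R) :
  (forall n, `|s n.+1 - s n| <= B * 2^-1 ^+ n) ->
  exists l, forall n, `|s n - l| <= 2 * B * 2^-1 ^+ n.
Proof.
move=> sB; pose a n := s n - 2 * B * 2^-1 ^+ n; pose b n := s n + 2 * B * 2^-1 ^+ n.
have B0 n : 0 <= B * 2^-1 ^+ n by exact: le_trans (sB n).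
have aS n : a n <= a n.+1.
  by have := sB n; rewrite /a exprS ler_norml => /andP[]; have := B0 n; lra.
have bS n : b n.+1 <= b n.
  by have := sB n; rewrite /b exprS ler_norml => /andP[]; have := B0 n; lra.
have a_le n k : a n <= a (n + k)%N.
  by elim: k => [|k IHk]; rewrite ?addn0// addnS (le_trans IHk).
have b_le n k : b (n + k)%N <= b n.
  by elim: k => [|k IHk]; rewrite ?addn0// addnS (le_trans _ IHk).
have ab n k : a n <= b k.
  apply: (le_trans (a_le n k)); rewrite addnC; apply: le_trans (b_le k n).
  by have := B0 (k + n)%N; rewrite /a /b; lra.
have lub k : ubound (range a) (b k) by move=> _ [n _ <-].
have al n : a n <= sup (range a).
  by apply: ub_le_sup; [exists (b 0%N); exact: lub | exists n].
have bl n : sup (range a) <= b n.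
  by apply: ge_sup; [exists (a 0%N); exists 0%N | exact: lub].
exists (sup (range a)) => n; rewrite ler_norml.
by have := al n; have := bl n; rewrite /a /b => ? ?; apply/andP; split; lra.
Qed.

Lemma cvg_half_pow (C : R) : (fun n => C * 2^-1 ^+ n) @ \oo --> (0 : R).
Proof.
rewrite -(mulr0 C); apply: cvgMr => //; apply: cvg_expr.
by rewrite ger0_norm ?invr_ge0// invf_lt1 ?ltr1n.
Qed.

Lemma le_half_pow_eq0 (r C : R) : (forall n, `|r| <= C * 2^-1 ^+ n) -> r = 0.
Proof.
move=> rC; apply/normr0_eq0/le_anti; rewrite normr_ge0 andbT.
rewrite -(cvg_lim (@Rhausdorff R) (cvg_half_pow C)); apply: limr_ge.
  exact: cvgP (cvg_half_pow C).
by apply: nearW => n; exact: rC.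
Qed.

(** This makes Picard iteration a contraction by 1/2 for the weighted norm
    [sup |z x| / expR (k * x)]: by Cauchy-Schwarz the integral is at most
    [|al| * expR (k * x) / sqrt (2 k)], which is small for large [k]. *)
Lemma exp_weight (al : R -> R) : L2 al ->
  exists k : R, 0 < k /\ forall x, I x ->
    prim (fun s => al s * expR (k * s)) x <= expR (k * x) / 2.
Proof.
move=> Lal; pose M := prim (fun s => al s ^+ 2) 1.
have M0 : 0 <= M by apply: prim_ge0 => // s _; exact: sqr_ge0.
pose k := 2 * M + 1; have k0 : 0 < k by rewrite /k; lra.
have cexp (c : R) : continuous (fun s => expR (c * s)).
  move=> s; apply: continuous_comp; last exact: continuous_expR.
  exact: mulrl_continuous.
exists k; split=> // x Ix.
have bexp : bounded_measurable (fun s => expR (k * s)).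
  exact: continuous_bounded_measurable.
have Lexp := bounded_measurable_L2 bexp.
have := cauchy_schwarz_prim Ix Lal Lexp.
have exp_int : prim (fun s => expR (k * s) ^+ 2) x <= expR (k * x) ^+ 2 / (2 * k).
  pose F s := expR (2 * k * s) / (2 * k).
  have [_ FE] : abscont F (fun s => expR (2 * k * s)).
    apply: abscont_derive => // s; rewrite /F.
    have -> : expR (2 * k * s) = (expR (2 * k * s) * (2 * k)) / (2 * k).
      by field; rewrite gt_eqF.
    apply: is_derive_eq; rewrite /GRing.scale/= mulr0 add0r; ring.
  have := FE x Ix; rewrite /F mulr0 expR0 => E.
  rewrite (@eq_prim R _ (fun s => expR (2 * k * s)))//; last first.
    by move=> s _; rewrite -expRM_natl; congr expR; rewrite mulr_natl; ring.
  have -> : expR (k * x) ^+ 2 = expR (2 * k * x).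
    by rewrite -expRM_natl; congr expR; ring.
  have : 0 <= 1 / (2 * k) by rewrite divr_ge0// mulr_ge0// ltW.
  lra.
have prim_M : prim (fun s => al s ^+ 2) x <= M.
  by apply: prim_le_total => //; [exact: Lal.2 | move=> s _; exact: sqr_ge0].
move=> CS; apply: (@le_trans _ _ `|expR (k * x) / 2|); last first.
  by rewrite ger0_norm// divr_ge0// expR_ge0.
apply: (le_trans (ler_norm _)); rewrite -ler_sqr ?nnegrE//.
rewrite !real_normK ?num_real//; apply: (le_trans CS).
apply: (@le_trans _ _ (M * (expR (k * x) ^+ 2 / (2 * k)))).
  apply: ler_pM => //; apply: prim_ge0 => // s _; exact: sqr_ge0.
rewrite expr_div_n mulrCA; apply: ler_wpM2l; first exact: sqr_ge0.
by rewrite ler_pdivrMr ?mulr_gt0// /k; lra.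
Qed.

End LinearSystem.

Section Picard.
Context {R : realType} (J : finType) (A : R -> J -> J -> R).
Local Notation I := (@unit_itv R).
Hypothesis A_L2 : forall i j, L2 (fun x => A x i j).

Let al (x : R) := \sum_i \sum_j `|A x i j|.

Let al_L2 : L2 al.
Proof. by apply: L2_sum => i; apply: L2_sum => j; exact/L2_norm/A_L2. Qed.

Let al_ge0 x : 0 <= al x.
Proof. by apply: sumr_ge0 => i _; apply: sumr_ge0 => j _; exact: normr_ge0. Qed.

Let Aop (z : J -> R -> R) i x := \sum_j A x i j * z j x.

Let Aop_L2 z i : (forall j, bounded_measurable (z j)) -> L2 (Aop z i).
Proof.
move=> bz; apply: L2_sum => j.
by apply: eq_L2 (L2_bounded_mul (bz j) (A_L2 i j)) => x _; rewrite mulrC.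
Qed.

Let Aop_le z i x (B : R) : (forall j, `|z j x| <= B) -> `|Aop z i x| <= al x * B.
Proof.
move=> zB; have [] := leP 0 B; last first.
  by move=> B0; have := le_lt_trans (le_trans (normr_ge0 _) (zB i)) B0; rewrite ltxx.
move=> B0; apply: (le_trans (ler_norm_sum _ _ _)).
apply: (@le_trans _ _ (\sum_j `|A x i j| * B)).
  by apply: ler_sum => j _; rewrite normrM ler_wpM2l.
rewrite -mulr_suml ler_wpM2r// /al [leRHS](bigD1 i)//= lerDl.
by apply: sumr_ge0 => k _; apply: sumr_ge0 => j _; exact: normr_ge0.
Qed.

(** Picard iteration.  What matters later is that one constant [C] bounds the
    solutions for all initial values and all right-hand sides. *)
Lemma linear_system_solution :
  exists C : R, 0 <= C /\ forall (c : J -> R) (g : J -> R -> R),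
    (forall i, L1 (g i)) ->
  exists z : J -> R -> R,
    [/\ forall i, abscont (z i) (fun x => \sum_j A x i j * z j x + g i x),
        forall i, z i 0 = c i &
        forall i x, I x ->
          `|z i x| <= C * \sum_j (`|c j| + prim (fun s => `|g j s|) 1)].
Proof.
have [k [k0 kP]] := exp_weight al_L2.
exists (3 * expR k); split; first by rewrite mulr_ge0// expR_ge0.
move=> c g Lg; set D := \sum_j _.
have Dj i : `|c i| + prim (fun s => `|g i s|) 1 <= D.
  rewrite /D (bigD1 i)//=. rewrite lerDl; apply: sumr_ge0 => j _; apply: addr_ge0 => //.
  by apply: prim_ge0.
have D0 : 0 <= D.
  by apply: sumr_ge0 => j _; apply: addr_ge0 => //; apply: prim_ge0.
pose z0 i x := c i + prim (g i) x.
pose step z i x := z0 i x + prim (Aop z i) x.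
pose S n := iter n step z0.
have bz0 i : bounded_measurable (z0 i).
  apply: bounded_measurableD; first exact: bounded_measurable_cst.
  exact: bounded_measurable_prim.
have bS n i : bounded_measurable (S n i).
  elim: n i => [|n IHn] i; first exact: bz0.
  apply: bounded_measurableD => //; apply: bounded_measurable_prim.
  exact/L2_L1/Aop_L2.
have z0D i x : I x -> `|z0 i x| <= D.
  move=> Ix; apply: le_trans (Dj i); apply: (le_trans (ler_normD _ _)).
  rewrite lerD2l; apply: (le_trans (norm_prim Ix (Lg i))).
  by apply: prim_le_total => //; exact: L1_norm.
have Aop_prim_le z i x (B : R) : (forall j, bounded_measurable (z j)) -> 0 <= B -> I x ->
    (forall j s, I s -> `|z j s| <= B * expR (k * s)) ->
    `|prim (Aop z i) x| <= B / 2 * expR (k * x).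
  move=> bz B0 Ix zB; apply: (le_trans (norm_prim Ix (L2_L1 (Aop_L2 _ _)))) => //.
  apply: (@le_trans _ _ (prim (fun s => B * (al s * expR (k * s))) x)).
    apply: le_prim => //.
    - exact/L1_norm/L2_L1/Aop_L2.
    - apply/L1Z/L2M => //; apply: bounded_measurable_L2.
      apply: continuous_bounded_measurable => s.
      apply: continuous_comp; last exact: continuous_expR.
      exact: mulrl_continuous.
    - move=> s Is; rewrite mulrCA; apply: Aop_le => j; exact: zB.
  rewrite primZ//; last first.
    apply: L2M => //; apply: bounded_measurable_L2.
    apply: continuous_bounded_measurable => s.
    apply: continuous_comp; last exact: continuous_expR.
    exact: mulrl_continuous.
  by rewrite mulrAC -mulrA; exact: ler_wpM2l (kP x Ix).
have exp1 x : I x -> 1 <= expR (k * x) <= expR k.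
  rewrite unit_itvE => /andP[x0 x1].
  have kx0 : 0 <= k * x by rewrite mulr_ge0// ltW.
  by rewrite -{1}expR0 !ler_expR kx0 /= ler_piMr// ltW.
have diff_le n i x : I x ->
    `|S n.+1 i x - S n i x| <= D * 2^-1 ^+ n.+1 * expR (k * x).
  elim: n i x => [|n IHn] i x Ix.
    rewrite /S /= /step addrC addKr expr1; apply: Aop_prim_le => // j s Is.
    apply: (le_trans (z0D j s Is)); rewrite ler_peMr//.
    by have /andP[] := exp1 s Is.
  have -> : S n.+2 i x - S n.+1 i x = prim (Aop (fun j s => S n.+1 j s - S n j s) i) x.
    rewrite /S !iterS /step opprD addrACA subrr add0r -primB//; last 2 first.
    - exact/L2_L1/Aop_L2/(bS n.+1).
    - exact/L2_L1/Aop_L2/(bS n).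
    apply: eq_prim => // s _; rewrite /Aop -sumrB.
    by apply: eq_bigr => j _; rewrite mulrBr.
  rewrite exprSr mulrA; apply: Aop_prim_le => //.
  - move=> j; apply: bounded_measurableD => //.
    apply: (@eq_ind _ _ bounded_measurable
      (bounded_measurableM (bounded_measurable_cst (-1)) (bS n j))).
    by apply/funext => s; rewrite mulN1r.
  - by rewrite mulr_ge0// exprn_ge0.
have diff_le' n i x : I x -> `|S n.+1 i x - S n i x| <= D * expR k * 2^-1 ^+ n.
  move=> Ix; apply: (le_trans (diff_le n i x Ix)); rewrite mulrAC exprS.
  have /andP[e1 ek] := exp1 x Ix.
  have P0 : 0 <= (2^-1 : R) ^+ n by rewrite exprn_ge0.
  have : 0 <= D * (expR k - expR (k * x)) * 2^-1 ^+ n.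
    by rewrite !mulr_ge0// subr_ge0.
  have : 0 <= D * expR (k * x) * 2^-1 ^+ n by rewrite !mulr_ge0// expR_ge0.
  lra.
have lim_ex i x : exists l, I x -> forall n, `|S n i x - l| <= 2 * (D * expR k) * 2^-1 ^+ n.
  have [Ix|nIx] := pselect (I x); last by exists 0.
  have [l lP] := geometric_cauchy_limit (fun n => diff_le' n i x Ix).
  by exists l.
pose z i x := sval (cid (lim_ex i x)).
have zP i x n : I x -> `|S n i x - z i x| <= 2 * (D * expR k) * 2^-1 ^+ n.
  by move=> Ix; exact: (svalP (cid (lim_ex i x)) Ix n).
have z_le i x : I x -> `|z i x| <= 3 * expR k * D.
  move=> Ix; have := zP i x 0%N Ix; rewrite expr0 mulr1 => h.
  have := z0D i x Ix => h'; have := exp1 1 unit_itv1; rewrite mulr1 => /andP[ek _].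
  have : `|z i x| <= `|z0 i x| + `|S 0%N i x - z i x|.
    by rewrite -[X in `|X|](subKr (z0 i x)) (le_trans (ler_normB _ _))// distrC.
  have : D <= D * expR k by rewrite ler_peMr.
  lra.
have bz i : bounded_measurable (z i).
  split; last by exists (3 * expR k * D) => x; exact: z_le.
  apply: (@measurable_fun_cvg _ _ _ _ (fun n => S n i)).
    by move=> n; exact: (bS n i).1.
  move=> x Ix; apply/cvgrPdistC_le => e e0.
  have /cvgr_norm_le := @cvg_half_pow R (2 * (D * expR k)).
  rewrite normr0 => /(_ e e0); apply: filterS => n.
  rewrite ger0_norm; first by apply: le_trans; exact: zP.
  by rewrite !mulr_ge0// ?expR_ge0// exprn_ge0.
have z_eq i x : I x -> z i x = z0 i x + prim (Aop z i) x.
  move=> Ix; apply/eqP; rewrite -subr_eq0; apply/eqP.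
  apply: (@le_half_pow_eq0 _ _ (2 * (D * expR k) * (1 + expR k))) => n.
  have -> : z i x - (z0 i x + prim (Aop z i) x) =
      prim (Aop (fun j s => S n j s - z j s) i) x - (S n.+1 i x - z i x).
    rewrite /S iterS /step (_ : prim (Aop (fun j s => _ - _) i) x =
       prim (Aop (S n) i) x - prim (Aop z i) x); first by ring.
    rewrite -primB//; last 2 first.
    - exact/L2_L1/Aop_L2/(bS n).
    - exact/L2_L1/Aop_L2.
    apply: eq_prim => // s _; rewrite /Aop -sumrB.
    by apply: eq_bigr => j _; rewrite mulrBr.
  have E0 : 0 <= 2 * (D * expR k) by rewrite !mulr_ge0// expR_ge0.
  move: E0 (zP); move: (2 * (D * expR k)) => E E0 zPE.
  have P0 : 0 <= (2^-1 : R) ^+ n by rewrite exprn_ge0.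
  have h1 : `|S n.+1 i x - z i x| <= E * 2^-1 ^+ n.
    by apply: (le_trans (zPE i x n.+1 Ix)); rewrite exprS; have := mulr_ge0 E0 P0; lra.
  have h2 : `|prim (Aop (fun j s => S n j s - z j s) i) x| <=
      E * 2^-1 ^+ n / 2 * expR (k * x).
    apply: Aop_prim_le => //.
    - move=> j; apply: bounded_measurableD => //.
      apply: (@eq_ind _ _ bounded_measurable
        (bounded_measurableM (bounded_measurable_cst (-1)) (bz j))).
      by apply/funext => s; rewrite mulN1r.
    - by rewrite mulr_ge0.
    - move=> j s Is; apply: (le_trans (zPE j s n Is)); rewrite ler_peMr//.
        by rewrite mulr_ge0.
      by have /andP[] := exp1 s Is.
  apply: (le_trans (ler_normB _ _)).
  have /andP[e1 ek] := exp1 x Ix.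
  have : 0 <= E * 2^-1 ^+ n by rewrite mulr_ge0.
  rewrite mulrAC; move: h1 h2; move: (E * 2^-1 ^+ n) => Y h1 h2 Y0.
  have : Y * expR (k * x) <= Y * expR k by rewrite ler_wpM2l.
  have : 0 <= Y * expR k by rewrite mulr_ge0// expR_ge0.
  lra.
have z_0 i : z i 0 = c i by rewrite z_eq// /z0 !prim_0 !addr0.
exists z; split=> // i; split=> [|x Ix]; first exact/L1D/Lg/L2_L1/Aop_L2.
rewrite z_0 z_eq// primD//; last exact/L2_L1/Aop_L2.
by rewrite /z0 -addrA [prim (g i) x + _]addrC.
Qed.

End Picard.

(** * Linear algebra over finite index types *)

Section FiniteLinearAlgebra.
Context {F : fieldType}.

Lemma sum_enum_val (J : finType) (f : J -> F) :
  \sum_j f j = \sum_(i < #|J|) f (enum_val i).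
Proof. rewrite (reindex (fun i : 'I_#|J| => enum_val i)) /=; last first.
  exact/onW_bij/enum_val_bij.
exact: eq_bigl. Qed.

Lemma left_inverse_right (J : finType) (K M : J -> J -> F) :
  (forall i j, \sum_k K i k * M k j = (i == j)%:R) ->
  forall i j, \sum_k M i k * K k j = (i == j)%:R.
Proof.
move=> KM.
pose mx (X : J -> J -> F) : 'M[F]_#|J| := \matrix_(i, j) X (enum_val i) (enum_val j).
have mxM X Y i j : \sum_k X i k * Y k j = (mx X *m mx Y) (enum_rank i) (enum_rank j).
  rewrite mxE sum_enum_val; apply: eq_bigr => k _.
  by rewrite !mxE !enum_rankK.
have : mx K *m mx M = 1%:M.
  apply/matrixP => i j; have := mxM K M (enum_val i) (enum_val j).
  by rewrite KM !enum_valK => <-; rewrite mxE (inj_eq enum_val_inj).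
move=> /mulmx1C MK i j.
by rewrite mxM MK mxE (inj_eq enum_rank_inj).
Qed.

(** A right-hand side that annihilates the left kernel of [B] is reached by [B].
    The solution is given by one matrix [P] for all right-hand sides, so that its
    size is controlled by theirs. *)
Lemma solvable_linear_system (J J' : finType) (B : J' -> J -> F) :
  exists P : J -> J' -> F, forall d : J' -> F,
    (forall w : J' -> F, (forall j, \sum_i w i * B i j = 0) ->
      \sum_i w i * d i = 0) ->
    forall i, \sum_j B i j * (\sum_k P j k * d k) = d i.
Proof.
pose M : 'M[F]_(#|J|, #|J'|) := \matrix_(j, i) B (enum_val i) (enum_val j).
exists (fun j k => pinvmx M (enum_rank k) (enum_rank j)) => d dP i.
pose dv : 'rV[F]_#|J'| := \row_i d (enum_val i).
have dM : (dv <= M)%MS.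
  rewrite submxE; apply/eqP/rowP => k; rewrite !mxE.
  have := dP (fun i => cokermx M (enum_rank i) k).
  rewrite sum_enum_val => dP'; rewrite -[RHS]dP'.
    by apply: eq_bigr => l _; rewrite enum_valK !mxE mulrC.
  move=> j; rewrite sum_enum_val.
  have := congr1 (fun X : 'M[F]_(_, _) => X (enum_rank j) k) (mulmx_coker M).
  rewrite !mxE => E; rewrite -[RHS]E; apply: eq_bigr => l _.
  by rewrite enum_valK !mxE enum_rankK mulrC.
have := congr1 (fun X : 'M[F]_(_, _) => X ord0 (enum_rank i)) (mulmxKpV dM).
rewrite !mxE enum_rankK => <-; rewrite sum_enum_val; apply: eq_bigr => j _.
rewrite !mxE enum_rankK enum_valK mulrC; congr (_ * _).
rewrite sum_enum_val; apply: eq_bigr => k _.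
by rewrite enum_valK !mxE mulrC.
Qed.

Lemma underdetermined_system (J J' : finType) (B : J' -> J -> F) :
  (#|J'| < #|J|)%N ->
  exists r : J -> F, (exists j, r j != 0) /\ forall i, \sum_j r j * B i j = 0.
Proof.
move=> ltJ.
pose M : 'M[F]_(#|J|, #|J'|) := \matrix_(j, i) B (enum_val i) (enum_val j).
have : kermx M != 0.
  rewrite kermx_eq0 /row_free neq_ltn; apply/orP; left.
  exact: leq_ltn_trans (rank_leq_col M) ltJ.
move=> /rowV0Pn[v /sub_kermxP vM v0].
exists (fun j => v ord0 (enum_rank j)); split.
  apply/existsP; apply: contraNT v0; rewrite negb_exists => /forallP v0.
  apply/eqP/rowP => k; rewrite !mxE; have := v0 (enum_val k).
  by rewrite enum_valK negbK => /eqP.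
move=> i; have := congr1 (fun X : 'M[F]_(_, _) => X ord0 (enum_rank i)) vM.
rewrite !mxE => E; rewrite -[RHS]E sum_enum_val; apply: eq_bigr => k _.
by rewrite !mxE enum_valK enum_rankK.
Qed.

End FiniteLinearAlgebra.

(** * The real vector Schrodinger operator *)

Section RealOperator.
Context {R : realType} (K : finType) (q : R -> K -> K -> R).
Notation leb := (@lebesgue_measure R).
Local Notation I := (@unit_itv R).
Implicit Types (u v f g : K -> R -> R) (T : K -> K -> R).

Definition ip u v : R := prim (fun x => \sum_i u i x * v i x) 1.

(** [u1] and [u2] are the first and second derivatives of [u], and [f] is its
    image [- u'' + q u]; boundary conditions are kept apart, in [coupled]. *)
Definition schrodinger u u1 u2 f : Prop :=
  [/\ forall i, abscont (u i) (u1 i), forall i, abscont (u1 i) (u2 i),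
      forall i, L2 (f i) &
      {ae leb, forall x, I x -> forall i,
         f i x = - u2 i x + \sum_j q x i j * u j x}].

Definition coupled T u u1 : Prop :=
  forall i, u i 1 = \sum_j T i j * u j 0 /\ u1 i 1 = \sum_j T i j * u1 j 0.

Definition orthonormal_columns T : Prop :=
  forall j k, \sum_i T i j * T i k = (j == k)%:R.

Definition op_graph T u f : Prop :=
  exists u1 u2, schrodinger u u1 u2 f /\ coupled T u u1.

Definition bvec u : Prop := forall i, bounded_measurable (u i).
Definition L2vec u : Prop := forall i, L2 (u i).

Lemma bvec_L2 u : bvec u -> L2vec u.
Proof. by move=> bu i; exact/bounded_measurable_L2. Qed.

Lemma schrodinger_bvec u u1 u2 f : schrodinger u u1 u2 f -> bvec u /\ bvec u1.
Proof.
move=> [h h1 _ _]; split=> i; first exact: abscont_bounded_measurable (h i).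
exact: abscont_bounded_measurable (h1 i).
Qed.

Lemma schrodinger_L2 u u1 u2 f : schrodinger u u1 u2 f -> [/\ L2vec u, L2vec u1 & L2vec f].
Proof.
move=> h; have [bu bu1] := schrodinger_bvec h; have [_ _ Lf _] := h.
by split=> //; exact: bvec_L2.
Qed.

Lemma op_L2 T u f : op_graph T u f -> L2vec u /\ L2vec f.
Proof. by move=> [u1 [u2 [/schrodinger_L2[? _ ?] _]]]. Qed.

Lemma L1_ip u v : L2vec u -> L2vec v -> L1 (fun x => \sum_i u i x * v i x).
Proof. by move=> Lu Lv; apply: L1_sum => i _; exact: L2M. Qed.

Lemma ipC u v : ip u v = ip v u.
Proof. by apply: eq_prim => // x _; apply: eq_bigr => i _; rewrite mulrC. Qed.

Lemma ip_eq u u' v v' : (forall i x, I x -> u i x = u' i x) ->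
  (forall i x, I x -> v i x = v' i x) -> ip u v = ip u' v'.
Proof.
move=> uu' vv'; apply: eq_prim => // x Ix; apply: eq_bigr => i _.
by rewrite uu'// vv'.
Qed.

Lemma ipDl u v w : L2vec u -> L2vec v -> L2vec w ->
  ip (fun i x => u i x + v i x) w = ip u w + ip v w.
Proof.
move=> Lu Lv Lw; rewrite /ip -primD//; [|exact: L1_ip..].
by apply: eq_prim => // x _; rewrite -big_split; apply: eq_bigr => i _; rewrite mulrDl.
Qed.

Lemma ipZl k u w : L2vec u -> L2vec w ->
  ip (fun i x => k * u i x) w = k * ip u w.
Proof.
move=> Lu Lw; rewrite /ip -primZ//; last exact: L1_ip.
by apply: eq_prim => // x _; rewrite mulr_sumr; apply: eq_bigr => i _; rewrite mulrA.
Qed.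

Lemma L2vecD u v : L2vec u -> L2vec v -> L2vec (fun i x => u i x + v i x).
Proof. by move=> Lu Lv i; exact: L2D. Qed.

Lemma L2vecZ k u : L2vec u -> L2vec (fun i x => k * u i x).
Proof. by move=> Lu i; exact: L2Z. Qed.

(** Used to apply [discriminant_le] to the quadratic form of a pencil. *)
Lemma ip_pencil r u v f g : L2vec u -> L2vec v -> L2vec f -> L2vec g ->
  ip (fun i x => u i x + r * v i x) (fun i x => f i x + r * g i x) =
  ip u f + r * (ip u g + ip v f) + r ^+ 2 * ip v g.
Proof.
move=> Lu Lv Lf Lg; have Lrv := L2vecZ r Lv; have Lrg := L2vecZ r Lg.
have Ls := L2vecD Lf Lrg.
rewrite ipDl// ipZl// ![ip _ (fun i x => f i x + r * g i x)]ipC.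
rewrite !ipDl// !ipZl// ![ip f _]ipC ![ip g _]ipC; ring.
Qed.

Lemma L2vec_sum (N : Type) (r : seq N) (c : N -> R) (U : N -> K -> R -> R) :
  (forall n, L2vec (U n)) -> L2vec (fun i x => \sum_(n <- r) c n * U n i x).
Proof. by move=> LU i; apply: L2_sum => n; exact/L2Z/LU. Qed.

Lemma ip_suml (N : Type) (r : seq N) (c : N -> R) (U : N -> K -> R -> R) w :
  (forall n, L2vec (U n)) -> L2vec w ->
  ip (fun i x => \sum_(n <- r) c n * U n i x) w = \sum_(n <- r) c n * ip (U n) w.
Proof.
move=> LU Lw; elim: r => [|n r IHr].
  rewrite big_nil -[RHS](mul0r 1) -prim_cst//; apply: eq_prim => // x _.
  by rewrite big1// => i _; rewrite big_nil mul0r.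
rewrite big_cons -IHr -ipZl// -ipDl//; [|exact: L2vecZ|exact: L2vec_sum].
by apply: ip_eq => // i x _; rewrite big_cons.
Qed.

Lemma ip_ge0 u : 0 <= ip u u.
Proof. by apply: prim_ge0 => // x _; apply: sumr_ge0 => i _; rewrite -expr2 sqr_ge0. Qed.

Lemma ip_cauchy_schwarz u v : L2vec u -> L2vec v -> ip u v ^+ 2 <= ip u u * ip v v.
Proof.
move=> Lu Lv; apply: discriminant_le => [|r]; first exact: ip_ge0.
have := ip_ge0 (fun i x => u i x + r * v i x); rewrite ip_pencil// [ip v u]ipC.
by congr (0 <= _); rewrite mulr2n; ring.
Qed.

Lemma schrodingerD u u1 u2 f v v1 v2 g :
  schrodinger u u1 u2 f -> schrodinger v v1 v2 g ->
  schrodinger (fun i x => u i x + v i x) (fun i x => u1 i x + v1 i x)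
    (fun i x => u2 i x + v2 i x) (fun i x => f i x + g i x).
Proof.
move=> [hu hu1 Lf fE] [hv hv1 Lg gE].
split=> [i|i|i|]; [exact: abscontD|exact: abscontD|exact: L2D|].
apply: ae_impl2 fE gE => x {}fE {}gE Ix i; have {}fE := fE Ix; have {}gE := gE Ix.
have -> : \sum_j q x i j * (u j x + v j x) =
    \sum_j q x i j * u j x + \sum_j q x i j * v j x.
  by rewrite -big_split; apply: eq_bigr => j _; rewrite mulrDr.
by rewrite fE gE; ring.
Qed.

Lemma schrodingerZ k u u1 u2 f : schrodinger u u1 u2 f ->
  schrodinger (fun i x => k * u i x) (fun i x => k * u1 i x)
    (fun i x => k * u2 i x) (fun i x => k * f i x).
Proof.
move=> [hu hu1 Lf fE].
split=> [i|i|i|]; [exact: abscontZ|exact: abscontZ|exact: L2Z|].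
apply: ae_impl fE => x h Ix i; rewrite h// mulrDr mulr_sumr mulrN; congr (_ + _).
by apply: eq_bigr => j _; rewrite mulrCA.
Qed.

Lemma schrodinger_eq u u1 u2 f u' u1' f' : schrodinger u u1 u2 f ->
  (forall i x, I x -> u i x = u' i x) -> (forall i x, I x -> u1 i x = u1' i x) ->
  (forall i x, I x -> f i x = f' i x) -> schrodinger u' u1' u2 f'.
Proof.
move=> [hu hu1 Lf fE] uu' uu1' ff'; split=> [i|i|i|].
- by apply: eq_abscont (hu i) => x; [exact: uu'|exact: uu1'].
- by apply: eq_abscont (hu1 i) => x; [exact: uu1'|].
- by apply: eq_L2 (Lf i) => x; exact: ff'.
apply: ae_impl fE => x h Ix i; rewrite -ff'// h//; congr (_ + _).
by apply: eq_bigr => j _; rewrite uu'.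
Qed.

Lemma schrodinger_sum (N : Type) (r : seq N) (c : N -> R) (U U1 U2 F : N -> K -> R -> R) :
  (forall n, schrodinger (U n) (U1 n) (U2 n) (F n)) ->
  exists w2, schrodinger (fun i x => \sum_(n <- r) c n * U n i x)
    (fun i x => \sum_(n <- r) c n * U1 n i x) w2
    (fun i x => \sum_(n <- r) c n * F n i x).
Proof.
move=> hU; elim: r => [|n r [w2 IHr]].
  exists (fun _ _ => 0); split=> [i|i|i|].
  - by apply: eq_abscont (abscont_cst 0) => // x _; rewrite big_nil.
  - by apply: eq_abscont (abscont_cst 0) => // x _; rewrite big_nil.
  - have := bounded_measurable_L2 (@bounded_measurable_cst R 0).
    by apply: eq_L2 => x _; rewrite big_nil.
  - apply: aeW => x Ix i; rewrite big_nil big1 ?addr0 ?oppr0// => j _.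
    by rewrite big_nil mulr0.
eexists; apply: schrodinger_eq (schrodingerD (schrodingerZ (c n) (hU n)) IHr) _ _ _;
  by move=> i x _; rewrite big_cons.
Qed.

Lemma op_graph0 T : op_graph T (fun _ _ => 0) (fun _ _ => 0).
Proof.
exists (fun _ _ => 0), (fun _ _ => 0); split; first split.
- by move=> i; exact: abscont_cst.
- by move=> i; exact: abscont_cst.
- by move=> i; exact/bounded_measurable_L2/bounded_measurable_cst.
- by apply: aeW => x Ix i; rewrite oppr0 add0r big1// => j _; rewrite mulr0.
- by move=> i; split; rewrite big1// => j _; rewrite mulr0.
Qed.

Lemma op_graphD T u v f g : op_graph T u f -> op_graph T v g ->
  op_graph T (fun i x => u i x + v i x) (fun i x => f i x + g i x).
Proof.
move=> [u1 [u2 [hu cu]]] [v1 [v2 [hv cv]]].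
eexists; eexists; split; first exact: schrodingerD hu hv.
move=> i /=; have [-> ->] := cu i; have [-> ->] := cv i.
by split; rewrite -big_split; apply: eq_bigr => j _; rewrite mulrDr.
Qed.

Lemma op_graphZ T k u f : op_graph T u f ->
  op_graph T (fun i x => k * u i x) (fun i x => k * f i x).
Proof.
move=> [u1 [u2 [hu cu]]].
eexists; eexists; split; first exact: schrodingerZ k _ _ _ _ hu.
move=> i /=; have [-> ->] := cu i.
by split; rewrite mulr_sumr; apply: eq_bigr => j _; rewrite mulrCA.
Qed.

Lemma op_graph_eq T u f u' f' : op_graph T u f ->
  (forall i x, I x -> u i x = u' i x) -> (forall i x, I x -> f i x = f' i x) ->
  op_graph T u' f'.
Proof.
move=> [u1 [u2 [hu cu]]] uu' ff'; exists u1, u2; split.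
  exact: schrodinger_eq hu _ _ _.
move=> i; have [e1 e2] := cu i; split=> //; rewrite -uu'// e1.
by apply: eq_bigr => j _; rewrite uu'.
Qed.

Hypothesis q_L2 : forall i j, L2 (fun x => q x i j).
Hypothesis q_sym : forall x i j, q x i j = q x j i.

(** The derivative of [u1 v - u v1] is [u2 v - u v2], from which the symmetric
    potential drops out. *)
Lemma lagrange_identity u u1 u2 f v v1 v2 g :
  schrodinger u u1 u2 f -> schrodinger v v1 v2 g ->
  \sum_i (u1 i 1 * v i 1 - u i 1 * v1 i 1) -
  \sum_i (u1 i 0 * v i 0 - u i 0 * v1 i 0) = ip u g - ip f v.
Proof.
move=> hu hv; have [Lu Lu1 Lf] := schrodinger_L2 hu; have [Lv Lv1 Lg] := schrodinger_L2 hv.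
have [au au1 _ fE] := hu; have [av av1 _ gE] := hv.
pose W x := \sum_i (u1 i x * v i x + -1 * (u i x * v1 i x)).
pose w x := \sum_i ((u2 i x * v i x + u1 i x * v1 i x) +
                    -1 * (u1 i x * v1 i x + u i x * v2 i x)).
have Ww : abscont W w.
  apply: abscont_sum => i; apply: abscontD; first exact: abscontM.
  by apply: abscontZ; exact: abscontM.
have WE x : W x = \sum_i (u1 i x * v i x - u i x * v1 i x).
  by apply: eq_bigr => i _; rewrite mulN1r.
rewrite -!WE -(abscont_total Ww) /ip -primB//; [|exact: L1_ip..].
apply: ae_eq_prim => //; first exact: Ww.1.
  by apply: L1B; exact: L1_ip.
apply: ae_impl2 fE gE => x {}fE {}gE Ix; have {}fE := fE Ix; have {}gE := gE Ix.
have symq : \sum_i (\sum_j q x i j * u j x) * v i x =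
    \sum_i u i x * (\sum_j q x i j * v j x).
  under eq_bigr do rewrite mulr_suml.
  rewrite exchange_big /=; apply: eq_bigr => j _; rewrite mulr_sumr.
  by apply: eq_bigr => i _; rewrite q_sym; ring.
have -> : \sum_i u i x * g i x =
    \sum_i u i x * (- v2 i x) + \sum_i u i x * (\sum_j q x i j * v j x).
  by rewrite -big_split; apply: eq_bigr => i _; rewrite gE mulrDr.
have -> : \sum_i f i x * v i x = \sum_i - u2 i x * v i x + \sum_i (\sum_j q x i j * u j x) * v i x.
  by rewrite -big_split; apply: eq_bigr => i _; rewrite fE mulrDl.
rewrite symq opprD addrACA subrr addr0 -sumrB; apply: eq_bigr => i _; ring.
Qed.

Lemma orthonormal_sum T (a b : K -> R) : orthonormal_columns T ->
  \sum_i (\sum_j T i j * a j) * (\sum_j T i j * b j) = \sum_i a i * b i.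
Proof.
move=> oT.
transitivity (\sum_i \sum_j \sum_k (T i j * T i k) * (a j * b k)).
  apply: eq_bigr => i _; rewrite mulr_suml; apply: eq_bigr => j _.
  by rewrite mulr_sumr; apply: eq_bigr => k _; ring.
rewrite exchange_big; apply: eq_bigr => j _; rewrite exchange_big (bigD1 j)//=.
rewrite -mulr_suml oT eqxx mul1r big1 ?addr0// => k kj.
by rewrite -mulr_suml oT eq_sym (negbTE kj) mul0r.
Qed.

(** An orthogonal coupling makes the boundary terms at 0 and 1 equal, hence the
    operator symmetric. *)
Lemma coupled_sum T (u v : K -> R -> R) : orthonormal_columns T ->
  (forall i, u i 1 = \sum_j T i j * u j 0) ->
  (forall i, v i 1 = \sum_j T i j * v j 0) ->
  \sum_i u i 1 * v i 1 = \sum_i u i 0 * v i 0.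
Proof.
move=> oT cu cv; rewrite -(orthonormal_sum (u^~ 0) (v^~ 0) oT).
by apply: eq_bigr => i _; rewrite cu cv.
Qed.

Lemma op_graph_sym T u v f g : orthonormal_columns T ->
  op_graph T u f -> op_graph T v g -> ip f v = ip u g.
Proof.
move=> oT [u1 [u2 [hu cu]]] [v1 [v2 [hv cv]]].
apply/esym/eqP; rewrite -subr_eq0 -(lagrange_identity hu hv) !sumrB.
rewrite (@coupled_sum T u1 v)//; [|by move=> i; case: (cu i)|by move=> i; case: (cv i)].
rewrite (@coupled_sum T u v1)//; [|by move=> i; case: (cu i)|by move=> i; case: (cv i)].
by rewrite subrr.
Qed.

Let al (x : R) := \sum_i \sum_j `|q x i j|.
Let al_L2 : L2 al.
Proof. by apply: L2_sum => i; apply: L2_sum => j; exact/L2_norm. Qed.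
Let al_ge0 x : 0 <= al x.
Proof. by apply: sumr_ge0 => i _; apply: sumr_ge0 => j _. Qed.

Lemma energy_identity T u u1 u2 f : orthonormal_columns T ->
  schrodinger u u1 u2 f -> coupled T u u1 ->
  ip f u = ip u1 u1 + prim (fun x => \sum_i \sum_j q x i j * u j x * u i x) 1.
Proof.
move=> oT hu cu; have [Lu Lu1 Lf] := schrodinger_L2 hu; have [au au1 _ fE] := hu.
have [bu bu1] := schrodinger_bvec hu.
pose W x := \sum_i (u1 i x * u i x).
pose w x := \sum_i (u2 i x * u i x + u1 i x * u1 i x).
have Ww : abscont W w by apply: abscont_sum => i; exact: abscontM.
have W0 : prim w 1 = 0.
  rewrite (abscont_total Ww) /W (@coupled_sum T u1 u)//; first by rewrite subrr.
    by move=> i; case: (cu i).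
  by move=> i; case: (cu i).
have LQ : L1 (fun x => \sum_i \sum_j q x i j * u j x * u i x).
  apply: L1_sum => i _; apply: L1_sum => j _.
  apply: eq_L1 (L1_bounded_mul (bounded_measurableM (bu j) (bu i)) (L2_L1 (q_L2 i j))) => x _.
  by ring.
have Lu1u1 := L1_ip Lu1 Lu1.
have Lfu := L1_ip Lf Lu.
transitivity (ip f u + prim w 1); first by rewrite W0 addr0.
rewrite /ip -!primD//; last exact: Ww.1.
apply: ae_eq_prim => //; [by apply: L1D => //; exact: Ww.1|exact: L1D|].
apply: ae_impl fE => x h Ix; have {}h := h Ix.
rewrite /w -!big_split; apply: eq_bigr => i _ /=.
by rewrite h mulrDl mulr_suml; ring.
Qed.

(** With [W = |u|^2], integrate [(x W)' = W + x W'] to bound [W 1] by the mean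
    of [W] and the integral of [|W'|]; the latter also bounds [W x - W 1], and
    [2 |u u1| <= e u1^2 + u^2 / e]. *)
Lemma sup_bound (u u1 u2 f : K -> R -> R) (e : R) : 0 < e -> schrodinger u u1 u2 f ->
  forall x, I x ->
    \sum_i u i x * u i x <= ip u u + 2 * (e * ip u1 u1 + e^-1 * ip u u).
Proof.
move=> e0 hu; have [Lu Lu1 Lf] := schrodinger_L2 hu; have [au au1 _ fE] := hu.
have Luu := L1_ip Lu Lu; have Lu1u1 := L1_ip Lu1 Lu1.
pose W x := \sum_i (u i x * u i x).
pose w x := \sum_i (u1 i x * u i x + u i x * u1 i x).
have Ww : abscont W w by apply: abscont_sum => i; exact: abscontM.
have ide : abscont (@idfun R) (fun=> 1).
  by apply: abscont_derive => x; exact: cst_continuous.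
have := abscont_total (abscontM ide Ww).
have bid := abscont_bounded_measurable ide.
have LW : L1 W by exact: L1_ip.
have Lw := Ww.1.
have Lidw : L1 (fun s => s * w s) by exact: L1_bounded_mul bid Lw.
rewrite primD//=; last by apply: eq_L1 LW => s _; rewrite mul1r.
rewrite (@eq_prim R (fun s => 1 * W s) W)//; last by move=> s _; rewrite mul1r.
rewrite mul1r mul0r subr0 => W1.
have w_le s : `|w s| <= e * (\sum_i u1 i s * u1 i s) + e^-1 * \sum_i u i s * u i s.
  apply: (le_trans (ler_norm_sum _ _ _)); rewrite !mulr_sumr -big_split.
  apply: ler_sum => i _ /=; rewrite ler_norml.
  have ee : e * e^-1 = 1 by rewrite mulfV// gt_eqF.
  have ei : 0 < e^-1 by rewrite invr_gt0.
  have : 0 <= e^-1 * (e * u1 i s + u i s) ^+ 2 by rewrite mulr_ge0 ?sqr_ge0// ltW.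
  have : 0 <= e^-1 * (e * u1 i s - u i s) ^+ 2 by rewrite mulr_ge0 ?sqr_ge0// ltW.
  have -> : e^-1 * (e * u1 i s - u i s) ^+ 2 =
      (e * e^-1) * (e * u1 i s ^+ 2) - 2 * (e * e^-1) * (u1 i s * u i s) +
      e^-1 * u i s ^+ 2 by ring.
  have -> : e^-1 * (e * u1 i s + u i s) ^+ 2 =
      (e * e^-1) * (e * u1 i s ^+ 2) + 2 * (e * e^-1) * (u1 i s * u i s) +
      e^-1 * u i s ^+ 2 by ring.
  rewrite ee !mul1r => h1 h2; apply/andP; split; lra.
have prim_w : prim (fun s => `|w s|) 1 <= e * ip u1 u1 + e^-1 * ip u u.
  rewrite /ip -!primZ// -primD//; [|exact: L1Z..].
  by apply: le_prim => //; [exact: L1_norm|by apply: L1D; exact: L1Z].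
move=> x Ix.
have Wx : W x = W 1 - (prim w 1 - prim w x).
  by have := Ww.2 x Ix; have := Ww.2 1 unit_itv1; lra.
have h1 : - (prim w 1 - prim w x) <= prim (fun s => `|w s|) 1.
  have : prim (fun s => `|w s| + w s) x <= prim (fun s => `|w s| + w s) 1.
    apply: prim_le_total => //; first by apply: L1D => //; exact: L1_norm.
    by move=> s _; rewrite -lerBlDr sub0r -normrN ler_norm.
  rewrite !primD//; [|exact: L1_norm..].
  have : 0 <= prim (fun s => `|w s|) x by exact: prim_ge0.
  lra.
have h2 : prim (fun s => s * w s) 1 <= prim (fun s => `|w s|) 1.
  apply: le_prim => //; first exact: L1_norm.
  move=> s; rewrite unit_itvE => /andP[s0 s1].
  apply: (le_trans (ler_norm _)); rewrite normrM ger0_norm//.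
  by rewrite ler_piMl.
have WI : prim W 1 = ip u u by [].
rewrite -/(W x) Wx; move: W1; rewrite WI; lra.
Qed.

(** The potential term is at most its total mass times [sup |u|^2], which by
    [sup_bound] with a small [e] is at most half of [|u1|^2] plus a multiple of
    [|u|^2].  This bounds the operator below as well as the derivative of its
    eigenfunctions; [C] is the same for all couplings [T]. *)
Lemma derivative_bound : exists C : R, 0 <= C /\
  forall T u u1 u2 f, orthonormal_columns T ->
    schrodinger u u1 u2 f -> coupled T u u1 ->
    ip u1 u1 <= 2 * (ip f u + C * ip u u).
Proof.
pose M := prim al 1; have M0 : 0 <= M by exact: prim_ge0.
pose e := (4 * M + 4)^-1; have e0 : 0 < e by rewrite invr_gt0; lra.
have Me : 4 * (M * e) <= 1.
  have : (4 * M + 4) * e = 1 by rewrite mulfV// gt_eqF//; lra.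
  nra.
have ei0 : 0 < e^-1 by rewrite invr_gt0.
exists (M * (1 + 2 * e^-1)); split; first by rewrite mulr_ge0//; lra.
move=> T u u1 u2 f oT hu cu; rewrite (energy_identity oT hu cu).
have [Lu Lu1 Lf] := schrodinger_L2 hu; have [bu bu1] := schrodinger_bvec hu.
set S := ip u u + 2 * (e * ip u1 u1 + e^-1 * ip u u).
have LQ : L1 (fun x => \sum_i \sum_j q x i j * u j x * u i x).
  apply: L1_sum => i _; apply: L1_sum => j _.
  apply: eq_L1 (L1_bounded_mul (bounded_measurableM (bu j) (bu i)) (L2_L1 (q_L2 i j))) => x _.
  by ring.
have : - prim (fun x => \sum_i \sum_j q x i j * u j x * u i x) 1 <= M * S.
  rewrite mulrC -primN// -primZ//; last exact: L2_L1.
  apply: le_prim => //; [exact: L1N|by apply: L1Z; exact: L2_L1|].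
  move=> x Ix; have Sx := sup_bound e0 hu Ix; rewrite -/S in Sx.
  apply: (@le_trans _ _ ((\sum_i u i x * u i x) * al x)); last exact: ler_wpM2r.
  apply: (le_trans (ler_norm _)); rewrite normrN.
  apply: (le_trans (ler_norm_sum _ _ _)); rewrite /al mulr_sumr.
  apply: ler_sum => i _; apply: (le_trans (ler_norm_sum _ _ _)).
  rewrite mulr_sumr; apply: ler_sum => j _.
  rewrite -mulrA normrM mulrC; apply: ler_wpM2r => //.
  have sq_le k : u k x * u k x <= \sum_i u i x * u i x.
    by rewrite (bigD1 k)//= lerDl; apply: sumr_ge0 => l _; rewrite -expr2 sqr_ge0.
  have := sq_le i; have := sq_le j; rewrite ler_norml.
  have := sqr_ge0 (u j x + u i x); have := sqr_ge0 (u j x - u i x).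
  by move=> *; apply/andP; split; nra.
have := ip_ge0 u1; have := ip_ge0 u; rewrite /S.
move: (ip u u) (ip u1 u1) (prim _ 1) => a b p a0 b0.
have : (M * e) * b * 4 <= b by rewrite -mulrA mulrCA; nra.
nra.
Qed.

End RealOperator.

(** * The bounded inverse of the shifted operator *)

Section Resolvent.
Context {R : realType} (K : finType) (q : R -> K -> K -> R).
Local Notation I := (@unit_itv R).
Hypothesis q_L2 : forall i j, L2 (fun x => q x i j).
Hypothesis q_sym : forall x i j, q x i j = q x j i.
Implicit Types (u v f : K -> R -> R) (c d : K -> R) (l : R).

(** The first-order system for the pair [(u, u')] equivalent to
    [- u'' + q u = l u]. *)
Definition sys_matrix l (x : R) (a b : K + K) : R :=
  match a, b with
  | inl i, inr j => (i == j)%:R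
  | inr i, inl j => q x i j - l * (i == j)%:R
  | _, _ => 0
  end.

Lemma sys_matrix_L2 l a b : L2 (fun x => sys_matrix l x a b).
Proof.
have L2c (k : R) : L2 (fun=> k) by exact/bounded_measurable_L2/bounded_measurable_cst.
case: a b => [i|i] [j|j] //=; exact: L2D.
Qed.

Lemma sum_delta (h : K -> R) i : \sum_j (i == j)%:R * h j = h i.
Proof.
rewrite (bigD1 i)//= eqxx mul1r big1 ?addr0// => j ji.
by rewrite eq_sym (negbTE ji) mul0r.
Qed.

Lemma initial_value_problem l : exists C : R, 0 <= C /\ forall c d f, L2vec f ->
  exists u u1 u2,
    [/\ schrodinger q u u1 u2 (fun i x => l * u i x + f i x),
        forall i, u i 0 = c i /\ u1 i 0 = d i &
        forall i x, I x ->
          `|u i x| <= C * \sum_j (`|c j| + `|d j| + prim (fun s => `|f j s|) 1) /\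
          `|u1 i x| <= C * \sum_j (`|c j| + `|d j| + prim (fun s => `|f j s|) 1)].
Proof.
have [C [C0 CP]] := linear_system_solution (sys_matrix_L2 l).
exists C; split=> // c d f Lf.
pose cd (a : K + K) : R := match a with inl i => c i | inr i => d i end.
pose g (a : K + K) (x : R) : R := match a with inl i => 0 | inr i => - f i x end.
have Lg a : L1 (g a).
  by case: a => i /=; [exact: L1_cst | exact/L1N/L2_L1].
have [z [zac z0 zle]] := CP cd g Lg.
pose u i := z (inl i); pose u1 i := z (inr i).
pose u2 i x := \sum_j q x i j * u j x - l * u i x - f i x.
have au i : abscont (u i) (u1 i).
  apply: eq_abscont (zac (inl i)) => // x _.
  by rewrite big_sumType /= big1 ?add0r ?addr0 ?sum_delta// => j _; rewrite mul0r.
have au1 i : abscont (u1 i) (u2 i).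
  apply: eq_abscont (zac (inr i)) => // x _.
  rewrite big_sumType /= [X in _ + X + _]big1 ?addr0; last by move=> j _; rewrite mul0r.
  rewrite /u2; congr (_ - _); rewrite -(sum_delta (u^~ x) i) mulr_sumr -sumrB.
  by apply: eq_bigr => j _; rewrite mulrBl mulrA.
exists u, u1, u2; split.
- split=> // [i|].
    apply: L2D => //; apply: L2Z; apply: bounded_measurable_L2.
    exact: abscont_bounded_measurable (au i).
  by apply: aeW => x Ix i; rewrite /u2; ring.
- by move=> i; split; rewrite /u /u1 z0.
- move=> i x Ix.
  have <- : \sum_a (`|cd a| + prim (fun s => `|g a s|) 1) =
      \sum_j (`|c j| + `|d j| + prim (fun s => `|f j s|) 1).
    rewrite big_sumType -[LHS]big_split /=; apply: eq_bigr => j _.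
    rewrite (@eq_prim R _ (fun=> 0))//; last by move=> s _; rewrite normr0.
    rewrite prim_cst// mul0r addr0 addrA; congr (_ + _).
    by apply: eq_prim => // s _; rewrite normrN.
  by split; exact: zle.
Qed.

(** The constant of [initial_value_problem] involves means of [|f|]; this turns
    them into the norm of [f]. *)
Lemma prim_norm_le_ip f j : L2vec f ->
  prim (fun s => `|f j s|) 1 <= Num.sqrt (ip f f).
Proof.
move=> Lf; rewrite -[leLHS]ger0_norm; last exact: prim_ge0.
rewrite -sqrtr_sqr ler_sqrt ?ip_ge0//.
have L2c : L2 (fun=> 1 : R) by exact/bounded_measurable_L2/bounded_measurable_cst.
rewrite (@eq_prim R _ (fun s => `|f j s| * 1))//; last by move=> s _; rewrite mulr1.
apply: (le_trans (cauchy_schwarz_prim _ (L2_norm (Lf j)) L2c)) => //.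
rewrite (@eq_prim R (fun=> 1 ^+ 2) (fun=> 1))//; last by move=> s _; rewrite expr1n.
rewrite prim_cst// mulr1 mulr1; apply: le_prim => //.
- exact: (L2_norm (Lf j)).2.
- exact: L1_ip.
- move=> s _; rewrite real_normK ?num_real// (bigD1 j)//= -expr2 lerDl.
  by apply: sumr_ge0 => k _; rewrite -expr2 sqr_ge0.
Qed.

(** The symplectic form on Cauchy data: the boundary term of the Lagrange
    identity. *)
Definition symp (a b : K + K -> R) : R :=
  \sum_i (a (inr i) * b (inl i) - a (inl i) * b (inr i)).

Definition symp_dual (a : K + K -> R) (k : K + K) : R :=
  match k with inl i => - a (inr i) | inr i => a (inl i) end.

Lemma symp_dualE a b : symp b a = \sum_k symp_dual a k * b k.
Proof.
rewrite /symp big_sumType /= sumrB addrC -sumrN; congr (_ + _); apply: eq_bigr => i _; ring.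
Qed.

Definition cauchy_data (u u1 : K -> R -> R) (x : R) (k : K + K) : R :=
  match k with inl i => u i x | inr i => u1 i x end.

Lemma symp_eq0 b : (forall a, symp a b = 0) -> forall k, b k = 0.
Proof.
move=> b0 [i|i].
  have := b0 (fun k => if k is inr j then (i == j)%:R else 0).
  rewrite /symp (eq_bigr (fun j => (i == j)%:R * b (inl j))) ?sum_delta// => j _.
  by rewrite mul0r subr0.
have := b0 (fun k => if k is inl j then - (i == j)%:R else 0).
rewrite /symp (eq_bigr (fun j => (i == j)%:R * b (inr j))) ?sum_delta// => j _.
by rewrite mul0r sub0r mulNr opprK.
Qed.

Lemma sympB a b b' : symp a (fun k => b k - b' k) = symp a b - symp a b'.
Proof. by rewrite /symp -sumrB; apply: eq_bigr => i _; ring. Qed.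

Definition mul_fun (M : K + K -> K + K -> R) (a : K + K -> R) (k : K + K) : R :=
  \sum_l M k l * a l.

(** Nondegeneracy of the form gives [M] a left inverse, the symplectic adjoint,
    and in finite dimension a left inverse is a right inverse. *)
Lemma symp_invariant_surj (M : K + K -> K + K -> R) :
  (forall a b, symp (mul_fun M a) (mul_fun M b) = symp a b) ->
  forall e, exists a, forall k, mul_fun M a k = e k.
Proof.
move=> Minv.
pose dl (k l : K + K) : R := (k == l)%:R.
pose y (k : K + K) : K + K -> R :=
  match k with inl i => fun s => - dl (inr i) s | inr i => dl (inl i) end.
have sy a k : symp a (y k) = a k.
  rewrite /symp; case: k => i /=.
    rewrite (eq_bigr (fun j => (i == j)%:R * a (inl j))) ?sum_delta// => j _.
    have e : (inr i == inr j :> K + K) = (i == j) by [].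
    by rewrite /y /dl /= e; ring.
  rewrite (eq_bigr (fun j => (i == j)%:R * a (inr j))) ?sum_delta// => j _.
  have e : (inl i == inl j :> K + K) = (i == j) by [].
  by rewrite /y /dl /= e; ring.
pose N k s := symp_dual (mul_fun M (y k)) s.
have NM k s : \sum_r N k r * M r s = (k == s)%:R.
  have := sy (dl s) k; rewrite -Minv symp_dualE /dl eq_sym => <-.
  apply: eq_bigr => r _; congr (_ * _); rewrite /mul_fun (bigD1 s)//= eqxx mulr1.
  by rewrite big1 ?addr0// => t ts; rewrite eq_sym (negbTE ts) mulr0.
have MN := left_inverse_right NM.
move=> e; exists (fun s => \sum_r N s r * e r) => k; rewrite /mul_fun.
under eq_bigr do rewrite mulr_sumr.
rewrite exchange_big /= (eq_bigr (fun r => (k == r)%:R * e r)); last first.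
  by move=> r _; rewrite -MN mulr_suml; apply: eq_bigr => s _; rewrite mulrA.
rewrite (bigD1 k)//= eqxx mul1r big1 ?addr0// => r rk.
by rewrite eq_sym (negbTE rk) mul0r.
Qed.

(** Solve the equation with zero Cauchy data and correct the solution by a
    solution of the homogeneous equation.  With [M] the monodromy matrix and
    [tau] the coupling, the correction [c] must satisfy [(M - tau) c = - d], where
    [d] is the boundary defect.  A left null vector of [M - tau] is the symplectic
    dual of some [e] with [M c0 = tau c0 = e], because [M] and [tau] are both
    symplectic; so it comes from an eigenfunction, and by the Lagrange identity it
    kills [d] as soon as [f] is orthogonal to that eigenfunction. *)
Lemma bounded_resolvent l T : orthonormal_columns T -> exists C : R, 0 <= C /\
  forall f, L2vec f ->
    (forall e, op_graph q T e (fun i x => l * e i x) -> ip f e = 0) ->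
    exists u, op_graph q T u (fun i x => l * u i x + f i x) /\
      ip u u <= C * ip f f.
Proof.
move=> oT; have [C [C0 ivp]] := initial_value_problem l.
pose tau (a b : K + K) : R := match a, b with
  | inl i, inl j => T i j | inr i, inr j => T i j | _, _ => 0 end.
have tau_l b i : mul_fun tau b (inl i) = \sum_j T i j * b (inl j).
  by rewrite /mul_fun big_sumType /= [X in _ + X]big1 ?addr0// => j _; rewrite mul0r.
have tau_r b i : mul_fun tau b (inr i) = \sum_j T i j * b (inr j).
  by rewrite /mul_fun big_sumType /= big1 ?add0r// => j _; rewrite mul0r.
have tau_symp a b : symp (mul_fun tau a) (mul_fun tau b) = symp a b.
  rewrite /symp; under eq_bigr do rewrite !tau_l !tau_r.
  by rewrite !sumrB !orthonormal_sum.
pose z0 (i : K) (x : R) : R := 0.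
have Lz0 : L2vec z0.
  by move=> i; exact/bounded_measurable_L2/bounded_measurable_cst.
pose dl (k r : K + K) : R := (k == r)%:R.
have /choice[U0 U0P] k : exists U : (K -> R -> R) * (K -> R -> R) * (K -> R -> R),
    [/\ schrodinger q U.1.1 U.1.2 U.2 (fun i x => l * U.1.1 i x + z0 i x),
      forall i, U.1.1 i 0 = dl k (inl i) /\ U.1.2 i 0 = dl k (inr i) &
      forall i x, I x -> `|U.1.1 i x| <= C * \sum_j
         (`|dl k (inl j)| + `|dl k (inr j)| + prim (fun s => `|z0 j s|) 1)].
  have [u [u1 [u2 [h h0 hb]]]] := ivp (fun i => dl k (inl i)) (fun i => dl k (inr i)) _ Lz0.
  exists (u, u1, u2); split=> // i x Ix.
  by have [] := hb i x Ix.
pose U k := (U0 k).1.1; pose U1 k := (U0 k).1.2.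
pose S := C * \sum_k \sum_j
   (`|dl k (inl j)| + `|dl k (inr j)| + prim (fun s => `|z0 j s|) 1).
have Sterm0 k j : 0 <= `|dl k (inl j)| + `|dl k (inr j)| + prim (fun s => `|z0 j s|) 1.
  by rewrite !addr_ge0//; exact: prim_ge0.
have S0 : 0 <= S.
  by rewrite mulr_ge0//; apply: sumr_ge0 => k _; apply: sumr_ge0 => j _; exact: Sterm0.
have US k i x : I x -> `|U k i x| <= S.
  move=> Ix; have [_ _ h] := U0P k; apply: (le_trans (h i x Ix)).
  rewrite ler_wpM2l// [leRHS](bigD1 k)//= lerDl; apply: sumr_ge0 => r _.
  by apply: sumr_ge0 => j _; exact: Sterm0.
pose M k r := cauchy_data (U r) (U1 r) 1 k.
(* the homogeneous solution with Cauchy data a at 0; M is the monodromy matrix *)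
pose E (a : K + K -> R) i x := \sum_k a k * U k i x.
pose E1 (a : K + K -> R) i x := \sum_k a k * U1 k i x.
have hom a : exists w2, schrodinger q (E a) (E1 a) w2 (fun i x => l * E a i x).
  have [|w2 hw] := @schrodinger_sum R K q _ (index_enum (K + K)%type) a U U1
    (fun k => (U0 k).2) (fun k i x => l * U k i x + z0 i x).
    by move=> k; have [] := U0P k.
  exists w2; apply: schrodinger_eq hw _ _ _ => // i x _.
  by rewrite /E mulr_sumr; apply: eq_bigr => k _; rewrite addr0 mulrCA.
have hom0 a k : cauchy_data (E a) (E1 a) 0 k = a k.
  rewrite -[RHS](_ : \sum_r a r * dl r k = _); last first.
    rewrite (bigD1 k)//= /dl eqxx mulr1 big1 ?addr0// => r rk.
    by rewrite (negbTE rk) mulr0.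
  by case: k => i /=; apply: eq_bigr => r _; have [_ h _] := U0P r; have [h1 h2] := h i;
     congr (_ * _).
have hom1 a k : cauchy_data (E a) (E1 a) 1 k = mul_fun M a k.
  by case: k => i /=; apply: eq_bigr => r _; rewrite mulrC.
have symp_ext X X' Z Z' : (forall k, X k = X' k) -> (forall k, Z k = Z' k) ->
    symp X Z = symp X' Z'.
  by move=> XX' ZZ'; apply: eq_bigr => i _; rewrite !XX' !ZZ'.
have M_symp a b : symp (mul_fun M a) (mul_fun M b) = symp a b.
  have [w2 ha] := hom a; have [w2' hb] := hom b.
  have [La _ _] := schrodinger_L2 ha; have [Lb _ _] := schrodinger_L2 hb.
  rewrite -(symp_ext _ _ _ _ (hom1 a) (hom1 b)) -(symp_ext _ _ _ _ (hom0 a) (hom0 b)).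
  apply/eqP; rewrite -subr_eq0; apply/eqP.
  apply: etrans (lagrange_identity q_sym ha hb) _.
  by rewrite ipC !ipZl// [ip (E b) _]ipC subrr.
pose B k r := M k r - tau k r.
have BE a k : \sum_r B k r * a r = mul_fun M a k - mul_fun tau a k.
  by rewrite /mul_fun -sumrB; apply: eq_bigr => r _; rewrite mulrBl.
have [P PP] := solvable_linear_system B.
pose D := C * #|K|%:R; have D0 : 0 <= D by rewrite mulr_ge0.
pose G := D + \sum_k (\sum_r `|P k r|) * D * S.
have G0 : 0 <= G.
  apply: addr_ge0 => //; apply: sumr_ge0 => k _.
  by apply: mulr_ge0 => //; apply: mulr_ge0 => //; exact: sumr_ge0.
exists (#|K|%:R * G ^+ 2); split; first by rewrite mulr_ge0// sqr_ge0.
move=> f Lf fperp.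
have [z [z1 [z2 [hz hz0 hzb]]]] := ivp (fun=> 0) (fun=> 0) f Lf.
pose N := Num.sqrt (ip f f); have N0 : 0 <= N by exact: sqrtr_ge0.
have Nle : C * \sum_j (`|0 : R| + `|0 : R| + prim (fun s => `|f j s|) 1) <= D * N.
  rewrite -mulrA ler_wpM2l// mulr_natl -sumr_const.
  by apply: ler_sum => j _; rewrite normr0 !add0r; exact: prim_norm_le_ip.
pose d k := - cauchy_data z z1 1 k.
have dN k : `|d k| <= D * N.
  by rewrite normrN; case: k => i /=; have [h1 h2] := hzb i 1 unit_itv1; exact: le_trans Nle.
have dsolv w : (forall j, \sum_i w i * B i j = 0) -> \sum_i w i * d i = 0.
  move=> wB.
  pose e (k : K + K) := match k with inl i => w (inr i) | inr i => - w (inl i) end.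
  have we X : \sum_k w k * X k = symp X e.
    by rewrite symp_dualE; apply: eq_bigr => -[i|i] _ /=; rewrite ?opprK.
  have [c0 c0P] := symp_invariant_surj tau_symp e.
  have eM k : e k = mul_fun M c0 k.
    apply/eqP; rewrite -subr_eq0; apply/eqP; move: k; apply: symp_eq0 => Y.
    have [a aY] := symp_invariant_surj M_symp Y.
    rewrite sympB -(symp_ext _ _ _ _ aY (fun=> erefl)).
    rewrite -(symp_ext _ _ (mul_fun M c0) _ aY (fun=> erefl)) M_symp.
    rewrite -(tau_symp a c0) (symp_ext _ (mul_fun tau a) _ e _ c0P)//.
    apply/eqP; rewrite -!we -sumrB; apply/eqP.
    rewrite (eq_bigr (fun k => \sum_r a r * (w k * B k r))); last first.
      by move=> k _; rewrite -mulrBr -BE mulr_sumr; apply: eq_bigr => r _; ring.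
    by rewrite exchange_big big1//= => r _; rewrite -mulr_sumr wB mulr0.
  have [w2 hE] := hom c0.
  have opE : op_graph q T (E c0) (fun i x => l * E c0 i x).
    eexists; exists w2; split; first exact: hE.
    move=> i; have -> : E c0 i 1 = mul_fun M c0 (inl i) := hom1 c0 (inl i).
    have -> : E1 c0 i 1 = mul_fun M c0 (inr i) := hom1 c0 (inr i).
    rewrite -!eM -!c0P tau_l tau_r; split; apply: eq_bigr => j _.
      by have -> : E c0 j 0 = c0 (inl j) := hom0 c0 (inl j).
    by have -> : E1 c0 j 0 = c0 (inr j) := hom0 c0 (inr j).
  have [Lz _ _] := schrodinger_L2 hz; have [LE _ _] := schrodinger_L2 hE.
  have := lagrange_identity q_sym hz hE.
  rewrite ipDl//; last exact: L2vecZ.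
  rewrite ipZl// fperp// addr0 [ip z (fun _ _ => _)]ipC ipZl// [ip (E c0) z]ipC subrr.
  rewrite [X in _ - X]big1; last by move=> i _; have [-> ->] := hz0 i; rewrite !mul0r subrr.
  rewrite subr0 => sz.
  transitivity (- \sum_k w k * cauchy_data z z1 1 k).
    by rewrite -sumrN; apply: eq_bigr => k _; rewrite /d mulrN.
  rewrite we (symp_ext _ (cauchy_data z z1 1) _ (cauchy_data (E c0) (E1 c0) 1))//.
    by rewrite [symp _ _]sz oppr0.
  by move=> k; rewrite hom1.
have Bc := PP d dsolv; pose c k := \sum_r P k r * d r; rewrite -/c in Bc.
have [w2 hc] := hom c.
have hu := schrodingerD hz hc; pose u i x := z i x + E c i x.
exists u; split.
  eexists; eexists; split.
    apply: schrodinger_eq hu _ _ _ => [//|//|] i x _.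
    by rewrite mulrDr addrAC.
  move=> i; have := Bc (inl i); have := Bc (inr i).
  rewrite !BE -!hom1 tau_l tau_r /= => br bl; have [z0i z10i] := hz0 i.
  have e0 j : u j 0 = c (inl j) by rewrite /u (hz0 j).1 add0r; exact: (hom0 c (inl j)).
  have e1 j : z1 j 0 + E1 c j 0 = c (inr j).
    by rewrite (hz0 j).2 add0r; exact: (hom0 c (inr j)).
  split.
    rewrite (eq_bigr (fun j => T i j * c (inl j))); last by move=> j _; rewrite e0.
    by move: bl; rewrite /u /d /=; lra.
  rewrite (eq_bigr (fun j => T i j * c (inr j))); last by move=> j _; rewrite e1.
  by move: br; rewrite /d /=; lra.
have uG i x : I x -> `|u i x| <= G * N.
  move=> Ix; apply: (le_trans (ler_normD _ _)); rewrite /G mulrDl; apply: lerD.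
    by have [h _] := hzb i x Ix; exact: le_trans Nle.
  apply: (le_trans (ler_norm_sum _ _ _)); rewrite mulr_suml; apply: ler_sum => k _.
  rewrite normrM mulrAC; apply: ler_pM => //; last exact: US.
  rewrite -mulrA mulr_suml; apply: (le_trans (ler_norm_sum _ _ _)).
  by apply: ler_sum => r _; rewrite normrM ler_wpM2l.
have [Lu _ _] := schrodinger_L2 hu.
have NN : N ^+ 2 = ip f f by rewrite sqr_sqrtr// ip_ge0.
rewrite -NN -mulrA -exprMn -[leRHS]mulr1 -prim_cst//; apply: le_prim => //.
- exact: L1_ip.
- exact: L1_cst.
move=> x Ix; rewrite mulr_natl -sumr_const; apply: ler_sum => i _.
rewrite -expr2 -real_normK ?num_real// ler_sqr ?nnegrE//; first exact: uG.
by rewrite mulr_ge0.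
Qed.

End Resolvent.

(** * The variational characterization of eigenvalues *)

Section Variational.
Context {R : realType} (K : finType) (q : R -> K -> K -> R).
Local Notation I := (@unit_itv R).
Hypothesis q_L2 : forall i j, L2 (fun x => q x i j).
Hypothesis q_sym : forall x i j, q x i j = q x j i.
Implicit Types (u v f g e : K -> R -> R).

(** The Gram system is solvable: a combination of the [U n] in the kernel of the
    Gram matrix has norm 0, hence is orthogonal to [u] by Cauchy-Schwarz. *)
Lemma ip_projection (N : finType) (U : N -> K -> R -> R) u :
  L2vec u -> (forall n, L2vec (U n)) ->
  exists c : N -> R, forall n,
    ip (fun i x => u i x + \sum_m c m * U m i x) (U n) = 0.
Proof.
move=> Lu LU.
have [P PP] := solvable_linear_system (fun n m => ip (U m) (U n)).
have dP (w : N -> R) : (forall m, \sum_n w n * ip (U m) (U n) = 0) ->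
    \sum_n w n * - ip u (U n) = 0.
  move=> w0; pose W i x := \sum_m w m * U m i x.
  have LW : L2vec W by exact: L2vec_sum.
  have WU n : ip W (U n) = 0.
    rewrite ip_suml// -[RHS](w0 n); apply: eq_bigr => m _; by rewrite ipC.
  have WW : ip W W = 0 by rewrite {1}/W ip_suml// big1// => m _; rewrite ipC WU mulr0.
  have := ip_cauchy_schwarz Lu LW; rewrite WW mulr0 => uW.
  have {uW} : ip u W = 0.
    by apply/eqP; rewrite -sqrf_eq0 eq_le uW sqr_ge0.
  rewrite ipC ip_suml// => E; rewrite -[RHS]oppr0 -[in RHS]E -sumrN.
  by apply: eq_bigr => n _; rewrite ipC mulrN.
have := PP _ dP; pose c m := \sum_k P m k * - ip u (U k) => cP; exists c => n.
rewrite ipDl//; last exact: L2vec_sum.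
rewrite ip_suml// -[X in X + _]opprK -cP addrC; apply/eqP; rewrite subr_eq0.
by apply/eqP; apply: eq_bigr => m _; rewrite mulrC.
Qed.

(** The eigenspace is spanned by finitely many of its vectors, which makes the
    projection onto it available. *)
Definition finite_eigenspace T l := exists (N : finType) (E : N -> K -> R -> R),
  (forall n, op_graph q T (E n) (fun i x => l * E n i x)) /\
  forall e, op_graph q T e (fun i x => l * e i x) ->
    exists c : N -> R, forall i x, I x -> e i x = \sum_n c n * E n i x.

Definition orthogonal_below T z v := forall l e, l < z ->
  op_graph q T e (fun i x => l * e i x) -> ip v e = 0.

Lemma op_graph_sum T (N : finType) (c : N -> R) (E F : N -> K -> R -> R) u f :
  op_graph q T u f -> (forall n, op_graph q T (E n) (F n)) ->
  op_graph q T (fun i x => u i x + \sum_n c n * E n i x)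
    (fun i x => f i x + \sum_n c n * F n i x).
Proof.
move=> opu opE.
suff : forall r : seq N, op_graph q T (fun i x => u i x + \sum_(n <- r) c n * E n i x)
    (fun i x => f i x + \sum_(n <- r) c n * F n i x) by apply.
elim=> [|n r IHr].
  by apply: op_graph_eq opu _ _ => i x _; rewrite big_nil addr0.
apply: op_graph_eq (op_graphD IHr (op_graphZ (c n) (opE n))) _ _ => i x _;
  by rewrite big_cons; ring.
Qed.

(** Let [s] be the best lower bound up to [z] on the vectors orthogonal to the
    eigenfunctions below [z].  If [s < z], such a [v] equals [(L - s) w] for a [w]
    of the same kind with [<v, w> <= (D + 1) |v|^2], by [bounded_resolvent] and a
    projection off the eigenspace of [s].  Cauchy-Schwarz for the nonnegative form
    of [L - s] gives [|v|^4 <= <(L - s) v, v> <v, w>], which improves [s]. *)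
Theorem variational_bound T z v g : orthonormal_columns T ->
  (forall l, l < z -> finite_eigenspace T l) ->
  op_graph q T v g -> orthogonal_below T z v -> z * ip v v <= ip g v.
Proof.
move=> oT fin_eig opv0 vz0; move: v g opv0 vz0.
pose bounded_by s := forall v g, op_graph q T v g -> orthogonal_below T z v ->
  s * ip v v <= ip g v.
have [C [C0 dC]] := derivative_bound q_L2.
have lowC : bounded_by (- C).
  move=> v g [u1 [u2 [hv cv]]] _; have := dC T v u1 u2 g oT hv cv.
  by have := ip_ge0 u1; lra.
pose A := [set s | s <= z /\ bounded_by s].
have A0 : A !=set0.
  exists (Num.min z (- C)); split; first by rewrite ge_min lexx.
  move=> v g opv vz; apply: le_trans (lowC v g opv vz).
  by rewrite ler_wpM2r ?ip_ge0// ge_min lexx orbT.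
have ubA : ubound A z by move=> s [].
pose s := sup A.
have sz : s <= z by apply: ge_sup.
have sB : bounded_by s.
  move=> v g opv vz; have := ip_ge0 v; rewrite le_eqVlt => /predU1P[v0|v0].
    have [a [_ aB]] := A0; have := aB v g opv vz.
    by rewrite -v0 !mulr0.
  rewrite -ler_pdivlMr//; apply: ge_sup => // a [_ aB].
  by rewrite ler_pdivlMr//; exact: aB.
have [szE|sltz] := eqVneq s z.
  by move=> v g opv vz; rewrite -[X in X * _]szE; exact: sB.
have {sltz sz} sltz : s < z by rewrite lt_neqAle sltz.
have [D [D0 res]] := bounded_resolvent q_L2 q_sym s oT.
have [N [E [opE spanE]]] := fin_eig s sltz.
have LE n : L2vec (E n) by case: (op_L2 (opE n)).
have improve v g : op_graph q T v g -> orthogonal_below T z v ->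
    ip v v <= (D + 1) * (ip g v - s * ip v v).
  move=> opv vz; have [Lv Lg] := op_L2 opv.
  have [|u [opu uD]] := res v Lv; first by move=> e; exact: vz.
  have [Lu _] := op_L2 opu.
  have [c cE] := ip_projection Lu LE.
  set w := (fun i x => u i x + \sum_m c m * E m i x) in cE.
  have opw : op_graph q T w (fun i x => s * w i x + v i x).
    apply: op_graph_eq (op_graph_sum c opu opE) _ _ => // i x _.
    rewrite /w mulrDr -addrA [v i x + _]addrC addrA; congr (_ + _ + _).
    by rewrite mulr_sumr; apply: eq_bigr => n _; rewrite mulrCA.
  have [Lw Lsw] := op_L2 opw.
  have Lsw' : L2vec (fun i x => s * w i x) by exact: L2vecZ.
  have wz : orthogonal_below T z w.
    move=> l e lz ope; have [Le _] := op_L2 ope.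
    have [lsE|ls] := eqVneq l s.
      have [d dE] := spanE e (eq_ind l (fun l => op_graph q T e (fun i x => l * e i x)) ope s lsE).
      rewrite (ip_eq (u' := w) (v' := fun i x => \sum_n d n * E n i x))//.
      rewrite ipC ip_suml// big1// => n _.
      by rewrite ipC cE mulr0.
    have := op_graph_sym q_sym oT opw ope.
    rewrite ipDl// ipZl// (vz l)// addr0 [RHS]ipC ipZl// [ip e w]ipC => /eqP.
    rewrite -subr_eq0 -mulrBl mulf_eq0 subr_eq0 eq_sym (negbTE ls) /= => /eqP.
    by [].
  have vw : ip v w = ip v u.
    rewrite /w ipC ipDl//; last exact: L2vec_sum.
    rewrite ip_suml// [X in _ + X]big1 ?addr0; first by rewrite ipC.
    by move=> n _; rewrite ipC (vz s)// mulr0.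
  have gw : ip g w = s * ip v w + ip v v.
    rewrite (op_graph_sym q_sym oT opv opw) ipC ipDl// ipZl//.
    by rewrite [ip w v]ipC.
  have e1 : ip (fun i x => s * w i x + v i x) v = s * ip v w + ip v v.
    by rewrite ipDl// ipZl// [ip w v]ipC.
  have e2 : ip (fun i x => s * w i x + v i x) w = s * ip w w + ip v w.
    by rewrite ipDl// ipZl.
  have CS : ip v v ^+ 2 <= (ip g v - s * ip v v) * ip v w.
    have expand r : ip (fun i x => g i x + r * (s * w i x + v i x))
          (fun i x => v i x + r * w i x) -
        s * ip (fun i x => v i x + r * w i x) (fun i x => v i x + r * w i x) =
        (ip g v - s * ip v v) + r * ip v v *+ 2 + r ^+ 2 * ip v w.
      by rewrite !ip_pencil// e1 e2 gw [ip w v]ipC mulr2n; ring.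
    have nonneg r : 0 <= (ip g v - s * ip v v) + r * ip v v *+ 2 + r ^+ 2 * ip v w.
      rewrite -expand subr_ge0; apply: sB.
        by apply: op_graphD => //; exact: op_graphZ.
      move=> l e lz ope; have [Le _] := op_L2 ope.
      rewrite ipDl//; last exact: L2vecZ.
      by rewrite ipZl// (vz l)// (wz l)// mulr0 addr0.
    apply: discriminant_le => //.
    have := sB _ _ opw wz; rewrite e2; lra.
  have vuD : ip v u <= (D + 1) * ip v v.
    have := ip_cauchy_schwarz Lv Lu; have := ip_ge0 v; have := ip_ge0 u.
    move: (ip v u) (ip v v) (ip u u) uD => a b c' uD c0 b0 abc.
    rewrite leNgt; apply/negP => lt_a.
    have : ((D + 1) * b) ^+ 2 < a ^+ 2.
      by rewrite ltr_sqr ?nnegrE//; nra.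
    have : b * c' <= b * (D * b) by rewrite ler_wpM2l.
    have : 0 <= b * b by rewrite mulr_ge0.
    nra.
  have b0 : 0 <= ip g v - s * ip v v by have := sB v g opv vz; lra.
  rewrite vw in CS.
  have := ip_ge0 v; rewrite le_eqVlt => /predU1P[v0|v0].
    by rewrite -[leLHS]v0 mulr_ge0// addr_ge0.
  rewrite -(ler_pM2r v0) -expr2; apply: (le_trans CS).
  by rewrite [X in _ <= X * _]mulrC -mulrA; exact: ler_wpM2l.
have D1 : 0 < D + 1 by rewrite ltr_wpDl.
have : A (Num.min z (s + (D + 1)^-1)).
  split; first by rewrite ge_min lexx.
  move=> v g opv vz; have := improve v g opv vz.
  rewrite -ler_pdivrMl// => h.
  apply: (@le_trans _ _ ((s + (D + 1)^-1) * ip v v)).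
    by rewrite ler_wpM2r ?ip_ge0// ge_min lexx orbT.
  by rewrite mulrDl; lra.
move=> /(ub_le_sup (ex_intro _ z ubA)); rewrite -/s leNgt lt_min sltz /=.
by rewrite ltrDl invr_gt0 D1.
Qed.

End Variational.

(** * The real form of the complex operator *)

Section ComplexComponents.
Context {R : realType}.
Notation leb := (@lebesgue_measure R).
Local Notation I := (@unit_itv R).
Implicit Types (z w : R[i]) (f g : R -> R[i]).

(** The real ([false]) and imaginary ([true]) parts, indexed by booleans so that
    a complex vector becomes a real one indexed by pairs. *)
Definition part (b : bool) z : R := if b then complex.Im z else complex.Re z.

(** The real 2 x 2 matrix of multiplication by [z]. *)
Definition cmul_mx z (b b' : bool) : R :=
  match b, b' with
  | false, false | true, true => complex.Re z
  | false, true => - complex.Im z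
  | true, false => complex.Im z
  end.

Lemma part_eq z w : (forall b, part b z = part b w) -> z = w.
Proof.
by case: z w => [a b] [c d] h; have /= := h false; have /= := h true => -> ->.
Qed.

Lemma partD b z w : part b (z + w) = part b z + part b w.
Proof. by case: z w b => [? ?] [? ?] []. Qed.

Lemma partN b z : part b (- z) = - part b z.
Proof. by case: z b => [? ?] []. Qed.

Lemma part_sum b (N : Type) (r : seq N) (P : pred N) (F : N -> R[i]) :
  part b (\sum_(n <- r | P n) F n) = \sum_(n <- r | P n) part b (F n).
Proof.
elim: r => [|n r IHr]; first by rewrite !big_nil; case: b.
by rewrite !big_cons; case: (P n); rewrite ?partD IHr.
Qed.

Lemma partM b z w : part b (z * w) = \sum_b' cmul_mx z b b' * part b' w.
Proof.
rewrite big_bool; case: z w b => [a b] [c d] [] /=; ring.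
Qed.

Lemma part_real b (a : R) z : part b (a%:C * z) = a * part b z.
Proof. by case: z b => [? ?] [] /=; ring. Qed.

Lemma part_norm b z : `|part b z| <= Normc.normc z.
Proof.
case: z b => [a b] [] /=; rewrite -sqrtr_sqr ler_wsqrtr//.
  by rewrite lerDr sqr_ge0.
by rewrite lerDl sqr_ge0.
Qed.

Lemma normc_le_parts z : Normc.normc z <= `|part false z| + `|part true z|.
Proof.
case: z => [a b] /=; rewrite -[leRHS]ger0_norm ?addr_ge0// -sqrtr_sqr ler_wsqrtr//.
rewrite sqrrD !real_normK ?num_real// lerD2r lerDl mulrn_wge0// mulr_ge0//.
Qed.

Lemma normc_sqr z : Normc.normc z ^+ 2 = part false z ^+ 2 + part true z ^+ 2.
Proof. by case: z => [a b] /=; rewrite sqr_sqrtr// addr_ge0// sqr_ge0. Qed.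

Lemma measurable_normc f : (forall b, measurable_fun I (fun x => part b (f x))) ->
  measurable_fun I (fun x => Normc.normc (f x)).
Proof.
move=> mf.
have -> : (fun x => Normc.normc (f x)) =
    Num.sqrt \o (fun x => part false (f x) ^+ 2 + part true (f x) ^+ 2).
  by apply/funext => x /=; case: (f x).
apply: measurableT_comp.
  by apply: continuous_measurable_fun; exact: sqrt_continuous.
by apply: measurable_funD; exact: measurable_funX.
Qed.

Lemma cmeasurableE f : cmeasurable 0 1 f <->
  forall b, measurable_fun I (fun x => part b (f x)).
Proof. by split=> [[mr mi] []|mf]//; split; [exact: (mf false)|exact: (mf true)]. Qed.

Lemma integrable_onE f : integrable_on 0 1 f <-> forall b, L1 (fun x => part b (f x)).
Proof.
split=> [[/cmeasurableE mf Lf] b|Lf].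
  by apply: le_L1 (mf b) _ Lf => x _; exact: part_norm.
have mf b : measurable_fun I (fun x => part b (f x)) by exact: L1_measurable.
split; first exact/cmeasurableE.
apply: (@le_L1 _ _ (fun x => `|part false (f x)| + `|part true (f x)|)).
- exact: measurable_normc.
- move=> x _; rewrite ger0_norm; first exact: normc_le_parts.
  by case: (f x) => a b /=; exact: sqrtr_ge0.
- by apply: L1D; exact/L1_norm/Lf.
Qed.

Lemma square_integrable_onE f : square_integrable_on 0 1 f <->
  forall b, L2 (fun x => part b (f x)).
Proof.
split=> [[/cmeasurableE mf Lf] b|Lf].
  split; first exact: mf.
  apply: le_L1 Lf; first exact: measurable_funX.
  move=> x _; rewrite ger0_norm ?sqr_ge0// normc_sqr.
  by case: b; rewrite ?lerDr ?lerDl sqr_ge0.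
split; first by apply/cmeasurableE => b; exact: (Lf b).1.
apply: eq_L1 (L1D (Lf false).2 (Lf true).2) => x _.
by rewrite normc_sqr.
Qed.

Lemma part_cintegral b x f : part b (cintegral 0 x f) = prim (fun s => part b (f s)) x.
Proof. by case: b. Qed.

Lemma ac_derivE f g : ac_deriv f g <->
  forall b, abscont (fun x => part b (f x)) (fun x => part b (g x)).
Proof.
split=> [[/integrable_onE Lg fE] b|h].
  split=> // x; rewrite unit_itvE => x01.
  by rewrite fE// partD part_cintegral.
split=> [|x x01]; first by apply/integrable_onE => b; exact: (h b).1.
apply: part_eq => b; rewrite partD part_cintegral; apply: (h b).2.
by rewrite unit_itvE.
Qed.

End ComplexComponents.

Section RealForm.
Context {R : realType} {m : nat}.
Notation leb := (@lebesgue_measure R).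
Local Notation I := (@unit_itv R).
Local Notation K := ('I_m * bool)%type.
Variable Q : R -> 'M[R[i]]_m.
Hypothesis Q_herm : forall x : R, Q x \is hermsymmx.
Hypothesis Q_L2 : forall s r : 'I_m, square_integrable_on 0 1 (fun x => Q x s r).
Implicit Types (y f : R -> 'cV[R[i]]_m).

Definition rvec y (k : K) (x : R) : R := part k.2 (y x k.1 ord0).
Definition cvec (u : K -> R -> R) (x : R) : 'cV[R[i]]_m :=
  \col_s (u (s, false) x +i* u (s, true) x).
(** The real symmetric potential that acts on real and imaginary parts as [Q]
    acts on complex vectors. *)
Definition rpot (x : R) (k k' : K) : R := cmul_mx (Q x k.1 k'.1) k.2 k'.2.
(** Multiplication by [expi t], as a real orthogonal matrix. *)
Definition phase_mx (t : R) (k k' : K) : R :=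
  (k.1 == k'.1)%:R * cmul_mx (expi t) k.2 k'.2.

Lemma cvecK u : rvec (cvec u) = u.
Proof. by apply/funext => -[s []]; apply/funext => x; rewrite /rvec mxE. Qed.

Lemma rpot_L2 k k' : L2 (fun x => rpot x k k').
Proof.
case: k k' => [s b] [r b'].
have /square_integrable_onE h := Q_L2 s r.
rewrite /rpot; case: b b' => [] [] /=; [exact: (h false)|exact: (h true)| |exact: (h false)].
by apply: eq_L2 (L2Z (-1) (h true)) => x _; rewrite mulN1r.
Qed.

Lemma rpot_sym x k k' : rpot x k k' = rpot x k' k.
Proof.
case: k k' => [s b] [r b']; rewrite /rpot /=.
have := Q_herm x => /is_hermitianmxP /(congr1 (fun A : 'M[R[i]]_m => A s r)).
rewrite expr0 scale1r !mxE => ->.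
by case: (Q x r s) b b' => [a c] [] [] //=; rewrite ?opprK.
Qed.

Lemma phase_mx_orthonormal t : orthonormal_columns (phase_mx t).
Proof.
move=> [s b] [r b'].
rewrite -(pair_bigA _ (fun i c => phase_mx t (i, c) (s, b) * phase_mx t (i, c) (r, b'))) /=.
rewrite (bigD1 s)//= [X in _ + X]big1 ?addr0; last first.
  move=> i /negbTE ns; rewrite big1// => c _; by rewrite /phase_mx /= ns !mul0r.
rewrite big_bool /phase_mx /= !eqxx !mul1r.
have [->|sr] := eqVneq s r; last first.
  rewrite !mul0r !mulr0 addr0.
  by rewrite (_ : (_ == _) = false)//; apply/negbTE; apply: contra sr => /eqP[->].
rewrite !mul1r; have := cos2Dsin2 t.
by case: b b' => [] [] /=; rewrite -pair_eqE /= eqxx /=; lra.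
Qed.

Lemma part_mulmx b (A : 'M[R[i]]_m) (v : 'cV[R[i]]_m) s :
  part b ((A *m v) s ord0) =
  \sum_(k : K) cmul_mx (A s k.1) b k.2 * part k.2 (v k.1 ord0).
Proof.
rewrite mxE part_sum.
rewrite -(pair_bigA _ (fun r c => cmul_mx (A s r) b c * part c (v r ord0))) /=.
by apply: eq_bigr => r _; rewrite partM.
Qed.

Lemma part_phase_mx b t (v : 'cV[R[i]]_m) s :
  part b ((expi t *: v) s ord0) = \sum_(k : K) phase_mx t (s, b) k * part k.2 (v k.1 ord0).
Proof.
rewrite mxE partM.
rewrite -(pair_bigA _ (fun r c => phase_mx t (s, b) (r, c) * part c (v r ord0))) /=.
rewrite (bigD1 s)//= [X in _ + X]big1 ?addr0; last first.
  move=> r rs; rewrite big1// => c _; by rewrite /phase_mx /= eq_sym (negbTE rs) !mul0r.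
by apply: eq_bigr => c _; rewrite /phase_mx /= eqxx mul1r.
Qed.

Lemma coupledE t y y1 : coupled (phase_mx t) (rvec y) (rvec y1) <->
  y 1 = expi t *: y 0 /\ y1 1 = expi t *: y1 0.
Proof.
split=> [h|[e e1] [s b]]; last by rewrite /rvec /= e e1 !part_phase_mx.
by split; apply/colP => s; apply: part_eq => b; have [e e1] := h (s, b);
  rewrite part_phase_mx; [exact: e|exact: e1].
Qed.

Lemma Lt_op_graph t y f : Lt Q t y f <-> op_graph rpot (phase_mx t) (rvec y) (rvec f).
Proof.
split=> [[y1 [y2 [ac bc Lf eqn]]]|[u1 [u2 [[au au1 Lf eqn] cu]]]].
  exists (rvec y1), (rvec y2); split; last exact/coupledE.
  split=> [[s b]|[s b]|[s b]|].
  - by have [/ac_derivE h _] := ac s; exact: h.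
  - by have [_ /ac_derivE h] := ac s; exact: h.
  - by have /square_integrable_onE h := Lf s; exact: h.
  - apply: ae_impl eqn => x h; rewrite unit_itvE => x01 [s b].
    by rewrite /rvec h// mxE partD mxE partN part_mulmx.
exists (cvec u1), (cvec u2); split.
- move=> s; split; apply/ac_derivE => b.
    by have := au (s, b); rewrite -[in X in abscont _ X](cvecK u1).
  by have := au1 (s, b); rewrite -[in X in abscont X _](cvecK u1) -[in X in abscont _ X](cvecK u2).
- by apply/coupledE; rewrite cvecK.
- by move=> s; apply/square_integrable_onE => b; exact: (Lf (s, b)).
- apply: ae_impl eqn => x h x01; apply/colP => s; apply: part_eq => b.
  have u2E : u2 (s, b) x = part b (cvec u2 x s ord0) by rewrite mxE; case: b.
  have := h _ (s, b); rewrite unit_itvE => /(_ x01).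
  rewrite /rvec /= => ->; rewrite [in RHS]mxE partD [X in part b X + _]mxE partN part_mulmx.
  by rewrite u2E.
Qed.

Lemma in_eigenspaceE t l y : in_eigenspace Q t l y <->
  op_graph rpot (phase_mx t) (rvec y) (fun k x => l * rvec y k x).
Proof.
rewrite /in_eigenspace; have -> : (fun k x => l * rvec y k x) = rvec (fun x => l%:C *: y x).
  by apply/funext => -[s b]; apply/funext => x; rewrite /rvec mxE part_real.
exact: Lt_op_graph.
Qed.

End RealForm.

(** * Changing the quasimomentum *)

Section Twist.
Context {R : realType} {m : nat} (Q : R -> 'M[R[i]]_m).
Local Notation I := (@unit_itv R).
Local Notation K := ('I_m * bool)%type.
Implicit Types (u v f g : K -> R -> R) (d t : R).

(** Multiplication by the imaginary unit, in terms of real and imaginary parts. *)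
Definition imul u (k : K) (x : R) : R :=
  if k.2 then u (k.1, false) x else - u (k.1, true) x.

(** Multiplication by [expi (d * x)]: it turns quasimomentum [t] into [t + d]. *)
Definition twist d u (k : K) (x : R) : R :=
  cos (d * x) * u k x + sin (d * x) * imul u k x.

Lemma imulK u k x : imul (imul u) k x = - u k x.
Proof. by case: k => s []; rewrite /imul /= ?opprK. Qed.

Lemma imulD u v k x : imul (fun k x => u k x + v k x) k x = imul u k x + imul v k x.
Proof. by case: k => s []; rewrite /imul /=; ring. Qed.

Lemma imulZ (a : R) u k x : imul (fun k x => a * u k x) k x = a * imul u k x.
Proof. by case: k => s []; rewrite /imul /=; ring. Qed.

Lemma imul_abscont u u1 : (forall k, abscont (u k) (u1 k)) ->
  forall k, abscont (imul u k) (imul u1 k).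
Proof.
move=> au [s []]; first exact: au.
apply: eq_abscont (abscontZ (-1) (au (s, true))) => x _; exact: mulN1r.
Qed.

Lemma imul_L2 u : L2vec u -> L2vec (imul u).
Proof.
move=> Lu [s []]; first exact: Lu.
by apply: eq_L2 (L2Z (-1) (Lu (s, true))) => x _; rewrite mulN1r.
Qed.

Lemma cos_abscont d : abscont (fun x : R => cos (d * x)) (fun x => - d * sin (d * x)).
Proof.
apply: abscont_derive => [x|].
  apply: is_derive_eq; rewrite /GRing.scale /=; ring.
move=> x; apply: cvgMr; apply: continuous_comp; last exact: continuous_sin.
exact: mulrl_continuous.
Qed.

Lemma sin_abscont d : abscont (fun x : R => sin (d * x)) (fun x => d * cos (d * x)).
Proof.
apply: abscont_derive => [x|].
  apply: is_derive_eq; rewrite /GRing.scale /=; ring.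
move=> x; apply: cvgMr; apply: continuous_comp; last exact: continuous_cos.
exact: mulrl_continuous.
Qed.

Lemma twist_sum d (N : finType) (c : N -> R) (U : N -> K -> R -> R) k x :
  twist d (fun k x => \sum_n c n * U n k x) k x = \sum_n c n * twist d (U n) k x.
Proof.
have iE : imul (fun k x => \sum_n c n * U n k x) k x = \sum_n c n * imul (U n) k x.
  case: k => s []; rewrite /imul //= -sumrN; apply: eq_bigr => n _; ring.
rewrite /twist iE !mulr_sumr -big_split; apply: eq_bigr => n _ /=; ring.
Qed.

Lemma twist_abscont d u u1 : (forall k, abscont (u k) (u1 k)) ->
  forall k, abscont (twist d u k) (twist d (fun k x => u1 k x + d * imul u k x) k).
Proof.
move=> au k.
apply: eq_abscont (abscontD (abscontM (cos_abscont d) (au k))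
  (abscontM (sin_abscont d) (imul_abscont au k))) => // x _.
by rewrite /twist imulD imulZ imulK; ring.
Qed.

Lemma twist_L2 d u : L2vec u -> L2vec (twist d u).
Proof.
move=> Lu k; apply: L2D; apply: L2_bounded_mul.
- exact: abscont_bounded_measurable (cos_abscont d).
- exact: Lu.
- exact: abscont_bounded_measurable (sin_abscont d).
- exact: imul_L2.
Qed.

Lemma sum_components (A : finType) (F : A * bool -> R) :
  \sum_k F k = \sum_s (F (s, false) + F (s, true)).
Proof.
transitivity (\sum_k F (k.1, k.2)); first by apply: eq_bigr => -[].
rewrite -(pair_bigA _ (fun s b => F (s, b))) /=; apply: eq_bigr => s _.
by rewrite big_bool addrC.
Qed.

Lemma twist_ip d u v : ip (twist d u) (twist d v) = ip u v.
Proof.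
apply: eq_prim => // x _; rewrite !sum_components; apply: eq_bigr => s _.
rewrite /twist /imul /=; have := cos2Dsin2 (d * x).
move: (cos _) (sin _) => c e ce.
transitivity ((c ^+ 2 + e ^+ 2) *
  (u (s, false) x * v (s, false) x + u (s, true) x * v (s, true) x)); first by ring.
by rewrite ce mul1r.
Qed.

(** [rpot Q] comes from complex matrices, so it commutes with [imul]. *)
Lemma rpot_imul u x k :
  \sum_k' rpot Q x k k' * imul u k' x = imul (fun k x => \sum_k' rpot Q x k k' * u k' x) k x.
Proof.
case: k => s b; rewrite /imul /=; case: b; rewrite -?sumrN !sum_components;
  try rewrite -sumrN; apply: eq_bigr => r _; rewrite /rpot /cmul_mx /=; ring.
Qed.

Lemma rpot_twist d u x k :
  \sum_k' rpot Q x k k' * twist d u k' x =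
  twist d (fun k x => \sum_k' rpot Q x k k' * u k' x) k x.
Proof.
rewrite /twist -rpot_imul !mulr_sumr -big_split; apply: eq_bigr => k' _ /=; ring.
Qed.

Lemma phase_mxE t u k x : \sum_k' phase_mx t k k' * u k' x = cos t * u k x + sin t * imul u k x.
Proof.
case: k => s b; rewrite sum_components (bigD1 s)//= big1 ?addr0; last first.
  by move=> r rs; rewrite /phase_mx /= eq_sym (negbTE rs) !mul0r addr0.
by rewrite /phase_mx /imul /= eqxx; case: b => /=; ring.
Qed.

Lemma twist_coupled t t' d u : expi t' = expi (t + d) ->
  (forall k, u k 1 = \sum_k' phase_mx t k k' * u k' 0) ->
  forall k, twist d u k 1 = \sum_k' phase_mx t' k k' * twist d u k' 0.
Proof.
move=> [ct st] cu k; rewrite phase_mxE ct st cosD sinD.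
have uE k' : u k' 1 = cos t * u k' 0 + sin t * imul u k' 0 by rewrite cu phase_mxE.
rewrite /twist !mulr1 !mulr0 cos0 sin0 uE.
have iE : imul u k 1 = cos t * imul u k 0 - sin t * u k 0.
  by case: k => s []; rewrite /imul /= uE /imul /=; ring.
rewrite iE (_ : imul (twist d u) k 0 = imul u k 0); first by ring.
by case: k {iE} => s b; rewrite /imul /twist /=; case: b; rewrite mulr0 cos0 sin0; ring.
Qed.

(** [- (e^{idx} u)'' + q e^{idx} u = e^{idx} (- u'' + q u - 2 i d u' + d^2 u)]. *)
Lemma twist_op_graph t t' d u u1 u2 g : expi t' = expi (t + d) ->
  schrodinger (rpot Q) u u1 u2 g -> coupled (phase_mx t) u u1 ->
  op_graph (rpot Q) (phase_mx t') (twist d u)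
    (twist d (fun k x => g k x + (- (2 * d) * imul u1 k x + d ^+ 2 * u k x))).
Proof.
move=> tt' hu cu; have [au au1 Lg gE] := hu.
have [Lu Lu1 _] := schrodinger_L2 hu.
pose w1 := twist d (fun k x => u1 k x + d * imul u k x).
exists w1; eexists; split; first split.
- exact: twist_abscont.
- move=> k; apply: twist_abscont => k'; apply: abscontD; first exact: au1.
  by apply: abscontZ; exact: imul_abscont.
- apply: twist_L2; apply: L2vecD => //; apply: L2vecD; last exact: L2vecZ.
  by apply: L2vecZ; exact: imul_L2.
- apply: ae_impl gE => x gE Ix k; have {}gE := gE Ix.
  rewrite rpot_twist /twist.
  have iE : imul g k x = - imul u2 k x + imul (fun k x => \sum_k' rpot Q x k k' * u k' x) k x.
    by case: k => s []; rewrite /imul /= gE; ring.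
  by rewrite !(imulD, imulZ, imulK) iE gE; ring.
- move=> k; split; apply: twist_coupled tt' _ _ => // k'.
    by case: (cu k').
  have [_ ->] := cu k'.
  rewrite phase_mxE (phase_mxE t (fun k x => u1 k x + d * imul u k x) k' 0).
  have iE : imul u k' 1 = cos t * imul u k' 0 - sin t * u k' 0.
    case: k' => s b; have := (cu (s, ~~ b)).1; rewrite phase_mxE.
    by case: b; rewrite /imul /= => ->; ring.
  by rewrite iE !(imulD, imulZ, imulK); ring.
Qed.

Lemma ip_imul u : ip (imul u) (imul u) = ip u u.
Proof.
apply: eq_prim => // x _; rewrite !sum_components; apply: eq_bigr => s _.
by rewrite /imul /=; ring.
Qed.

End Twist.

(** * Eigenfunctions indexed by the eigenvalue sequence *)

Section EigenvalueContinuity.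
Context {R : realType} {m : nat} (Q : R -> 'M[R[i]]_m).
Notation leb := (@lebesgue_measure R).
Local Notation I := (@unit_itv R).
Local Notation K := ('I_m * bool)%type.
Hypothesis Q_herm : forall x : R, Q x \is hermsymmx.
Implicit Types (u v f g e : K -> R -> R) (t : R).

Let q_sym := rpot_sym Q_herm.

Lemma op_graph_imul t u f : op_graph (rpot Q) (phase_mx t) u f ->
  op_graph (rpot Q) (phase_mx t) (imul u) (imul f).
Proof.
move=> [u1 [u2 [[au au1 Lf fE] cu]]]; exists (imul u1), (imul u2); split; first split.
- exact: imul_abscont.
- exact: imul_abscont.
- exact: imul_L2.
- apply: ae_impl fE => x fE Ix k; have {}fE := fE Ix; rewrite rpot_imul.
  by case: k => s []; rewrite /imul /= fE; ring.
- move=> k; rewrite !phase_mxE.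
  have iE (z : K -> R -> R) : (forall k, z k 1 = \sum_k' phase_mx t k k' * z k' 0) ->
      imul z k 1 = cos t * imul z k 0 + sin t * imul (imul z) k 0.
    move=> zc; case: k => s b; have := zc (s, ~~ b); rewrite phase_mxE.
    by case: b; rewrite /imul /= => ->; ring.
  by split; apply: iE => k'; case: (cu k').
Qed.

Lemma rvecZ (z : R[i]) (y : R -> 'cV[R[i]]_m) k x :
  rvec (fun x => z *: y x) k x = complex.Re z * rvec y k x + complex.Im z * imul (rvec y) k x.
Proof.
by case: k => s b; rewrite /rvec /imul /= mxE partM big_bool; case: b => /=; ring.
Qed.

Lemma rvec_sum (N : Type) (r : seq N) (y : N -> R -> 'cV[R[i]]_m) k x :
  rvec (fun x => \sum_(n <- r) y n x) k x = \sum_(n <- r) rvec (y n) k x.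
Proof. by rewrite /rvec summxE part_sum. Qed.

(** [F n false] and [F n true] are an eigenfunction for [lam n] and its product
    by the imaginary unit; this is a real basis of eigenfunctions, indexed like
    the eigenvalue sequence.  The family is independent over the reals but need not be
    orthonormal: orthogonality holds between different eigenvalues only. *)
Definition eigenfamily t (lam : nat -> R) (F : nat -> bool -> K -> R -> R) : Prop :=
  [/\ forall n b, op_graph (rpot Q) (phase_mx t) (F n b) (fun i x => lam n * F n b i x),
      forall l, exists d (ns : 'I_d -> nat), (forall j, lam (ns j) = l) /\
        forall e, op_graph (rpot Q) (phase_mx t) e (fun i x => l * e i x) ->
        exists c : 'I_d * bool -> R, forall i x, I x ->
          e i x = \sum_k c k * F (ns k.1) k.2 i x &
      forall N (r : 'I_N * bool -> R),
        (forall i x, I x -> \sum_k r k * F (k.1 : 'I_N) k.2 i x = 0) ->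
        forall k, r k = 0].

Lemma eigen_orthogonal t l l' u v : l != l' ->
  op_graph (rpot Q) (phase_mx t) u (fun i x => l * u i x) ->
  op_graph (rpot Q) (phase_mx t) v (fun i x => l' * v i x) -> ip u v = 0.
Proof.
move=> ll' opu opv; have [Lu _] := op_L2 opu; have [Lv _] := op_L2 opv.
have := op_graph_sym q_sym (phase_mx_orthonormal t) opu opv.
rewrite ipZl// [RHS]ipC ipZl// [ip v u]ipC => /eqP.
by rewrite -subr_eq0 -mulrBl mulf_eq0 subr_eq0 (negbTE ll') => /eqP.
Qed.

(** Pointwise vanishing, not only almost everywhere: let [e] tend to 0 in
    [sup_bound]. *)
Lemma op_graph_ip0 t u f : op_graph (rpot Q) (phase_mx t) u f -> ip u u = 0 ->
  forall i x, I x -> u i x = 0.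
Proof.
move=> [u1 [u2 [hu _]]] u0 i x Ix.
have u_le : forall e : R, 0 < e -> \sum_k u k x * u k x <= e.
  move=> e e0.
  have d0 : 0 < 2 * ip u1 u1 + 1 by have := ip_ge0 u1; lra.
  have ed0 : 0 < e / (2 * ip u1 u1 + 1) by rewrite divr_gt0.
  apply: (le_trans (sup_bound ed0 hu Ix)); rewrite u0 mulr0 add0r addr0 mulrA.
  rewrite [2 * _]mulrC -!mulrA ger_pMr// mulrC ler_pdivrMr// mul1r; lra.
have : \sum_k u k x * u k x = 0.
  apply/eqP; rewrite eq_le; apply/andP; split.
    by apply/ler_addgt0Pl => e e0; rewrite addr0; exact: u_le.
  by apply: sumr_ge0 => k _; rewrite -expr2 sqr_ge0.
move=> /eqP; rewrite psumr_eq0; last by move=> k _; rewrite -expr2 sqr_ge0.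
by move=> /allP /(_ i (mem_index_enum i)) /=; rewrite mulf_eq0 orbb => /eqP.
Qed.

Lemma op_graph_eigensum t (N : finType) (P : pred N) (c : N -> R) (E : N -> K -> R -> R) l :
  (forall n, P n -> op_graph (rpot Q) (phase_mx t) (E n) (fun i x => l * E n i x)) ->
  op_graph (rpot Q) (phase_mx t) (fun i x => \sum_(n | P n) c n * E n i x)
    (fun i x => l * \sum_(n | P n) c n * E n i x).
Proof.
move=> opE.
suff : forall r : seq N, op_graph (rpot Q) (phase_mx t)
    (fun i x => \sum_(n <- r | P n) c n * E n i x)
    (fun i x => l * \sum_(n <- r | P n) c n * E n i x) by apply.
elim=> [|n r IHr].
  by apply: op_graph_eq (op_graph0 _ _) _ _ => i x _; rewrite big_nil ?mulr0.
have [Pn|nPn] := boolP (P n).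
  apply: op_graph_eq (op_graphD (op_graphZ (c n) (opE n Pn)) IHr) _ _ => i x _;
    by rewrite big_cons Pn//; ring.
by apply: op_graph_eq IHr _ _ => i x _; rewrite big_cons (negbTE nPn).
Qed.

(** The bijection between the indices [n] with [lam n = l] and a basis of the
    eigenspace of [l] assigns a basis vector to each index.  For the independence,
    the terms of a vanishing combination that belong to one eigenvalue form a
    vector orthogonal to all the others, hence to itself. *)
Lemma eigenfamily_exists t lam : eigenvalue_sequence Q t lam ->
  exists F, eigenfamily t lam F.
Proof.
move=> [_ hlam].
have /choice[D DP] l : exists D : {d : nat & (('I_d -> R -> 'cV[R[i]]_m) * (nat -> nat))%type},
   [/\ forall i, in_eigenspace Q t l ((projT2 D).1 i),
       forall c : 'I_(projT1 D) -> R[i],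
          (forall x : R, 0 <= x <= 1 -> \sum_i c i *: (projT2 D).1 i x = 0) ->
          forall i, c i = 0,
       forall z, in_eigenspace Q t l z ->
          exists c : 'I_(projT1 D) -> R[i],
            forall x : R, 0 <= x <= 1 -> z x = \sum_i c i *: (projT2 D).1 i x &
       set_bij [set n | lam n = l] `I_(projT1 D) (projT2 D).2].
  have [d [y [y1 y2 y3]] /card_set_bijP[f fbij]] := hlam l.
  by exists (existT _ d (y, f)).
pose d l := projT1 (D l); pose y l : 'I_(d l) -> R -> 'cV[R[i]]_m := (projT2 (D l)).1.
pose f l := (projT2 (D l)).2.
have fd n : (f (lam n) n < d (lam n))%N.
  by have [_ _ _ [ff _ _]] := DP (lam n); apply: (ff n).
pose g n : 'I_(d (lam n)) := Ordinal (fd n).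
pose F n b := if b then imul (rvec (y (lam n) (g n))) else rvec (y (lam n) (g n)).
have opF n b : op_graph (rpot Q) (phase_mx t) (F n b) (fun i x => lam n * F n b i x).
  have op : op_graph (rpot Q) (phase_mx t) (F n false) (fun i x => lam n * F n false i x).
    by apply/in_eigenspaceE; have [+ _ _ _] := DP (lam n); apply.
  case: b => //; apply: op_graph_eq (op_graph_imul op) _ _ => // i x _.
  exact: imulZ.
have yE l n (j : 'I_(d l)) : lam n = l -> f l n = j -> y l j = y (lam n) (g n).
  by move=> ln; case: _ / ln j => j fj; congr y; apply/val_inj.
exists F; split => // [l|N r r0 k0].
  have [_ _ spanl [_ _ fsurj]] := DP l.
  have /choice[ns nsP] (j : 'I_(d l)) : exists n, lam n = l /\ f l n = j.
    by have [n /= ln fn] := fsurj j (ltn_ord j); exists n.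
  exists (d l), ns; split=> [j|e ope]; first by have [] := nsP j.
  have [c cE] : exists c : 'I_(d l) -> R[i], forall x : R, 0 <= x <= 1 ->
      cvec e x = \sum_i c i *: y l i x.
    by apply: spanl; apply/in_eigenspaceE; rewrite cvecK.
  exists (fun k => part k.2 (c k.1)) => i x Ix.
  have -> : e i x = rvec (fun x => \sum_j c j *: y l j x) i x.
    by rewrite -[in LHS](cvecK e) /rvec cE// -unit_itvE.
  rewrite rvec_sum -(pair_bigA _ (fun j b => part b (c j) * F (ns j) b i x)) /=.
  apply: eq_bigr => j _; rewrite rvecZ big_bool addrC.
  by have [ln fn] := nsP j; rewrite /F -(yE l (ns j) j).
set l := lam k0.1.
have LF n b : L2vec (F n b) by case: (op_L2 (opF n b)).
pose P i x := \sum_(k : 'I_N * bool | lam k.1 == l) r k * F k.1 k.2 i x.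
have opP : op_graph (rpot Q) (phase_mx t) P (fun i x => l * P i x).
  by apply: op_graph_eigensum => -[n b] /= /eqP <-.
have [LP _] := op_L2 opP.
have ipP0 : ip P P = 0.
  transitivity (ip (fun i x => \sum_(k : 'I_N * bool) r k * F k.1 k.2 i x) P).
    rewrite ip_suml// {1}/P (ip_eq (u' := fun i x => \sum_(k : 'I_N * bool)
      (if lam k.1 == l then r k else 0) * F k.1 k.2 i x) (v' := P))//; last first.
      move=> i x _; rewrite /P big_mkcond; apply: eq_bigr => k _.
      by case: ifP; rewrite ?mul0r.
    rewrite ip_suml//; apply: eq_bigr => k _; case: ifPn => // kl.
    by rewrite (eigen_orthogonal kl (opF k.1 k.2) opP) !mulr0.
  transitivity (ip (fun _ _ => 0) P); first by apply: ip_eq => // i x; exact: r0.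
  rewrite -[RHS](mul0r 1) -prim_cst//; apply: eq_prim => // x _.
  by rewrite big1// => i _; rewrite mul0r.
have P0 := op_graph_ip0 opP ipP0.
have [_ indep _ [_ finj _]] := DP l.
pose z (i : 'I_N) : R[i] := r (i, false) +i* r (i, true).
pose c (j : 'I_(d l)) := \sum_(i : 'I_N | (lam i == l) && (f l i == j)) z i.
have c0 j : c j = 0.
  apply: indep => x; rewrite -unit_itvE => Ix.
  have -> : \sum_j c j *: y l j x = \sum_(i : 'I_N | lam i == l) z i *: y (lam i) (g i) x.
    under eq_bigr do rewrite /c scaler_suml.
    rewrite (exchange_big_dep (fun i : 'I_N => lam i == l))/=; last by move=> j' i _ /andP[].
    apply: eq_bigr => i /eqP il.
    have fid : (f l i < d l)%N by rewrite -il.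
    rewrite (bigD1 (Ordinal fid))/=; last by rewrite il eqxx eqxx.
    rewrite big1 ?addr0; first by rewrite -(yE l i (Ordinal fid)).
    move=> j' /andP[/andP[_ /eqP fj] /eqP[]]; exact/val_inj.
  apply/colP => s; apply: part_eq => b; rewrite [in RHS]mxE.
  transitivity (P (s, b) x); last by rewrite P0//; case: b.
  rewrite summxE part_sum /P big_mkcond [RHS]big_mkcond.
  rewrite sum_components /=; apply: eq_bigr => i _.
  case: ifP => // _; last by rewrite addr0.
  rewrite -[LHS]/(rvec (fun x => z i *: y (lam i) (g i) x) (s, b) x) rvecZ.
  by [].
have lk : f l k0.1 = Ordinal (fd k0.1) by [].
have := c0 (Ordinal (fd k0.1)); rewrite /c (bigD1 k0.1) ?eqxx//= big1 ?addr0; last first.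
  move=> i /andP[/andP[/eqP il /eqP fi]] /eqP[].
  by apply/val_inj; apply: finj; rewrite ?inE.
by case: k0 {P opP LP ipP0 P0 indep finj c c0 lk} @l => i [] /= => -[? ?].
Qed.

End EigenvalueContinuity.

(** * Continuity of the eigenvalues in the quasimomentum *)

Section EigenvalueLipschitz.
Context {R : realType} {m : nat} (Q : R -> 'M[R[i]]_m).
Local Notation I := (@unit_itv R).
Local Notation K := ('I_m * bool)%type.
Hypothesis Q_herm : forall x : R, Q x \is hermsymmx.
Hypothesis Q_L2 : forall s r : 'I_m, square_integrable_on 0 1 (fun x => Q x s r).
Implicit Types (t d : R) (lam : nat -> R).

Let q_L2 : forall i j, L2 (fun x => rpot Q x i j) := rpot_L2 Q_L2.
Let q_sym := rpot_sym Q_herm.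

(** The difference of the two sides is the squared norm of
    [\sum_k sqrt (lam n - lam k) * r k * F k]: the cross terms agree because
    eigenfunctions for different eigenvalues are orthogonal. *)
Lemma eigenfamily_rayleigh t lam F n (r : 'I_n.+1 * bool -> R) :
  nondecreasing_seq lam -> eigenfamily Q t lam F ->
  ip (fun i x => \sum_k r k * (lam k.1 * F k.1 k.2 i x))
     (fun i x => \sum_k r k * F k.1 k.2 i x) <=
  lam n * ip (fun i x => \sum_k r k * F k.1 k.2 i x)
             (fun i x => \sum_k r k * F k.1 k.2 i x).
Proof.
move=> mono [opF _ _].
have LF (k : 'I_n.+1 * bool) : L2vec (F k.1 k.2) by case: (op_L2 (opF k.1 k.2)).
pose a (k : 'I_n.+1 * bool) := Num.sqrt (lam n - lam k.1).
have double (b c : 'I_n.+1 * bool -> R) :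
    ip (fun i x => \sum_k b k * F k.1 k.2 i x) (fun i x => \sum_k c k * F k.1 k.2 i x) =
    \sum_k \sum_l b k * c l * ip (F k.1 k.2) (F l.1 l.2).
  rewrite ip_suml//; last exact: L2vec_sum.
  apply: eq_bigr => k _; rewrite ipC ip_suml// mulr_sumr.
  by apply: eq_bigr => l _; rewrite ipC mulrA.
have -> : ip (fun i x => \sum_k r k * (lam k.1 * F k.1 k.2 i x))
     (fun i x => \sum_k r k * F k.1 k.2 i x) =
    ip (fun i x => \sum_k (r k * lam k.1) * F k.1 k.2 i x)
     (fun i x => \sum_k r k * F k.1 k.2 i x).
  by apply: ip_eq => // i x _; apply: eq_bigr => k _; rewrite mulrA.
have := ip_ge0 (fun i x => \sum_k (a k * r k) * F k.1 k.2 i x).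
rewrite !double => pos; rewrite -subr_ge0 mulr_sumr -sumrB; move: pos; congr (0 <= _).
apply: eq_bigr => k _; rewrite mulr_sumr -sumrB; apply: eq_bigr => l _.
have [kl|kl] := eqVneq (lam k.1) (lam l.1); last first.
  by rewrite (eigen_orthogonal Q_herm kl (opF k.1 k.2) (opF l.1 l.2)) !mulr0 subr0.
have akl : a k * a l = lam n - lam k.1.
  rewrite /a -kl -expr2 sqr_sqrtr// subr_ge0; apply: mono.
  by rewrite -ltnS.
transitivity ((a k * a l) * (r k * r l * ip (F k.1 k.2) (F l.1 l.2))); first by ring.
by rewrite akl; ring.
Qed.

Lemma card_ord_bool n : #|{: 'I_n * bool}| = n.*2.
Proof. by rewrite card_prod card_ord card_bool muln2. Qed.

(** Twist a combination of the first [n + 1] eigenfunctions at [t] by [d], and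
    choose it so that the result is orthogonal to the first [n] eigenfunctions at
    [t'].  Then [variational_bound] compares [lam' n] with its Rayleigh quotient,
    which the twist changes by [2 |d| |v'| / |v| + d^2] at most, and [v'] is
    controlled by [derivative_bound]. *)
Theorem eigenvalue_lipschitz : exists C : R, 0 <= C /\
  forall t t' d lam lam', expi t' = expi (t + d) ->
    eigenvalue_sequence Q t lam -> eigenvalue_sequence Q t' lam' ->
    forall n, lam' n <= lam n +
      2 * `|d| * Num.sqrt (2 * (lam n + C)) + d ^+ 2.
Proof.
have [C [C0 dC]] := derivative_bound q_L2.
exists C; split=> // t t' d lam lam' tt' hlam hlam' n.
have [F famF] := eigenfamily_exists Q_herm hlam.
have [F' famF'] := eigenfamily_exists Q_herm hlam'.
have [mono _] := hlam; have [mono' _] := hlam'.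
have [opF _ indepF] := famF; have [opF' spanF' _] := famF'.
have LF n' b : L2vec (F n' b) by case: (op_L2 (opF n' b)).
have LF' n' b : L2vec (F' n' b) by case: (op_L2 (opF' n' b)).
have [|r [[k0 rk0] rperp]] := @underdetermined_system R ('I_n.+1 * bool)%type ('I_n * bool)%type
    (fun k' k => ip (twist d (F k.1 k.2)) (F' k'.1 k'.2)).
  by rewrite !card_ord_bool ltn_double.
pose v i x := \sum_k r k * F (k.1 : 'I_n.+1) k.2 i x.
pose g i x := \sum_k r k * (lam (k.1 : 'I_n.+1) * F k.1 k.2 i x).
have opv : op_graph (rpot Q) (phase_mx t) v g.
  have := op_graph_sum r (op_graph0 (rpot Q) (phase_mx t)) (fun k : 'I_n.+1 * bool => opF k.1 k.2).
  by move=> h; apply: op_graph_eq h _ _ => i x _; rewrite add0r.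
have [Lv Lg] := op_L2 opv.
have v0 : 0 < ip v v.
  rewrite lt_neqAle ip_ge0 andbT eq_sym; apply: contraNneq rk0 => vv0; apply/eqP.
  apply: (indepF _ r) => i x Ix. exact: (op_graph_ip0 opv vv0 i Ix).
have gv : ip g v <= lam n * ip v v by exact: eigenfamily_rayleigh famF.
have [v1 [v2 [hv cv]]] := opv; have [_ Lv1 _] := schrodinger_L2 hv.
have op' := twist_op_graph tt' hv cv.
set g' := (X in op_graph _ _ _ (twist d X)) in op'.
have perp : orthogonal_below (rpot Q) (phase_mx t') (lam' n) (twist d v).
  move=> l e ln ope; have [d' [ns [nsl span]]] := spanF' l.
  have [c cE] := span e ope.
  rewrite (ip_eq (u' := twist d v) (v' := fun i x => \sum_k c k * F' (ns k.1) k.2 i x))//.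
  rewrite ipC ip_suml//; last exact: twist_L2.
  rewrite big1// => -[j b] _ /=.
  have nsn : (ns j < n)%N.
    rewrite ltnNge; apply/negP => /mono'; rewrite nsl leNgt.
    by rewrite ln.
  have := rperp (Ordinal nsn, b); rewrite /= => E.
  suff -> : ip (F' (ns j) b) (twist d v) = 0 by rewrite mulr0.
  rewrite -[RHS]E ipC.
  rewrite (ip_eq (u' := fun i x => \sum_(k : 'I_n.+1 * bool) r k * twist d (F k.1 k.2) i x)
     (v' := F' (ns j) b))//; last by move=> i x _; rewrite twist_sum.
  by rewrite ip_suml// => k; exact: twist_L2.
have fin_eig l : l < lam' n -> finite_eigenspace (rpot Q) (phase_mx t') l.
  move=> _; have [d' [ns [nsl span]]] := spanF' l.
  exists ('I_d' * bool)%type, (fun k => F' (ns k.1) k.2); split=> // -[j b].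
  by have := opF' (ns j) b; rewrite nsl.
have := variational_bound q_L2 q_sym (phase_mx_orthonormal t') fin_eig op' perp.
rewrite !twist_ip /g' => main.
have Liv1 := imul_L2 Lv1.
have L1' : L2vec (fun k x => - (2 * d) * imul v1 k x) by exact: L2vecZ.
have L2' : L2vec (fun k x => d ^+ 2 * v k x) by exact: L2vecZ.
rewrite ipDl// in main; last exact: L2vecD.
rewrite ipDl// !ipZl// in main.
have := dC _ _ _ _ _ (phase_mx_orthonormal t) hv cv => dv.
have CS := ip_cauchy_schwarz Liv1 Lv; rewrite ip_imul in CS.
pose S := Num.sqrt (2 * (lam n + C)).
have S0 : 0 <= S by exact: sqrtr_ge0.
have v1v1 : ip v1 v1 <= 2 * (lam n + C) * ip v v by lra.
have SS : S ^+ 2 = 2 * (lam n + C).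
  rewrite sqr_sqrtr// -(pmulr_lge0 _ v0); apply: le_trans v1v1; exact: ip_ge0.
have ivS : `|ip (imul v1) v| <= S * ip v v.
  rewrite -ler_sqr ?nnegrE ?mulr_ge0 ?ip_ge0// real_normK ?num_real//.
  apply: (le_trans CS); rewrite exprMn SS expr2 mulrA; apply: ler_wpM2r => //.
  exact: ip_ge0.
have div : `|d * ip (imul v1) v| <= `|d| * (S * ip v v) by rewrite normrM ler_wpM2l.
rewrite -(ler_pM2r v0); apply: (le_trans main); move: div; rewrite ler_norml => /andP[div _].
rewrite -/S; lra.
Qed.

End EigenvalueLipschitz.

(** * The Riemann-Lebesgue lemma and the remainders *)

Section RiemannLebesgue.
Context {R : realType}.
Local Notation I := (@unit_itv R).
Implicit Types (f : R -> R) (d : R).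

Lemma bessel (K : finType) (U : nat -> K -> R -> R) (f : K -> R -> R) N :
  L2vec f -> (forall n, L2vec (U n)) ->
  (forall n k, n != k -> ip (U n) (U k) = 0) -> (forall n, ip (U n) (U n) <= 1) ->
  \sum_(n < N) ip f (U n) ^+ 2 <= ip f f.
Proof.
move=> Lf LU orthU normU.
pose V (n : 'I_N) := U n; have LV n : L2vec (V n) by exact: LU.
pose S i x := \sum_(n < N) ip f (V n) * V n i x.
have LS : L2vec S by apply: L2vec_sum => n; exact: LU.
have fS : ip f S = \sum_(n < N) ip f (U n) ^+ 2.
  rewrite ipC ip_suml//.
  by apply: eq_bigr => n _; rewrite ipC expr2.
have SS : ip S S <= \sum_(n < N) ip f (U n) ^+ 2.
  rewrite {1}/S ip_suml//.
  apply: ler_sum => n _; rewrite [ip (V n) S]ipC ip_suml//.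
  rewrite (bigD1 n)//= big1 ?addr0; last first.
    by move=> k kn; rewrite orthU// mulr0.
  rewrite mulrA -expr2 ler_piMr ?sqr_ge0//; exact: normU.
have := ip_ge0 (fun i x => f i x + (-1) * S i x).
rewrite ip_pencil// [ip S f]ipC fS; lra.
Qed.

Lemma cos_sin_2pin (n : nat) : cos (2 * pi * n%:R) = 1 :> R /\ sin (2 * pi * n%:R) = 0 :> R.
Proof.
elim: n => [|n [c s]]; first by rewrite mulr0 cos0 sin0.
have -> : 2 * pi * n.+1%:R = 2 * pi * n%:R + pi *+ 2 :> R by rewrite -natr1 mulr2n; ring.
by rewrite cosD2pi sinD2pi.
Qed.

Lemma int_cos_2pi (c : R) : c != 0 -> sin (2 * pi * c) = 0 ->
  prim (fun x => cos (2 * pi * c * x)) 1 = 0.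
Proof.
move=> c0 sc; have k0 : 2 * pi * c != 0 by rewrite !mulf_neq0// gt_eqF// pi_gt0.
have := abscont_total (abscontZ (2 * pi * c)^-1 (sin_abscont (2 * pi * c))).
rewrite mulr1 mulr0 sin0 sc mulr0 subr0 => <-.
by apply: eq_prim => // x _; rewrite mulrA mulVf// mul1r.
Qed.

Lemma trig_bounded n : bounded_measurable (fun x : R => cos (2 * pi * n * x)) /\
  bounded_measurable (fun x : R => sin (2 * pi * n * x)).
Proof.
split; [exact: abscont_bounded_measurable (cos_abscont _)|
        exact: abscont_bounded_measurable (sin_abscont _)].
Qed.

Lemma ip_unit (f g : R -> R) : ip (fun _ : unit => f) (fun _ : unit => g) =
  prim (fun x => f x * g x) 1.
Proof.
apply: eq_prim => // x _; rewrite (eq_bigr (fun=> f x * g x))// big_const card_unit /=.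
by rewrite addr0.
Qed.

(** The coefficients are square summable by Bessel's inequality. *)
Lemma orthonormal_coef_cvg0 (phi : nat -> R -> R) f : L2 f -> (forall n, L2 (phi n)) ->
  (forall n k, n != k -> prim (fun x => phi n x * phi k x) 1 = 0) ->
  (forall n, prim (fun x => phi n x * phi n x) 1 <= 1) ->
  forall d, 0 < d -> exists N : nat, forall n, (N <= n)%N ->
    `|prim (fun x => f x * phi n x) 1| <= d.
Proof.
move=> Lf Lphi orth norm d d0.
pose a n := prim (fun x => f x * phi n x) 1.
have sum_le N : series (fun n => a n ^+ 2) N <= prim (fun x => f x * f x) 1.
  rewrite /series /= big_mkord.
  have := @bessel unit (fun n _ => phi n) (fun _ => f) N (fun=> Lf) (fun n _ => Lphi n).
  rewrite ip_unit; under eq_bigr do rewrite ip_unit.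
  by apply=> [n k nk|n]; rewrite ip_unit; [exact: orth|exact: norm].
have : cvgn (series (fun n => a n ^+ 2)).
  apply: nondecreasing_is_cvgn.
    apply/nondecreasing_seqP => n; rewrite /series /= big_nat_recr//= lerDl.
    exact: sqr_ge0.
  by exists (prim (fun x => f x * f x) 1) => _ [n _ <-].
move=> /cvg_series_cvg_0 /cvgr_norm_le.
rewrite normr0 => /(_ (d ^+ 2)); rewrite exprn_gt0// => /(_ isT)[N _ NP].
exists N => n Nn; have h : `|a n ^+ 2| <= d ^+ 2 := NP n Nn; rewrite ger0_norm ?sqr_ge0// in h.
by rewrite -ler_sqr ?nnegrE ?normr_ge0 ?(ltW d0)// real_normK ?num_real.
Qed.

Lemma nat_diff_sin (n k : nat) : sin (2 * pi * (n%:R - k%:R)) = 0 :> R.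
Proof.
have [cn sn] := cos_sin_2pin n; have [ck sk] := cos_sin_2pin k.
by rewrite mulrBr sinB cn sn ck sk; ring.
Qed.

Lemma nat_sum_sin (n k : nat) : sin (2 * pi * (n%:R + k%:R)) = 0 :> R.
Proof.
have [cn sn] := cos_sin_2pin n; have [ck sk] := cos_sin_2pin k.
by rewrite mulrDr sinD cn sn ck sk; ring.
Qed.

Lemma riemann_lebesgue f : L2 f -> forall d, 0 < d -> exists N : nat, forall n : nat, (N <= n)%N ->
  `|prim (fun x => f x * cos (2 * pi * n%:R * x)) 1| <= d /\
  `|prim (fun x => f x * sin (2 * pi * n%:R * x)) 1| <= d.
Proof.
move=> Lf d d0.
have Lcos (c : R) : L2 (fun x : R => cos (2 * pi * c * x)).
  exact/bounded_measurable_L2/(trig_bounded c).1.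
have Lsin (c : R) : L2 (fun x : R => sin (2 * pi * c * x)).
  exact/bounded_measurable_L2/(trig_bounded c).2.
have int0 (n k : nat) : n != k ->
    prim (fun x => cos (2 * pi * (n%:R - k%:R) * x)) 1 = 0 :> R /\
    prim (fun x => cos (2 * pi * (n%:R + k%:R) * x)) 1 = 0 :> R.
  move=> nk; split; apply: int_cos_2pi; rewrite ?nat_diff_sin ?nat_sum_sin//.
    by rewrite subr_eq0 eqr_nat.
  by rewrite -natrD pnatr_eq0 addn_eq0; apply: contra nk => /andP[/eqP-> /eqP->].
have argB (n k : nat) (x : R) :
    2 * pi * (n%:R - k%:R) * x = 2 * pi * n%:R * x - 2 * pi * k%:R * x by ring.
have argD (n k : nat) (x : R) :
    2 * pi * (n%:R + k%:R) * x = 2 * pi * n%:R * x + 2 * pi * k%:R * x by ring.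
have sq_le (h : R -> R) : L2 h -> (forall x, `|h x| <= 1) -> prim (fun x => h x * h x) 1 <= 1.
  move=> Lh h1; rewrite -[leRHS](mul1r 1) -prim_cst//; apply: le_prim => //.
    - exact: L2M.
    - exact: L1_cst.
  by move=> x _; rewrite -expr2 -real_normK ?num_real// expr_le1.
have [||N1 N1P] := @orthonormal_coef_cvg0 (fun n x => cos (2 * pi * n%:R * x)) f Lf
  (fun n => Lcos n%:R) _ _ d d0.
- move=> n k nk; have [i1 i2] := int0 n k nk.
  rewrite (@eq_prim R _ (fun x => 2^-1 * (cos (2 * pi * (n%:R - k%:R) * x) +
    cos (2 * pi * (n%:R + k%:R) * x))))//; last first.
    by move=> x _; rewrite argB argD cosB cosD; field.
  by rewrite primZ ?primD// ?i1 ?i2 ?addr0 ?mulr0//; [exact: L2_L1..|apply: L1D; exact: L2_L1].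
- by move=> n; apply: sq_le => // x; rewrite ler_norml cos_geN1 cos_le1.
have [||N2 N2P] := @orthonormal_coef_cvg0 (fun n x => sin (2 * pi * n%:R * x)) f Lf
  (fun n => Lsin n%:R) _ _ d d0.
- move=> n k nk; have [i1 i2] := int0 n k nk.
  rewrite (@eq_prim R _ (fun x => 2^-1 * (cos (2 * pi * (n%:R - k%:R) * x) -
    cos (2 * pi * (n%:R + k%:R) * x))))//; last first.
    by move=> x _; rewrite argB argD cosB cosD; field.
  by rewrite primZ ?primB// ?i1 ?i2 ?subr0 ?mulr0//; [exact: L2_L1..|apply: L1B; exact: L2_L1].
- by move=> n; apply: sq_le => // x; rewrite ler_norml sin_geN1 sin_le1.
exists (maxn N1 N2) => n; rewrite geq_max => /andP[n1 n2].
by split; [exact: N1P|exact: N2P].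
Qed.

End RiemannLebesgue.

Section SmallRemainder.
Context {R : realType} {m : nat} (Q : R -> 'M[R[i]]_m).
Hypothesis Q_L2 : forall s r : 'I_m, square_integrable_on 0 1 (fun x => Q x s r).

Lemma fourier_coef_cvg0 (f : R -> R[i]) : square_integrable_on 0 1 f ->
  forall d : R, 0 < d -> exists N : nat, forall n : int, (N <= `|n|)%N ->
    Normc.normc (fourier_coef f n) <= d.
Proof.
move=> /square_integrable_onE Lf d d0; have d4 : 0 < d / 4 by rewrite divr_gt0.
have [N1 N1P] := riemann_lebesgue (Lf false) d4.
have [N2 N2P] := riemann_lebesgue (Lf true) d4.
exists (maxn N1 N2) => n; rewrite geq_max => /andP[/N1P[c1 s1] /N2P[c2 s2]].
pose k : R := 2 * pi * `|n|%N%:R.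
have nE : exists b : bool, forall x : R, - (2 * pi * n%:~R * x) = (-1) ^+ b * (k * x).
  case: n @k {c1 s1 c2 s2} => n k; rewrite /k; first by exists true => x; rewrite expr1 /=; ring.
  exists false => x; rewrite NegzE expr0 /= mulrNz; ring.
have [b bE] := nE.
have cosE x : cos (- (2 * pi * n%:~R * x)) = cos (k * x).
  by rewrite bE; case: b {bE nE}; rewrite ?expr1 ?expr0 ?mul1r ?mulN1r ?cosN.
have sinE x : sin (- (2 * pi * n%:~R * x)) = (-1) ^+ b * sin (k * x).
  by rewrite bE; case: b {bE nE cosE}; rewrite ?expr1 ?expr0 ?mul1r ?mulN1r ?sinN.
have Lc b' : L1 (fun x => part b' (f x) * cos (k * x)).
  apply: L2M => //; exact/bounded_measurable_L2/(trig_bounded _).1.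
have Ls b' : L1 (fun x => part b' (f x) * sin (k * x)).
  apply: L2M => //; exact/bounded_measurable_L2/(trig_bounded _).2.
apply: (le_trans (normc_le_parts _)).
rewrite /fourier_coef !part_cintegral.
have b1 (y : R) : `|(-1) ^+ b * y| = `|y| by rewrite normrM normr_sign mul1r.
have -> : prim (fun x => part false (f x * expi (- (2 * pi * n%:~R * x)))) 1 =
    prim (fun x => part false (f x) * cos (k * x)) 1 -
    (-1) ^+ b * prim (fun x => part true (f x) * sin (k * x)) 1.
  rewrite -primZ// -primB//; last exact: L1Z.
  apply: eq_prim => // x _; rewrite partM big_bool /= cosE sinE; ring.
have -> : prim (fun x => part true (f x * expi (- (2 * pi * n%:~R * x)))) 1 =
    prim (fun x => part true (f x) * cos (k * x)) 1 +
    (-1) ^+ b * prim (fun x => part false (f x) * sin (k * x)) 1.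
  rewrite -primZ// -primD//; last exact: L1Z.
  apply: eq_prim => // x _; rewrite partM big_bool /= cosE sinE; ring.
have -> : d = (d / 4 + d / 4) + (d / 4 + d / 4) by field.
apply: lerD; [apply: (le_trans (ler_normB _ _))|apply: (le_trans (ler_normD _ _))];
  by rewrite b1; apply: lerD.
Qed.

Lemma qmax_cvg0 (d : R) : 0 < d -> exists N : nat, forall k : int, (N <= `|k|)%N ->
  qmax Q k <= d.
Proof.
move=> d0.
have /choice[N NP] (sr : 'I_m * 'I_m) := fourier_coef_cvg0 (Q_L2 sr.1 sr.2) d0.
exists (\max_sr N sr) => k Nk.
apply: bigmax_le; first exact: ltW. move=> s _.
apply: bigmax_le; first exact: ltW. move=> r _.
rewrite big_seq; apply: bigmax_le; first exact: ltW.
move=> n; rewrite !inE => nk; apply: (NP (s, r)).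
apply: leq_trans (leq_bigmax (s, r)) _; apply: leq_trans Nk _.
by case/or4P: nk => /eqP ->; lia.
Qed.

Lemma log_ratio_cvg0 (d : R) : 0 < d -> exists N : nat, forall k : int, (N <= `|k|)%N ->
  `| ln `|k%:~R| / k%:~R | <= d.
Proof.
move=> d0; exists (maxn 1 (Num.bound ((2 / d) ^+ 2))) => k.
rewrite geq_max => /andP[k1 kN].
rewrite normrM normfV; set x : R := `|k%:~R|.
have xE : x = `|k|%N%:R by rewrite /x -intr_norm -natr_absz.
have x1 : 1 <= x by rewrite xE ler1n.
have x0 : 0 < x by lra.
have s0 : 0 < Num.sqrt x by rewrite sqrtr_gt0.
have sx : Num.sqrt x ^+ 2 = x by rewrite sqr_sqrtr// ltW.
rewrite ger0_norm; last by rewrite ln_ge0.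
have lnx : ln x <= 2 * Num.sqrt x.
  have -> : ln x = ln (Num.sqrt x) *+ 2 by rewrite -lnXn// sx.
  by rewrite mulr2n; have := ln_sublinear s0; lra.
have dx : (2 / d) ^+ 2 <= x.
  rewrite xE; apply: ltW; apply: (lt_le_trans (archi_boundP _)); first exact: sqr_ge0.
  by rewrite ler_nat.
have ds : 2 / d <= Num.sqrt x.
  by rewrite -ler_sqr ?nnegrE ?sx// ?divr_ge0// ltW.
rewrite ler_pdivrMr//; apply: (le_trans lnx).
rewrite -[in leRHS]sx expr2 mulrA; apply: ler_wpM2r; first exact: ltW.
by rewrite -ler_pdivrMl// mulrC.
Qed.

(** The logarithmic term tends to 0, and so does the maximum of finitely many
    Fourier coefficients. *)
Lemma eps_cvg0 (c1 d : R) : 0 < c1 -> 0 < d -> exists N : nat, forall k : int, (N <= `|k|)%N ->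
  eps c1 Q k <= d.
Proof.
move=> c0 d0; have d2 : 0 < d / c1 / 2 by rewrite !divr_gt0.
have [N1 N1P] := log_ratio_cvg0 d2; have [N2 N2P] := qmax_cvg0 d2.
exists (maxn N1 N2) => k; rewrite geq_max => /andP[/N1P h1 /N2P h2].
rewrite /eps mulrC -ler_pdivlMr//; apply: (le_trans (lerD h1 h2)).
by rewrite -splitr.
Qed.

Lemma eps_bounded (c1 : R) : 0 < c1 -> exists E : R, forall k : int, eps c1 Q k <= E.
Proof.
move=> c0; have [N NP] := eps_cvg0 c0 (ltr01 : 0 < 1 :> R).
pose S := \sum_(i < N) (`|eps c1 Q i%:Z| + `|eps c1 Q (- i%:Z)|).
have S0 : 0 <= S by apply: sumr_ge0 => i _; exact: addr_ge0.
exists (1 + S) => k; have [Nk|kN] := leqP N `|k|.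
  by rewrite (le_trans (NP k Nk))// lerDl.
rewrite /S (bigD1 (Ordinal kN))//=.
have : 0 <= \sum_(i < N | i != Ordinal kN) (`|eps c1 Q i%:Z| + `|eps c1 Q (- i%:Z)|).
  by apply: sumr_ge0 => i _; exact: addr_ge0.
have := normr_ge0 (eps c1 Q `|k|%N); have := normr_ge0 (eps c1 Q (- `|k|%N%:Z)).
have : eps c1 Q k <= `|eps c1 Q `|k|%N| \/ eps c1 Q k <= `|eps c1 Q (- `|k|%N%:Z)|.
  by case: k {kN} => n; [left|right]; rewrite ?NegzE ?abszN; exact: ler_norm.
by case; lra.
Qed.

End SmallRemainder.

(** * Quasimomenta and eigenvalue indices *)

Section Momenta.
Context {R : realType}.
Implicit Types (s t x : R).

(** Diagonal choice: at [k], take [1 / (n + 1)] for the largest [n < k] whose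
    threshold lies below [k]. *)
Lemma vanishing_sequence_of_eventually (P : R -> nat -> Prop) :
  (forall d, 0 < d -> exists N : nat, forall k, (N < k)%N -> P d k) ->
  exists (N : nat) (gamma : nat -> R), gamma @ \oo --> (0 : R) /\
    forall k, (N < k)%N -> P (gamma k) k.
Proof.
move=> evP.
have /choice[K KP] (n : nat) : exists N : nat, forall k, (N < k)%N -> P n.+1%:R^-1 k.
  by apply: evP; rewrite invr_gt0.
pose level k := \max_(i < k | (K i < k)%N) i.
exists (K 0%N), (fun k => (level k).+1%:R^-1); split.
  apply/cvgr0Pnorm_le => d d0; have [n nd] := ltr_add_invr d0; rewrite add0r in nd.
  exists (maxn (K n) n).+1 => // k /=; rewrite gtn_max => /andP[Kn nk].
  rewrite ger0_norm ?invr_ge0//; apply: le_trans (ltW nd).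
  rewrite lef_pV2 ?posrE// ler_nat ltnS.
  exact: (leq_bigmax_cond (Ordinal nk)).
move=> k Kk; apply: KP; have k0 : (0 < k)%N by exact: leq_ltn_trans Kk.
have [|i iP] := @eq_bigmax_cond _ [pred i : 'I_k | (K i < k)%N] (fun i => i : nat).
  by apply/card_gt0P; exists (Ordinal k0).
by rewrite /level => ->; move: iP; rewrite inE.
Qed.

Lemma expiD_2pi t (z : int) : expi (t + 2 * pi * z%:~R) = expi t.
Proof.
have nat_shift (n : nat) (u : R) : expi (u + 2 * pi * n%:R) = expi u.
  have [c s] : cos (2 * pi * n%:R) = 1 :> R /\ sin (2 * pi * n%:R) = 0 :> R.
    exact: cos_sin_2pin.
  by rewrite /expi cosD sinD c s !mulr1 !mulr0 subr0 addr0.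
case: z => n; first exact: nat_shift.
rewrite -[in RHS](subrK (2 * pi * n.+1%:R) t) nat_shift NegzE mulrNz mulrN.
by [].
Qed.

Lemma quasimomentum s : exists (r : int) t, - pi < t <= pi /\ s = 2 * pi * r%:~R + t.
Proof.
have pi0 : 0 < pi :> R by exact: pi_gt0.
pose r := Num.ceil ((s - pi) / (2 * pi)).
have := ceil_itv ((s - pi) / (2 * pi)); rewrite -/r => /andP[].
rewrite ltr_pdivlMr ?ler_pdivrMr ?mulr_gt0// intrD /= => h1 h2.
exists r, (s - 2 * pi * r%:~R); split; last by ring.
by apply/andP; split; lra.
Qed.

(** The product of two nonzero integers that differ by [k] is smallest in
    absolute value when they have opposite signs and one of them is 1 or -1. *)
Lemma shifted_product_ge (q : int) (k : nat) : (0 < k)%N -> q != 0 -> q + k%:Z != 0 ->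
  (k.-1 <= `|q|%N * `|(q + k%:Z)%R|%N)%N.
Proof.
case: q => n k0 q0 qk0; first by rewrite -PoszD !absz_nat; nia.
have [nk|kn] := ltnP n.+1 k.
  have -> : `|(Negz n + k%:Z)%R|%N = (k - n.+1)%N by rewrite NegzE; lia.
  have -> : `|Negz n|%N = n.+1 by [].
  have : (0 < k - n.+1)%N by rewrite subn_gt0.
  move: nk; set p := (k - n.+1)%N => nk p0; have -> : k = (n.+1 + p)%N by rewrite /p; lia.
  nia.
have -> : `|(Negz n + k%:Z)%R|%N = (n.+1 - k)%N by move: qk0; rewrite NegzE; lia.
have -> : `|Negz n|%N = n.+1 by [].
have : (0 < n.+1 - k)%N by move: qk0; rewrite NegzE; lia.
nia.
Qed.

End Momenta.

Section EigenvalueIndex.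
Context {R : realType} {m : nat} (Q : R -> 'M[R[i]]_m).

Lemma eigenvalue_sequence_is_eigenvalue t lam n :
  eigenvalue_sequence Q t lam -> is_eigenvalue Q t (lam n).
Proof.
move=> [_ /(_ (lam n)) [d [y [y1 y2 y3]] /card_set_bijP[f [ff _ _]]]].
pose j : 'I_d := Ordinal (ff n erefl).
exists (y j); first exact: y1.
apply: contrapT => ny; have y0 x : 0 <= x <= 1 -> y j x = 0.
  by move=> x01; apply/eqP/negPn/negP => yx; apply: ny; exists x.
have := y2 (fun i => (i == j)%:R) _ j; rewrite eqxx => h.
suff /eqP : (1 : R[i]) = 0 by rewrite oner_eq0.
apply: h => x x01; rewrite (bigD1 j)//= y0// scaler0 add0r big1// => i /negbTE ->.
by rewrite scale0r.
Qed.

Lemma is_eigenvalue_index t lam l :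
  eigenvalue_sequence Q t lam -> is_eigenvalue Q t l -> exists n, lam n = l.
Proof.
move=> [_ /(_ l) [d [y [y1 y2 y3]] /card_set_bijP[f [_ _ fsurj]]]] [z zl [x x01 zx]].
have [c cE] := y3 z zl.
have d0 : (0 < d)%N.
  rewrite lt0n; apply: contra zx => /eqP dE; rewrite cE//.
  by rewrite big1// => i _; have := ltn_ord i; rewrite [X in (_ < X)%N]dE.
by have [n /= ln _] := fsurj 0%N d0; exists n.
Qed.

Lemma homotopy1 : homotopy Q 1 = Q.
Proof. by apply/funext => x; rewrite /homotopy scale1r addrC subrK. Qed.

End EigenvalueIndex.

(** * Free eigenvalues near a crossing *)

Section FoldedMomenta.
Context {R : realType}.
Implicit Types (s c M : R) (k : nat) (q : int).

(** From [(s - A) (s + A) = c]. *)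
Lemma momentum_offset (A s c M : R) : 0 < A -> 0 < s -> s ^+ 2 = A ^+ 2 + c -> `|c| <= M ->
  M <= A -> `|s - A| <= 1 /\ A ^+ 2 * (s - A) ^+ 2 <= M ^+ 2.
Proof.
move=> A0 s0 sE cM MA.
have aE : (s - A) * (s + A) = c by rewrite -[RHS](addKr (A ^+ 2)) -sE; ring.
have absE : `|s - A| * (s + A) = `|c| by rewrite -aE normrM [`|s + A|]ger0_norm ?addr_ge0 ?ltW.
have an0 := normr_ge0 (s - A).
have aA : `|s - A| * A <= M.
  apply: le_trans cM; rewrite -absE; apply: ler_wpM2l => //; lra.
split.
  by rewrite -(ler_pM2r A0) mul1r (le_trans aA).
rewrite -[(s - A) ^+ 2]real_normK ?num_real// mulrC -exprMn.
have aA0 : 0 <= `|s - A| * A by rewrite mulr_ge0// ltW.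
by rewrite ler_sqr ?nnegrE//; exact: le_trans aA.
Qed.

(** The difference factors as [4 pi q (s + pi q)], and [s] is close to [pi k];
    only the shifts [q = 0] and [q = - k] return to the neighbourhood of [s ^+ 2]. *)
Lemma far_momentum k q s c M : (0 < k)%N -> 0 < s -> s ^+ 2 = (pi * k%:R) ^+ 2 + c -> `|c| <= M ->
  M <= pi * k%:R -> q != 0 -> q + k%:Z != 0 ->
  k.-1%:R <= `|(s + 2 * pi * q%:~R) ^+ 2 - s ^+ 2|.
Proof.
move=> k0 s0 sE cM MA q0 qk0.
have pi2 : 2 <= pi :> R by exact: pi_ge2.
have A0 : 0 < pi * k%:R :> R by rewrite mulr_gt0 ?pi_gt0 ?ltr0n.
have [a1 _] := momentum_offset A0 s0 sE cM MA.
have -> : (s + 2 * pi * q%:~R) ^+ 2 - s ^+ 2 =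
    (4 * pi) * q%:~R * (pi * (q + k%:Z)%:~R + (s - pi * k%:R)).
  by rewrite intrD -pmulrn; ring.
set w := (q + k%:Z)%:~R : R.
have qn : `|q%:~R| = `|q|%N%:R :> R by rewrite -intr_norm -natr_absz.
have wn : `|w| = `|(q + k%:Z)%R|%N%:R by rewrite /w -intr_norm -natr_absz.
have w1 : 1 <= `|w| by rewrite wn ler1n lt0n absz_eq0.
have big : `|w| <= `|pi * w + (s - pi * k%:R)|.
  have h : `|pi * w| <= `|pi * w + (s - pi * k%:R)| + `|s - pi * k%:R|.
    by rewrite -{1}[pi * w](addrK (s - pi * k%:R)) (le_trans (ler_normB _ _)).
  have : `|pi * w| = pi * `|w| by rewrite normrM ger0_norm ?pi_ge0.
  nra.
rewrite !normrM [`|4|]ger0_norm// [`|pi|]ger0_norm ?pi_ge0//.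
have prod_ge : k.-1%:R <= `|q%:~R| * `|w|.
  by rewrite qn wn -natrM ler_nat; exact: shifted_product_ge.
have qw : `|q%:~R| * `|w| <= `|q%:~R| * `|pi * w + (s - pi * k%:R)| by exact: ler_wpM2l.
have : 0 <= `|q%:~R| * `|pi * w + (s - pi * k%:R)| by exact: mulr_ge0.
rewrite -mulrA; move: (`|q%:~R| * `|pi * w + _|) qw => z qw z0.
have := le_trans prod_ge qw => kz; apply: (le_trans kz); nra.
Qed.

(** The folded branch moves down as [s] moves up: with [a = s - A], one has
    [s^2 = A^2 + 2 A a + a^2] and [(s - 2 A)^2 = A^2 - 2 A a + a^2]. *)
Lemma reflected_momentum (A s c M eta : R) : 0 < A -> 0 < s -> s ^+ 2 = A ^+ 2 + c -> `|c| <= M ->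
  M <= A -> 0 < eta -> M ^+ 2 / eta <= A ^+ 2 ->
  0 <= (s - 2 * A) ^+ 2 - (A ^+ 2 - c) <= 2 * eta.
Proof.
move=> A0 s0 sE cM MA e0 Me; have [_ h] := momentum_offset A0 s0 sE cM MA.
have -> : (s - 2 * A) ^+ 2 - (A ^+ 2 - c) = 2 * (s - A) ^+ 2.
  have -> : c = s ^+ 2 - A ^+ 2 by rewrite sE; ring.
  ring.
have A2 : 0 < A ^+ 2 by rewrite exprn_gt0.
rewrite mulr_ge0 ?sqr_ge0//= ler_wpM2l// -(ler_pM2l A2); apply: (le_trans h).
by rewrite -ler_pdivrMr.
Qed.

End FoldedMomenta.

Section Gaps.
Context {R : realType} {m : nat} (Q : R -> 'M[R[i]]_m).
Variable lam : R -> nat -> R.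
Hypothesis hlam : forall t : R, - pi < t <= pi -> eigenvalue_sequence Q t (lam t).

(** In a gap the number of eigenvalues below [x] is the same for all
    quasimomenta; the last of them has index [n]. *)
Lemma gap_counting alpha beta x : spectral_gap lam alpha beta -> alpha < x < beta ->
  exists n, forall t : R, - pi < t <= pi ->
    lam t n < x /\ forall l, is_eigenvalue Q t l -> l < x -> l <= lam t n.
Proof.
move=> [_ [n [[subA _] [inf_ub _]]]] /andP[ax xb]; exists n => t tI.
have lt_n : lam t n < x by apply: le_lt_trans ax; apply: subA; exists t.
split=> // l /(is_eigenvalue_index (hlam tI)) [i <-] ix.
have [mono _] := hlam tI; apply: (mono); rewrite leqNgt; apply/negP => ni.
have : beta <= lam t n.+1 by apply: inf_ub; exists t.
have := mono _ _ ni; lra.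
Qed.

Variables (p : nat) (mu : 'I_p.+1 -> R).
Hypothesis mu_lt : forall i j : 'I_p.+1, (i < j)%N -> mu i < mu j.

Lemma mu_separation : exists kappa : R, 0 < kappa /\
  forall i j, i != j -> kappa <= `|mu i - mu j|.
Proof.
have pos (ij : 'I_p.+1 * 'I_p.+1) : ij.1 != ij.2 -> 0 < `|mu ij.1 - mu ij.2|.
  rewrite normr_gt0 subr_eq0 => ne; have := ne; rewrite neq_ltn => /orP[] /mu_lt h.
    by rewrite lt_eqF.
  by rewrite gt_eqF.
pose d (ij : 'I_p.+1 * 'I_p.+1) := if ij.1 == ij.2 then 1 else `|mu ij.1 - mu ij.2|.
have d0 ij : 0 < d ij by rewrite /d; case: ifPn => // /pos.
exists (\big[Num.min/1]_ij d ij); split.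
  by apply: (big_ind (fun y => 0 < y)) => // a b a0 b0; rewrite lt_min a0.
move=> i j ij; have -> : `|mu i - mu j| = d (i, j) by rewrite /d /= (negbTE ij).
exact: bigmin_le_cond.
Qed.

Lemma mu_bound : exists H : R, 0 <= H /\ forall i, `|mu i| <= H.
Proof.
exists (\sum_i `|mu i|); split; first exact: sumr_ge0.
by move=> i; rewrite (bigD1 i)//= lerDl; exact: sumr_ge0.
Qed.

End Gaps.

Section SeparationEstimates.
Context {R : realType}.
Implicit Types (A B C eta x l s c M : R) (k : nat) (q : int).

Lemma leq_half_pred (K0 k : nat) : (3 * K0 + 10 < k)%N ->
  (K0 <= k.-1./2)%N /\ (K0 <= k./2)%N.
Proof. by rewrite !geq_half_double -!muln2 => ?; split; lia. Qed.

(** Large eigenvalues have free neighbours of large index, for which the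
    remainder is small. *)
Lemma large_index (K0 : nat) (k : int) (t : R) : - pi < t <= pi ->
  (2 * pi * K0%:R + pi) ^+ 2 < (2 * pi * k%:~R + t) ^+ 2 -> (K0 <= `|k|)%N.
Proof.
move=> tI lowf; rewrite leqNgt; apply/negP => kK0; move: lowf; apply/negP.
have pi0 : 0 <= pi :> R by exact: pi_ge0.
have posK : 0 <= 2 * pi * K0%:R + pi :> R by rewrite addr_ge0 ?mulr_ge0.
rewrite -leNgt -[(2 * pi * k%:~R + t) ^+ 2]real_normK ?num_real// ler_sqr ?nnegrE//.
apply: (le_trans (ler_normD _ _)); apply: lerD.
  rewrite normrM [`|2 * pi|]ger0_norm ?mulr_ge0//; apply: ler_wpM2l.
    by rewrite mulr_ge0.
  by rewrite -intr_norm -natr_absz ler_nat ltnW.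
by case/andP: tI => ? ?; rewrite ler_norml; apply/andP; split => //; exact: ltW.
Qed.

Lemma large_index_of_momentum (K0 k : nat) (r : int) (t s : R) : - pi < t <= pi ->
  s = 2 * pi * r%:~R + t -> 9 / 10 * (pi * k%:R) <= s -> 3 * K0%:R + 10 < k%:R :> R ->
  (K0 < `|r|)%N.
Proof.
move=> /andP[_ tpi] -> h kK; have pi0 : 0 < pi :> R by exact: pi_gt0.
have : 9 / 10 * pi * (3 * K0%:R + 10) <= 9 / 10 * pi * k%:R :> R.
  by apply: ler_wpM2l; [lra|exact: ltW].
have : 0 <= pi * K0%:R :> R by rewrite mulr_ge0// ltW.
move=> K1 K2; rewrite -(ltr_nat R) natr_absz intr_norm.
apply: lt_le_trans (ler_norm _); rewrite -(ltr_pM2l pi0).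
clear - h K1 K2 tpi pi0; lra.
Qed.

Lemma exists_momentum A c M : 0 < A -> `|c| <= M -> 10 * M <= A ^+ 2 ->
  exists s, [/\ 0 < s, s ^+ 2 = A ^+ 2 + c & 9 / 10 * A <= s].
Proof.
move=> A0; rewrite ler_norml => /andP[cM _] AM.
have A2 : 0 < A ^+ 2 by rewrite exprn_gt0.
have Ac : 0 < A ^+ 2 + c by lra.
exists (Num.sqrt (A ^+ 2 + c)); rewrite sqrtr_gt0 sqr_sqrtr; last exact: ltW.
split=> //; have [A9 s0] : 0 <= 9 / 10 * A /\ 0 <= Num.sqrt (A ^+ 2 + c).
  by rewrite sqrtr_ge0; split=> //; lra.
by rewrite -ler_sqr ?nnegrE// sqr_sqrtr ?ltW// exprMn; lra.
Qed.

(** The bound of [eigenvalue_lipschitz] for two momenta on both sides of a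
    crossing: they differ by about [eta / A], and the square root is at most
    about [sqrt 2 * A]. *)
Lemma momentum_step A B C eta l c sm sp : 10 <= A -> 0 < eta -> 20 * eta <= A ->
  8 * (B + C) <= A ^+ 2 -> l <= A ^+ 2 + B ->
  0 < sm -> 0 < sp -> 9 / 10 * A <= sm -> 9 / 10 * A <= sp ->
  sm ^+ 2 = c - eta -> sp ^+ 2 = c + eta ->
  2 * `|sm - sp| * Num.sqrt (2 * (l + C)) + (sm - sp) ^+ 2 <= 4 * eta.
Proof.
move=> A10 eta0 etaA BC lB sm0 sp0 smA spA smE spE.
have A0 : 0 < A by lra.
set S := Num.sqrt _; have S0 : 0 <= S by exact: sqrtr_ge0.
have SA : S <= 3 / 2 * A.
  have [neg|/ltW pos] := leP (2 * (l + C)) 0; first by rewrite /S ler0_sqrtr//; lra.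
  have A32 : 0 <= 3 / 2 * A by lra.
  by rewrite -ler_sqr ?nnegrE// sqr_sqrtr// exprMn; lra.
have dE : (sp - sm) * (sp + sm) = 2 * eta by rewrite -subr_sqr spE smE; ring.
have d0 : 0 < sp - sm.
  have : 0 < (sp - sm) * (sp + sm) by rewrite dE mulr_gt0.
  by rewrite pmulr_lgt0// addr_gt0.
rewrite distrC (ger0_norm (ltW d0)) -sqrrN opprB.
move: (sp - sm) dE d0 => d dE d0.
have dA : d * A <= 10 / 9 * eta.
  have : d * (9 / 5 * A) <= d * (sp + sm) by apply: ler_wpM2l; [exact: ltW|lra].
  lra.
have dS : d * S <= d * (3 / 2 * A) by apply: ler_wpM2l => //; exact: ltW.
have d1 : d <= 1 / 4 by rewrite -(ler_pM2r A0); lra.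
have d10 : d * 10 <= d * A by apply: ler_wpM2l => //; exact: ltW.
have dd : d * d <= d * (1 / 4) by apply: ler_wpM2l => //; exact: ltW.
rewrite expr2 -mulrA; lra.
Qed.

(** Here [nu = mu_j] and [nu' = mu_i], and [s] is the momentum at which the
    branch [j] is at [x + eta].  The shift [q = 0] is excluded by the separation
    of the [mu]s, [q = - k] by the distance of [x] to the points
    [(pi k)^2 + (mu_i + mu_j) / 2], and all other shifts because the momentum is
    large. *)
Lemma branch_avoids_window k q s x (nu nu' H M delta kappa eta l : R) :
  (0 < k)%N -> 0 < s -> s ^+ 2 = x - nu + eta ->
  `|x - nu + eta - (pi * k%:R) ^+ 2| <= M -> M <= pi * k%:R ->
  M ^+ 2 / eta <= (pi * k%:R) ^+ 2 -> 2 * H + 10 * eta + 1 <= k%:R ->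
  `|nu| <= H -> `|nu'| <= H -> 0 < eta -> 20 * eta <= delta -> 20 * eta <= kappa ->
  nu' = nu \/ kappa <= `|nu' - nu| ->
  2 * delta <= `|2 * (x - (pi * k%:R) ^+ 2) - nu' - nu| ->
  x - 6 * eta <= l -> l < x ->
  eta <= `|l - ((s + 2 * pi * q%:~R) ^+ 2 + nu')|.
Proof.
move=> k0 s0 sE cM MA eA kbig; rewrite !ler_norml => /andP[n1 n2] /andP[n1' n2'].
move=> eta0 ed ek sep far l1 l2.
have A0 : 0 < pi * k%:R :> R by rewrite mulr_gt0 ?pi_gt0 ?ltr0n.
have sE' : s ^+ 2 = (pi * k%:R) ^+ 2 + (x - nu + eta - (pi * k%:R) ^+ 2).
  by rewrite sE; ring.
have [->|q0] := eqVneq q 0.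
  rewrite mulr0 addr0 sE; case: sep => [->|sep].
    have -> : l - (x - nu + eta + nu) = - (x - l + eta) by ring.
    by rewrite normrN ger0_norm; lra.
  have : `|nu' - nu| <= `|l - (x - nu + eta + nu')| + `|x - l + eta|.
    rewrite -normrN; have -> : - (nu' - nu) = (l - (x - nu + eta + nu')) + (x - l + eta) by ring.
    exact: ler_normD.
  have -> : `|x - l + eta| = x - l + eta by rewrite ger0_norm; lra.
  clear - sep l1 l2 ek eta0; lra.
have [qk|qk] := eqVneq (q + k%:Z) 0.
  have -> : s + 2 * pi * q%:~R = s - 2 * (pi * k%:R).
    have -> : q = - k%:Z by apply/eqP; rewrite -addr_eq0 qk.
    by rewrite mulrNz -pmulrn; ring.
  have /andP[] := reflected_momentum A0 s0 sE' cM MA eta0 eA.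
  move: ((pi * k%:R) ^+ 2) ((s - 2 * _) ^+ 2) far => a r far r1 r2.
  pose w := r - (a - (x - nu + eta - a)) + (x - l) - eta.
  have : `|2 * (x - a) - nu' - nu| <= `|l - (r + nu')| + `|w|.
    have -> : 2 * (x - a) - nu' - nu = (l - (r + nu')) + w by rewrite /w; ring.
    exact: ler_normD.
  have : `|w| <= 9 * eta.
    by rewrite /w ler_norml; apply/andP; split; clear - r1 r2 l1 l2 eta0; lra.
  clear - far ed eta0; lra.
have := far_momentum k0 s0 sE' cM MA q0 qk.
have -> : k.-1%:R = k%:R - 1 :> R by rewrite -[in RHS](prednK k0) -natr1 addrK.
rewrite sE; move: ((s + _) ^+ 2) => r hr.
have : `|r - (x - nu + eta)| <= `|l - (r + nu')| + `|l - nu' - x + nu - eta|.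
  have -> : r - (x - nu + eta) = (l - nu' - x + nu - eta) - (l - (r + nu')) by ring.
  by rewrite [leRHS]addrC; exact: ler_normB.
have : `|l - nu' - x + nu - eta| <= 2 * H + 7 * eta.
  by rewrite ler_norml; apply/andP; split; clear - n1 n2 n1' n2' l1 l2 eta0; lra.
clear - hr kbig eta0; lra.
Qed.

End SeparationEstimates.

(** * Gaps *)

(** The crossing argument: [sm] and [sp] are the momenta at which the branch [j]
    is at [x - eta] and [x + eta]. *)
Lemma gap_near_crossing (R : realType) (m : nat) (Q : R -> 'M[R[i]]_m)
    (Q_herm : forall x : R, Q x \is hermsymmx)
    (Q_L2 : forall s r : 'I_m, square_integrable_on 0 1 (fun x => Q x s r))
    (lam : R -> nat -> R)
    (hlam : forall t : R, - pi < t <= pi -> eigenvalue_sequence Q t (lam t))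
    (p : nat) (mu : 'I_p.+1 -> R) (c1 : R)
    (mu_lt : forall i j : 'I_p.+1, (i < j)%N -> mu i < mu j)
    (hc1 : localization_constant Q mu c1) (delta : R) :
  0 < delta -> exists N : nat, forall k, (N < k)%N ->
  forall alpha beta x, spectral_gap lam alpha beta -> alpha < x < beta ->
    Uset Q mu c1 k x ->
  forall j, exists i, `|x - ((pi * k%:R) ^+ 2 + (mu i + mu j) / 2)| < delta.
Proof.
move=> delta0; have [c0 [N [L [N0 locQ exQ]]]] := hc1.
have [kappa [kappa0 kappaP]] := mu_separation mu_lt.
have [H [H0 HP]] := mu_bound mu.
have [eta [eta0 etad etak]] : exists eta : R, [/\ 0 < eta, 20 * eta <= delta & 20 * eta <= kappa].
  exists (Num.min delta kappa / 20).
  have -> : 20 * (Num.min delta kappa / 20) = Num.min delta kappa by field.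
  rewrite !ge_min !lexx orbT; split=> //.
  by rewrite divr_gt0// lt_min delta0.
have [E0 EP] := eps_bounded Q_L2 c0.
have [K0 K0P] := eps_cvg0 Q_L2 c0 eta0.
have [C [C0 lipC]] := eigenvalue_lipschitz Q_herm Q_L2.
have [B [B0 BE]] : exists B : R, 0 <= B /\ B = H + eta by exists (H + eta); split=> //; lra.
have [M [M0 ME]] : exists M : R, 0 <= M /\ M = 2 * H + 2 * eta.
  by exists (2 * H + 2 * eta); split=> //; lra.
(* beyond X all terms of lower order than A^2 = (pi k)^2 are negligible *)
pose X := 10 * M + 8 * (B + C) + 20 * eta + `|L| + (2 * pi * K0%:R + pi) ^+ 2 + `|E0| +
  M ^+ 2 / eta + 10 * H + B + 3 * K0%:R + 10.
exists (Num.bound X) => k Xk alpha beta x gap xab Ux j.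
have pi2 : 2 <= pi :> R by exact: pi_ge2.
have [A AE] : exists A : R, A = pi * k%:R by exists (pi * k%:R).
have [k10 A10 MA kbig [k3K A10M A8 A20 [ALx AK0 AMe]]] :
  [/\ 10 < k%:R :> R, 10 <= A, M <= A, 2 * H + 10 * eta + 1 <= k%:R &
  [/\ 3 * K0%:R + 10 < k%:R :> R, 10 * M <= A ^+ 2, 8 * (B + C) <= A ^+ 2, 20 * eta <= A &
  [/\ `|L| + B + 6 * eta < A ^+ 2,
      (2 * pi * K0%:R + pi) ^+ 2 + B + 6 * eta + H + `|E0| < A ^+ 2 &
      M ^+ 2 / eta <= A ^+ 2]]].
  have pos1 : 0 <= (2 * pi * K0%:R + pi) ^+ 2 :> R by exact: sqr_ge0.
  have pos2 : 0 <= M ^+ 2 / eta by rewrite divr_ge0 ?sqr_ge0// ltW.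
  have pos3 : 0 <= K0%:R :> R by [].
  have pos4 := normr_ge0 L; have pos5 := normr_ge0 E0.
  have X0 : 0 <= X by rewrite /X; clear - M0 B0 C0 H0 eta0 pos1 pos2 pos3 pos4 pos5; lra.
  have Xk' : X < k%:R by apply: (lt_trans (archi_boundP X0)); rewrite ltr_nat.
  have kA : k%:R <= A by rewrite AE ler_peMl//; clear - pi2; lra.
  have k10 : 10 < k%:R :> R.
    by move: Xk'; rewrite /X; clear - M0 B0 C0 H0 eta0 pos1 pos2 pos3 pos4 pos5; lra.
  have AA : A <= A ^+ 2 by rewrite expr2 ler_peMl//; clear - k10 kA; lra.
  move: Xk'; rewrite /X.
  move: (M ^+ 2 / eta) ((2 * pi * K0%:R + pi) ^+ 2) pos1 pos2 => a b pos1 pos2.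
  move: (A ^+ 2) AA => A2 AA; move: k%:R k10 kA => kk k10 kA; move: K0%:R pos3 => KK pos3.
  clear - M0 B0 C0 H0 eta0 pos1 pos2 pos3 pos4 pos5 AA k10 kA => Xk'.
  by split; [lra..|split; [lra..|split; lra]].
have k0 : (0 < k)%N by rewrite -(ltr_nat R); clear - k10; lra.
have kK : (3 * K0 + 10 < k)%N by rewrite -(ltr_nat R) natrD natrM.
have A0 : 0 < A by clear - A10; lra.
clear X Xk.
have [h hE] : exists h, h = x - A ^+ 2 by exists (x - A ^+ 2).
have /andP[h1 h2] : - B <= h <= B.
  move: Ux; rewrite /Uset /= in_itv /= -AE => /andP[x1 x2].
  have [k1K k2K] := leq_half_pred kK.
  have e1 : eps_half c1 Q k.-1 <= eta by exact: K0P.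
  have e2 : eps_half c1 Q k <= eta by exact: K0P.
  have := HP ord0; have := HP ord_max; rewrite !ler_norml => /andP[? ?] /andP[? ?].
  by rewrite hE BE; apply/andP; split; clear N0 locQ exQ kappaP HP EP K0P lipC; lra.
apply: contrapT => nex.
have far i : 2 * delta <= `|2 * (x - A ^+ 2) - mu i - mu j|.
  have : delta <= `|x - (A ^+ 2 + (mu i + mu j) / 2)|.
    by rewrite leNgt AE; apply/negP => lt; apply: nex; exists i.
  have -> : x - (A ^+ 2 + (mu i + mu j) / 2) = (2 * (x - A ^+ 2) - mu i - mu j) / 2 by field.
  by rewrite normrM [`|2^-1|]ger0_norm ?invr_ge0// ler_pdivlMr// mulrC.
have muj := HP j; move: (muj); rewrite ler_norml => /andP[mj1 mj2].
(* the momenta just before and just after the branch j crosses x *)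
have cmM : `|h - mu j - eta| <= M.
  by rewrite ler_norml ME; apply/andP; split; clear - h1 h2 mj1 mj2 BE eta0; lra.
have cpM : `|h - mu j + eta| <= M.
  by rewrite ler_norml ME; apply/andP; split; clear - h1 h2 mj1 mj2 BE eta0; lra.
have [sm [sm0 smE smA]] := exists_momentum A0 cmM A10M.
have [sp [sp0 spE spA]] := exists_momentum A0 cpM A10M.
have {}smE : sm ^+ 2 = x - mu j - eta by rewrite smE hE; ring.
have {}spE : sp ^+ 2 = x - mu j + eta by rewrite spE hE; ring.
have [rm [tm [tmI smt]]] := quasimomentum sm; have [rp [tp [tpI spt]]] := quasimomentum sp.
have [n gapn] := gap_counting hlam gap xab.
have [_ below_m] := gapn tm tmI; have [lt_p _] := gapn tp tpI.
have Lx : L < x - 6 * eta.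
  by have := ler_norm L; clear - ALx h1 hE; lra.
(* some eigenvalue is within eta of the branch j, hence just below x, and the
   n-th one is the largest below x *)
have near_x : x - 2 * eta < lam tm n.
  have rmK : (K0 < `|rm|)%N by apply: (large_index_of_momentum tmI smt) k3K; rewrite -AE.
  have freeE : free_eigenvalue mu rm j tm = x - eta.
    by rewrite /free_eigenvalue -smt smE; ring.
  have [||l eigl] := exQ tm rm j tmI.
  - by apply/eqP => rm0; rewrite rm0 in rmK.
  - by rewrite freeE; clear - Lx eta0; lra.
  rewrite freeE => /andP[l1 l2]; have epsm : eps c1 Q rm <= eta by apply: K0P; exact: ltnW.
  have lx : l < x by clear - l2 epsm; lra.
  by have := below_m l eigl lx; clear - l1 epsm; lra.
(* an eigenvalue in this window would be within eta of some free branch, but all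
   free branches avoid the window *)
have far_x : lam tp n < x - 6 * eta.
  rewrite ltNge; apply/negP => l6.
  (* the localization is stated for the homotopy, whose end point 1 is Q *)
  have eigl : is_eigenvalue (homotopy Q 1) tp (lam tp n).
    by rewrite homotopy1; apply: eigenvalue_sequence_is_eigenvalue; exact: hlam.
  have [|k3 [i [_]]] := locQ tp 1 (lam tp n) tpI _ eigl (lt_le_trans Lx l6).
    by rewrite ler01 lexx.
  rewrite /free_eigenvalue => /andP[l1 l2].
  have mui := HP i; move: (mui); rewrite ler_norml => /andP[mi1 mi2].
  have eps3 : eps c1 Q k3 <= eta.
    apply: K0P; apply: (large_index tpI).
    by have := EP k3; have := ler_norm E0; clear - l1 l2 l6 h1 hE AK0 mi1 mi2; lra.
  have k3E : 2 * pi * k3%:~R + tp = sp + 2 * pi * (k3 - rp)%:~R.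
    by rewrite spt intrB; ring.
  have sep : mu i = mu j \/ kappa <= `|mu i - mu j|.
    by have [->|ij] := eqVneq i j; [left|right; exact: kappaP].
  have cpM' : `|x - mu j + eta - (pi * k%:R) ^+ 2| <= M.
    by have -> : x - mu j + eta - (pi * k%:R) ^+ 2 = h - mu j + eta by rewrite hE AE; ring.
  rewrite AE in MA AMe far; rewrite k3E in l1 l2.
  have := branch_avoids_window (k3 - rp) k0 sp0 spE cpM' MA AMe kbig muj mui eta0 etad etak
    sep (far i) l6 lt_p.
  rewrite leNgt => /negP; apply; rewrite ltr_norml.
  by apply/andP; split; clear - l1 l2 eps3; lra.
(* the n-th eigenvalue has moved by more than 4 eta, against its continuity *)
have shift : expi tm = expi (tp + (sm - sp)).
  have -> : tp + (sm - sp) = tm + 2 * pi * (rm - rp)%:~R by rewrite smt spt intrB; ring.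
  by rewrite expiD_2pi.
have := lipC tp tm (sm - sp) (lam tp) (lam tm) shift (hlam _ tpI) (hlam _ tmI) n.
have lB : lam tp n <= A ^+ 2 + B by clear - h2 hE lt_p; lra.
have := momentum_step A10 eta0 A20 A8 lB sm0 sp0 smA spA smE spE.
clear - near_x far_x; lra.
Qed.

Theorem corollary2 (R : realType) (m : nat) (hm : (0 < m)%N)
  (Q : R -> 'M[R[i]]_m)
  (hQherm : forall x : R, Q x \is hermsymmx)
  (hQL2 : forall (s r : 'I_m) (a b : R),
     square_integrable_on a b (fun x => Q x s r))
  (hQper : forall x : R, Q (x + 1) = Q x)
  (lam : R -> nat -> R)
  (hlam : forall t : R, - pi < t <= pi -> eigenvalue_sequence Q t (lam t))
  (p : nat) (mu : 'I_p.+1 -> R)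
  (hmu_lt : forall i j : 'I_p.+1, (i < j)%N -> mu i < mu j)
  (hmu : forall z : R[i], eigenvalue (mean Q) z <-> exists j, z = (mu j)%:C)
  (c1 : R) (hc1 : localization_constant Q mu c1) :
  exists (N3 : nat) (gamma : nat -> R),
    gamma @ \oo --> (0 : R) /\
    forall k : nat, (N3 < k)%N ->
      forall alpha beta : R, spectral_gap lam alpha beta ->
        `]alpha, beta[ `<=` Uset Q mu c1 k ->
        `]alpha, beta[ `<=` \bigcap_(j in [set: 'I_p.+1]) Sset mu gamma j k.
Proof.
pose near (d : R) (k : nat) := forall alpha beta x, spectral_gap lam alpha beta ->
  alpha < x < beta -> Uset Q mu c1 k x ->
  forall j, exists i, `|x - ((pi * k%:R) ^+ 2 + (mu i + mu j) / 2)| < d.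
have [N [gamma [gamma0 gammaP]]] := vanishing_sequence_of_eventually
  (P := near) (gap_near_crossing hQherm (fun s r => hQL2 s r 0 1) hlam hmu_lt hc1).
exists N, gamma; split=> // k Nk alpha beta gap gapU x xab j _.
have [|i xi] := gammaP k Nk alpha beta x gap _ (gapU x xab) j.
  by move: xab; rewrite /= in_itv.
exists i => //=; move: xi; rewrite in_itv ltr_norml => /andP[h1 h2] /=.
by apply/andP; split; lra.
Qed.
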